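(* For every real $x\ge 10^{9111}$ we have $B_1(x)\ge B_3(x)$.
   Context: For $j\in\{1,3\}$ and a positive integer $n$, let $b_j(n)=1$ if $n=X^2+jY^2$ for some integers $X,Y$, and $b_j(n)=0$ otherwise. Put $B_j(x)=\sum_{1\le n\le x}b_j(n)$. *)

(* Defs.v *)
From mathcomp Require Import all_boot all_order all_algebra.
From mathcomp Require Import boolp reals.
Set Implicit Arguments.
Unset Strict Implicit.
Unset Printing Implicit Defensive.
Import Order.TTheory GRing.Theory Num.Theory.
Local Open Scope ring_scope.

(* The boolean is coerced to [nat], giving 0 or 1. *)
Definition b (j n : nat) : nat :=
  `[< exists X Y : int, n%:Z = X ^+ 2 + j%:Z * Y ^+ 2 >].

(* [Num.truncn x] is the floor of [x] for [0 <= x] and 0 for [x < 0], so the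
   index runs over exactly the naturals [n] with [1 <= n <= x]. *)
Definition B (R : realType) (j : nat) (x : R) : nat :=
  (\sum_(1 <= n < (Num.truncn x).+1) b j n)%N.

(* Main.v *)
Require Import Defs.
From Stdlib Require Import ZArith.
From mathcomp Require Import all_boot all_order all_algebra.
From mathcomp Require Import boolp reals.
From mathcomp Require Import exp finfield ring lra zify ssrZ.

(** Attach the modulus q = 4 to the form X^2 + Y^2 and q = 3 to X^2 + 3 Y^2, and call a prime p
    inert when p = -1 mod q. Let f_q be the indicator of the integers in which every inert prime
    has an even exponent, and C_q its summatory function. Every n with f_4 n = 1 is a sum of two
    squares, and every n of the form X^2 + 3 Y^2 satisfies f_3 n = 1. Hence it is enough to prove
    C_3 N <= C_4 N. By Landau, C_q N is asymptotic to k_q N / sqrt (ln N), where k_4 / k_3 is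
    about 1.2. This margin allows every estimate below to lose several percent, so that an
    elementary argument with explicit constants suffices: all sums are finite, and the only fact
    from analysis is ln (1 + x) <= x. Write L = ln N.

    Logarithmic means. Let Lam_f be the arithmetic function with f ln = f * Lam_f (Dirichlet
    convolution); it satisfies 2 Lam_f = Mangoldt (1 + chi) + Lam_h, where chi is the quadratic
    character modulo q and Lam_h lives on the even powers of inert primes and on the powers of the
    ramified prime. Mertens' method
    ([mertens_f_bounds]) gives sum_(d <= n) Lam_f d / d = ln n / 2 + O(1). Put
    M N = sum_(m <= N) f m / m and W N = sum_(m <= N) (f m / m) ln (N / m). Then
    |L M - 3/2 W| <= 8 M ([Mf_Wf]). As M is the derivative of W with respect to L, this is a
    differential inequality for W. Hence W^2 / (L - 8)^3 decreases and W^2 / (L + 9)^3 increases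
    ([Wf_growth_le], [Wf_growth_ge]).

    The ratio of the two forms. Since f * f = (1 * chi) * h, where h is supported on squares and on
    squares times the ramified prime, the sum S_q N = sum_(n <= N) ((f * f) n / n) ln (N / n) is
    asymptotic to L(1, chi) (sum h d / d) L^2 / 2. Partial sums give numerical bounds for this
    constant, from above for q = 3 ([Sff3_le]) and from below for q = 4 ([Sff4_ge]). An inequality
    W_4 <= kappa W_3 valid from some point on passes to S_4 <= kappa^2 S_3 + O(L)
    ([Sff_compare]), so kappa^2 is at least the quotient of the two constants. By the growth
    lemmas, the ratio of W_4 to W_3 at a single large N controls all larger arguments; so already
    at N this ratio is not much less than its limit. The result is M_4 N >= 7/6 M_3 N as soon as
    L >= 17000 ([Mf_ratio]).

    Chebyshev bounds. For psi_f n = sum_(d <= n) Lam_f d the first paragraph predicts n / 2. For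
    n >= 10^12 one has psi_f 4 n >= 0.467 (n + 1) and psi_f 3 n <= 0.532 n ([psi_f4_ge],
    [psi_f3_le]). These come from Chebyshev's method with the coefficients mu d for d <= 170 for
    the Mangoldt function and mu d chi d for its twist. The defect of both combinations is
    compared with an explicit step function; a computation does this for arguments up to 12000,
    and the number of coefficients gives a bound for the other arguments.

    Conclusion ([Cf_compare]). Fix Y about 10^12. On the one hand
      L C_4 N >= sum_(n <= N) f_4 n ln n = sum_(m <= N) f_4 m psi_f 4 (N / m)
              >= 0.467 N M_4 (N / Y).
    On the other hand L C_3 N is at most 0.532 N M_3 N + 5 N (M_3 N - M_3 (N / Y)) up to a
    negligible term. The differences M N - M (N / Y) are of relative size ln Y / L by [Mf_Wf]
    ([Mf_tail]), which is small because L >= 17000. Finally 0.467 * 7/6 exceeds 0.532 by enough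
    to pay for them. *)

Set Implicit Arguments.
Unset Strict Implicit.
Unset Printing Implicit Defensive.
Import Order.TTheory GRing.Theory Num.Theory.
Local Open Scope ring_scope.
Delimit Scope Z_scope with BZ.
Local Open Scope nat_scope.

(** * Integers represented by the two forms *)

(** The elements moved by an involution come in pairs. *)
Lemma odd_card_fixed (T : finType) (f : T -> T) (A : {set T}) :
  {in A, forall x, f x \in A} -> {in A, forall x, f (f x) = x} ->
  odd #|A| = odd #|[set x in A | f x == x]|.
Proof.
elim: {A}_.+1 {-2}A (ltnSn #|A|) => // m IH A leAm fA fK.
case: (pickP [pred x in A | f x != x]) => [x /= /andP[xA fx]|nofix]; last first.
  suff -> : [set x in A | f x == x] = A by []; apply/setP=> x; rewrite inE.
  by move: (nofix x) => /=; case: (x \in A) => //= /negbFE ->.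
have fxA := fA _ xA.
pose A' := A :\ x :\ f x.
have cA : #|A| = #|A'|.+2.
  by rewrite (cardsD1 x A) xA (cardsD1 (f x) (A :\ x)) !inE fx fxA.
have inA' y : y \in A' -> [/\ y \in A, y != x & y != f x].
  by rewrite !inE => /and3P[].
rewrite cA /= negbK (IH A'); first last.
- by move=> y /inA'[yA _ _]; apply: fK.
- move=> y /inA'[yA yx yfx]; rewrite !inE fA // andbT; apply/andP; split.
    by apply: contra yx => /eqP e; rewrite -(fK y) // e fK.
  by apply: contra yfx => /eqP <-; rewrite fK.
- by rewrite cA in leAm; lia.
suff -> : [set y in A' | f y == y] = [set y in A | f y == y] by [].
apply/setP=> y; rewrite !inE.
case: (eqVneq y (f x)) => [->|_] /=; first by rewrite fK // eq_sym (negbTE fx) andbF.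
by case: (eqVneq y x) => [->|_] /=; rewrite ?(negbTE fx) ?andbF.
Qed.

Lemma prime_sqrF x : prime (x ^ 2) = false.
Proof.
apply/negP=> /primeP[x1 /(_ x)]; rewrite dvdn_exp //; move=> /(_ isT) /orP[]/eqP; nia.
Qed.

(** Zagier's involution on the triples with x^2 + 4 y z = p. *)
Definition zagier_map (t : nat * nat * nat) : nat * nat * nat :=
  let: (x, y, z) := t in
  if x + z < y then (x + z.*2, z, y - x - z)
  else if x < y.*2 then (y.*2 - x, y, x + z - y)
  else (x - y.*2, x + z - y, y).

Lemma zagier_mapE p x y z (pp : prime p) : x ^ 2 + 4 * (y * z) = p ->
  let: (x', y', z') := zagier_map (x, y, z) in
  x' ^ 2 + 4 * (y' * z') = p /\ zagier_map (x', y', z') = (x, y, z).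
Proof.
move=> def_p.
have y0 : 0 < y.
  rewrite lt0n; apply/negP => /eqP y0; move: pp; rewrite -def_p y0 mul0n muln0 addn0.
  by rewrite prime_sqrF.
have z0 : 0 < z.
  rewrite lt0n; apply/negP => /eqP y0'; move: pp; rewrite -def_p y0' !muln0 addn0.
  by rewrite prime_sqrF.
have x0 : 0 < x.
  rewrite lt0n; apply/negP => /eqP x0; move: pp; rewrite -def_p x0 add0n.
  by move/primeP=> [h1 /(_ 2)]; rewrite dvdn_mulr // => /(_ isT) /orP[]/eqP; nia.
have n1 : x + z <> y.
  move=> e; move: pp; have -> : p = (y + z) ^ 2 by rewrite -def_p -e; ring.
  by rewrite prime_sqrF.
have n2 : x <> y.*2.
  move=> e; move: pp; have -> : p = y * (4 * (y + z)) by rewrite -def_p e -mul2n; ring.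
  by move/primeP=> [h1 /(_ 4)]; rewrite mulnCA dvdn_mulr // => /(_ isT) /orP[]/eqP; nia.
rewrite /zagier_map.
case: ltnP => h1.
  have [k ?] : exists k, y = x + z + k by exists (y - x - z); lia.
  subst y.
  have -> : x + z + k - x - z = k by lia.
  split; first by rewrite -def_p -mul2n; ring.
  case: ltnP => h2; first by lia.
  case: ltnP => h3; first by lia.
  by congr (_, _, _); lia.
case: ltnP => h2.
  have [k ?] : exists k, z = y + k - x by exists (x + z - y); lia.
  have [l ?] : exists l, y.*2 = x + l by exists (y.*2 - x); lia.
  have -> : y.*2 - x = l by lia.
  have -> : x + z - y = k by lia.
  split; first by nia.
  case: ltnP => h3; first by lia.
  case: ltnP => h4; last by lia.
  by congr (_, _, _); lia.
have [k ?] : exists k, x = y.*2 + k by exists (x - y.*2); lia.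
subst x; have -> : y.*2 + k - y.*2 = k by lia.
split.
  have -> : y.*2 + k + z - y = y + k + z by lia.
  by rewrite -def_p -mul2n; ring.
by case: ltnP => h3; [congr (_, _, _)|]; lia.
Qed.

(** Zagier's proof: his involution has the single fixed point (1, 1, p / 4), so the number of
    triples with x^2 + 4 y z = p is odd, and the involution exchanging y and z has a fixed point
    as well. *)
Lemma sum_two_squares_prime p : prime p -> p %% 4 = 1 ->
  exists a b, p = a ^ 2 + b ^ 2.
Proof.
move=> pp p41; pose T := ('I_p.+1 * 'I_p.+1 * 'I_p.+1)%type.
pose toN (t : T) : nat * nat * nat := (t.1.1 : nat, t.1.2 : nat, t.2 : nat).
pose ofN (t : nat * nat * nat) : T := (inord t.1.1, inord t.1.2, inord t.2).
pose good (t : nat * nat * nat) := t.1.1 ^ 2 + 4 * (t.1.2 * t.2) == p.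
have ofNK t : good t -> toN (ofN t) = t.
  case: t => [[x y] z]; rewrite /good /= => /eqP e.
  have y0 : 0 < y.
    rewrite lt0n; apply/negP => /eqP y0; move: pp; rewrite -e y0 mul0n muln0 addn0.
    by rewrite prime_sqrF.
  have z0 : 0 < z.
    rewrite lt0n; apply/negP => /eqP y0'; move: pp; rewrite -e y0' !muln0 addn0.
    by rewrite prime_sqrF.
  by rewrite /toN /= !inordK //; nia.
have toNK t : ofN (toN t) = t by case: t => [[x y] z]; rewrite /ofN /= !inord_val.
pose A : {set T} := [set t | good (toN t)].
pose f t := ofN (zagier_map (toN t)).
pose g (t : T) : T := (t.1.1, t.2, t.1.2).
have zag t : good t -> good (zagier_map t) /\ zagier_map (zagier_map t) = t.
  case: t => [[x y] z] /eqP /(zagier_mapE pp).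
  by case: (zagier_map _) => [[x' y'] z'] [e1 e2]; split=> //; apply/eqP.
have p1 := prime_gt1 pp.
have oddA : odd #|A|.
  rewrite (@odd_card_fixed _ f); first last.
  - by move=> t; rewrite inE /f => /zag[gd e]; rewrite ofNK // e toNK.
  - by move=> t; rewrite inE /f => /zag[gd e]; rewrite inE ofNK.
  (* the fixed point of the involution *)
  pose u := (1, 1, p %/ 4).
  have gu : good u by rewrite /good /u /=; apply/eqP; lia.
  suff -> : [set x in A | f x == x] = [set ofN u] by rewrite cards1.
  apply/setP=> t; rewrite !inE; apply/andP/eqP => [[gt /eqP ft]|->]; last first.
    rewrite ofNK // gu; split=> //; apply/eqP.
    rewrite /f ofNK //; congr ofN; rewrite /u /zagier_map.
    by case: ltnP => h1; [lia|]; case: ltnP => h2; [|lia]; congr (_, _, _); lia.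
  rewrite -[t]toNK; congr ofN; have [gz _] := zag _ gt.
  have : zagier_map (toN t) = toN t by rewrite -{2}ft /f ofNK.
  move: gt gz; case: (toN t) => [[x y] z]; rewrite /good /zagier_map /u /= => /eqP gt _.
  case: ltnP => h1; [|case: ltnP => h2]; move=> /eqP; rewrite !xpair_eqE;
    case/andP=> /andP[/eqP e1 /eqP e2] /eqP e3.
  - move: pp; have -> : p = x ^ 2 by nia.
    by rewrite prime_sqrF.
  - have xy : x = y by lia.
    have : y %| p by rewrite -gt xy; apply: dvdn_add; [apply: dvdn_exp|rewrite dvdn_mull ?dvdn_mulr].
    case/primeP: pp => _ pp /pp /orP[/eqP y1|/eqP yp].
      by rewrite xy y1; congr (_, _, _); nia.
    by nia.
  - move: pp; have -> : p = x ^ 2 by nia.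
    by rewrite prime_sqrF.
have gA : {in A, forall t, g t \in A}.
  by move=> [[x y] z]; rewrite !inE /good /= [y * z]mulnC.
have gK : {in A, forall t, g (g t) = t} by move=> [[x y] z].
rewrite (odd_card_fixed gA gK) in oddA.
have : [set x in A | g x == x] != set0 by apply/negP=> /eqP e; rewrite e cards0 in oddA.
case/set0Pn=> [[[x y] z]]; rewrite !inE /good /g /= => /andP[/eqP e /eqP[ez]].
exists (x : nat), (2 * y)%N; apply: etrans (esym e) _; rewrite ez.
by congr (_ + _); ring.
Qed.

Definition even_on (I : pred nat) (n : nat) :=
  all (fun p => I p ==> ~~ odd (logn p n)) (primes n).

Lemma even_onP (I : pred nat) n : 0 < n ->
  reflect (forall p, prime p -> I p -> ~~ odd (logn p n)) (even_on I n).
Proof.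
move=> n0; apply: (iffP allP) => [h p pp Ip|h p].
  case: (boolP (p \in primes n)) => [/h|]; first by rewrite Ip.
  by rewrite -logn_gt0 lt0n negbK => /eqP ->.
by rewrite mem_primes => /and3P[pp _ _]; apply/implyP; apply: h.
Qed.

Lemma even_on_mul_prime (I : pred nat) p n : prime p -> 0 < n -> ~~ I p ->
  even_on I (p * n) = even_on I n.
Proof.
move=> pp n0 nI; apply/even_onP/even_onP => //; first by rewrite muln_gt0 prime_gt0.
  move=> h q pq Iq; have := h q pq Iq; rewrite lognM ?(prime_gt0 pp) // (logn_prime _ pp).
  by case: eqP => [e|//]; rewrite -e Iq in nI.
move=> h q pq Iq; rewrite lognM ?(prime_gt0 pp) // (logn_prime _ pp).
by case: eqP => [e|_]; [rewrite -e Iq in nI|apply: h].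
Qed.

Lemma even_on_mul_sqr (I : pred nat) m n : 0 < m -> 0 < n ->
  even_on I (m ^ 2 * n) = even_on I n.
Proof.
move=> m0 n0; have mn0 : 0 < m ^ 2 * n by rewrite muln_gt0 expn_gt0 m0.
by apply/even_onP/even_onP => // h q pq Iq; have := h q pq Iq;
  rewrite lognM ?expn_gt0 ?m0 // lognX oddD mul2n odd_double.
Qed.

(** The smallest prime factor p is removed. If p = 3 mod 4, then p^2 divides n and the square
    goes into both variables; otherwise p is a sum of two squares, and sums of two squares are
    closed under products. *)
Lemma even_on_sum_two_squares n : 0 < n -> even_on (fun p => p %% 4 == 3) n ->
  exists a b : int, (n%:Z = a ^+ 2 + b ^+ 2)%R.
Proof.
have [m] := ubnP n; elim: m n => // m IH n lt_n n0 h.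
have [n1|n1] := leqP n 1; first by exists 1%R, 0%R; have -> : n = 1 by lia.
have pp := pdiv_prime n1; have /dvdnP[k def_n] := pdiv_dvd n.
move: (pdiv n) pp def_n => p pp def_n; have p1 := prime_gt1 pp.
have k0 : 0 < k by rewrite lt0n; apply/eqP => k0; move: n0; rewrite def_n k0.
have lt_k : k < n by rewrite def_n; nia.
have [p3|p3] := boolP (p %% 4 == 3).
  have : ~~ odd (logn p n) by apply: (even_onP _ n0 h).
  rewrite def_n lognM ?(prime_gt0 pp) // (logn_prime _ pp) eqxx addn1 /= negbK => o.
  have /dvdnP[l def_k] : p %| k.
    by apply: contraTT o => npk; rewrite logn_coprime ?prime_coprime.
  have l0 : 0 < l by rewrite lt0n; apply/eqP => l0; move: k0; rewrite def_k l0.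
  have lm : l < m by nia.
  have hl : even_on (fun p => p %% 4 == 3) l.
    move: h; rewrite def_n def_k (_ : l * p * p = p ^ 2 * l); last by ring.
    by rewrite even_on_mul_sqr ?(prime_gt0 pp).
  have [a [b e]] := IH l lm l0 hl.
  exists (p%:Z * a)%R, (p%:Z * b)%R; rewrite def_k !PoszM e; ring.
have km : k < m by lia.
have hk : even_on (fun p => p %% 4 == 3) k by move: h; rewrite def_n mulnC even_on_mul_prime.
have [a [b e]] := IH k km k0 hk.
have [c [d ep]] : exists c d : nat, p = c ^ 2 + d ^ 2.
  case: (even_prime pp) => [->|o]; first by exists 1, 1.
  by apply: sum_two_squares_prime => //; move: p3 o; lia.
exists (a * c%:Z - b * d%:Z)%R, (a * d%:Z + b * c%:Z)%R.
have ep' : (p%:Z = c%:Z ^+ 2 + d%:Z ^+ 2)%R by rewrite ep PoszD !expnS !expn0 !muln1 !PoszM; ring.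
rewrite def_n PoszM e ep'; ring.
Qed.

(** If y were nonzero, -3 would be a square, which gives a primitive cube root of unity; this
    is impossible in the field with p elements when 3 does not divide p - 1, because then raising
    to the power p is not the identity on it. *)
Lemma sqr_m3_sqr p (x y : 'F_p) : prime p -> p %% 3 = 2 -> p != 2 ->
  (x ^+ 2 + 3%:R * y ^+ 2 = 0)%R -> y = 0%R.
Proof.
move=> pp p3 p2 e; apply/eqP/negPn/negP => y0.
have [k def_p] : exists k, p = 3 * k + 2 by exists (p %/ 3); lia.
have chp : p \in [pchar 'F_p]%R by apply: pchar_Fp.
have nz (m : nat) : ~~ (p %| m) -> (m%:R != 0 :> 'F_p)%R by rewrite (dvdn_pcharf chp).
have n2 : (2%:R != 0 :> 'F_p)%R.
  by apply: nz; apply/negP=> /dvdn_leq-/(_ isT); have := prime_gt1 pp; lia.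
have n3 : (3%:R != 0 :> 'F_p)%R.
  by apply: nz; apply/negP=> /(dvdn_leq (isT : 0 < 3)); have := prime_gt1 pp; lia.
pose w : 'F_p := ((x / y - 1) / 2%:R)%R.
have es : ((x / y) ^+ 2 = - 3%:R)%R.
  by rewrite expr_div_n (_ : x ^+ 2 = - 3%:R * y ^+ 2)%R; [field | move/eqP: e; rewrite addr_eq0 mulNr => /eqP].
have ew : (w ^+ 2 + w + 1 = 0)%R.
  have -> : (w ^+ 2 + w + 1 = ((x / y) ^+ 2 + 3%:R) / 4%:R)%R.
    by rewrite /w; field; rewrite n2 y0 /= (_ : 4 = 2 * 2)%N // natrM mulf_neq0.
  by rewrite es addNr mul0r.
have w3 : (w ^+ 3 = 1)%R.
  have : ((w - 1) * (w ^+ 2 + w + 1) = w ^+ 3 - 1)%R by ring.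
  by rewrite ew mulr0 => /eqP; rewrite eq_sym subr_eq0 => /eqP.
have w0 : (w != 0)%R by apply/eqP => w0; move/eqP: w3; rewrite w0 expr0n /= eq_sym oner_eq0.
have : (w ^+ (3 * k + 2) = w)%R.
  by rewrite -def_p -[in RHS](expf_card w) card_Fp.
rewrite exprD exprM w3 expr1n mul1r => w2.
have w1 : (w = 1)%R by apply: (mulfI w0); rewrite mulr1 -expr2.
move/eqP: ew; rewrite w1 expr1n (_ : 1 + 1 + 1 = 3%:R)%R ?(negbTE n3) //; ring.
Qed.

Lemma loeschian_prime_dvd p (X Y : int) : prime p -> p %% 3 = 2 -> p != 2 ->
  (p%:Z %| (X ^+ 2 + 3%:Z * Y ^+ 2)%R)%Z -> (p%:Z %| X)%Z && (p%:Z %| Y)%Z.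
Proof.
move=> pp p3 p2 dv; have chp : p \in [pchar 'F_p]%R by apply: pchar_Fp.
have dvF (z : int) : (p%:Z %| z)%Z = (z%:~R == 0 :> 'F_p)%R.
  by rewrite -(dvdz_pcharf chp).
have Y0 : (Y%:~R = 0 :> 'F_p)%R.
  apply: (@sqr_m3_sqr p X%:~R%R) => //; apply/eqP; move: dv.
  by rewrite dvF rmorphD rmorphM !rmorphXn.
move: dv; rewrite !dvF rmorphD rmorphM !rmorphXn /= Y0 expr0n mulr0 addr0 eqxx andbT.
by rewrite expf_eq0.
Qed.

Lemma int_parity (z : int) : exists i : int, (z = 2 * i \/ z = 2 * i + 1)%R.
Proof. by exists (z %/ 2)%Z; lia. Qed.

(** Descent: an inert prime dividing the value of the form divides both variables. This fails
    only for p = 2 with X and Y odd, and then the value is 4 modulo 8. *)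
Lemma loeschian_even_on (X Y : int) n : 0 < n -> (n%:Z = X ^+ 2 + 3%:Z * Y ^+ 2)%R ->
  even_on (fun p => p %% 3 == 2) n.
Proof.
move=> n0 e; apply/even_onP => // p pp /eqP p3.
have [m] := ubnP n; elim: m n X Y n0 e => // m IH n X Y n0 e lt_n.
have p1 := prime_gt1 pp.
have [pn|pn] := boolP (p %| n); last by rewrite logn_coprime ?prime_coprime.
have descent : (p%:Z %| X)%Z && (p%:Z %| Y)%Z -> ~~ odd (logn p n).
  case/andP=> /dvdzP[x eX] /dvdzP[y eY].
  have e' : (n%:Z = p%:Z ^+ 2 * (x ^+ 2 + 3%:Z * y ^+ 2))%R by rewrite e eX eY; ring.
  have [k ek] : exists k : nat, (k%:Z = x ^+ 2 + 3%:Z * y ^+ 2)%R.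
    have nn : (0 <= x ^+ 2 + 3%:Z * y ^+ 2)%R.
      by apply: addr_ge0; [|apply: mulr_ge0]; rewrite ?sqr_ge0.
    by exists `|(x ^+ 2 + 3%:Z * y ^+ 2)%R|%N; rewrite gez0_abs.
  have def_n : n = p ^ 2 * k.
    by apply/eqP; rewrite -eqz_nat e' -ek PoszM expnS expn1 PoszM expr2.
  have k0 : 0 < k by rewrite lt0n; apply/eqP => k0; move: n0; rewrite def_n k0 muln0.
  rewrite def_n lognM ?expn_gt0 ?(ltnW p1) // lognX logn_prime // eqxx /= negbK.
  apply: (IH k x y) => //; rewrite def_n in lt_n.
  have p4 : 4 <= p ^ 2 by rewrite (leq_exp2r 2 p (isT : 0 < 2)).
  have : 4 * k <= p ^ 2 * k by rewrite leq_mul2r p4 orbT.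
  by lia.
have [p2|p2] := eqVneq p 2; last first.
  by apply: descent; apply: loeschian_prime_dvd => //; rewrite -e.
have [y ey] := int_parity Y.
have [x ex] := int_parity X.
have [k ek] : exists k, n = 2 * k by case/dvdnP: pn => k ->; exists k; rewrite p2 mulnC.
have ed : (Y = 2 * y /\ X = 2 * x \/ Y = 2 * y + 1 /\ X = 2 * x + 1)%R.
  have e2 : (n%:Z = X * X + 3 * (Y * Y))%R by rewrite e; ring.
  case: ey ex => eY [] eX; [by left| | |by right]; exfalso; move: e2; rewrite ek eX eY; lia.
case: ed => [[eY eX]|[eY eX]].
  apply: descent; apply/andP; rewrite p2; split; apply/dvdzP; [exists x|exists y];
    by rewrite ?eX ?eY mulrC.
have [l el] : exists l, n = 4 * (2 * l + 1).
  have half (z : int) : exists j : int, (z * (z + 1) = 2 * j)%R.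
    have [i [->|->]] := int_parity z.
      by exists (i * (2 * i + 1))%R; ring.
    by exists ((2 * i + 1) * (i + 1))%R; ring.
  have [j ej] := half x; have [j' ej'] := half y.
  have e4 : (n%:Z = 8 * j + 24 * j' + 4)%R.
    have -> : (8 * j + 24 * j' + 4 = 4 * (2 * j) + 12 * (2 * j') + 4 :> int)%R by ring.
    by rewrite -ej -ej' e eX eY; ring.
  by exists `|(j + 3 * j')%R|%N; move: e4 n0; clear; lia.
have o : logn 2 (2 * l + 1) = 0 by rewrite logn_coprime // coprime2n; lia.
have l0 : 0 < 2 * l + 1 by rewrite addn1.
by rewrite el p2 lognM // o.
Qed.

(** * Dirichlet convolution and logarithmic derivatives *)

Local Open Scope ring_scope.

Section DirichletConvolution.
Variable R : comNzRingType.
Implicit Types (a b c : nat -> R) (n N d : nat).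

(** The key to exchanging a sum over n with a sum over the divisors of n. *)
Lemma sum_multiples (V : nmodType) (G : nat -> V) N d : (0 < d)%N ->
  \sum_(1 <= n < N.+1 | (d %| n)%N) G n = \sum_(1 <= k < (N %/ d).+1) G (d * k)%N.
Proof.
move=> d0; elim: N => [|N IH]; first by rewrite div0n !big_geq.
rewrite big_mkcond big_nat_recr //= -big_mkcond IH divnS //.
case: (boolP (d %| N.+1)%N) => [dN|_]; last by rewrite addr0 add0n.
rewrite add1n [in RHS]big_nat_recr //=; congr (_ + G _).
by have := divnK dN; rewrite divnS // dN add1n mulnC.
Qed.

Lemma sum_divisors (V : nmodType) (G : nat -> V) N n : (0 < n <= N)%N ->
  \sum_(d <- divisors n) G d = \sum_(1 <= d < N.+1 | (d %| n)%N) G d.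
Proof.
move=> /andP[n0 nN]; rewrite -[RHS]big_filter; apply: perm_big.
apply: uniq_perm; rewrite ?divisors_uniq ?filter_uniq ?iota_uniq // => d.
rewrite mem_filter mem_index_iota -dvdn_divisors //.
case: (boolP (d %| n)%N) => //= dn; rewrite (dvdn_gt0 n0 dn) ltnS.
by rewrite (leq_trans (dvdn_leq n0 dn)).
Qed.

Lemma sum_divisor_pairs (V : nmodType) (F : nat -> nat -> V) N :
  \sum_(1 <= n < N.+1) \sum_(d <- divisors n) F d (n %/ d)%N =
  \sum_(1 <= d < N.+1) \sum_(1 <= k < (N %/ d).+1) F d k.
Proof.
under eq_big_nat => n /andP[n0 nN].
  rewrite (@sum_divisors _ _ N); last by rewrite n0 -ltnS.
  over.
rewrite (exchange_big_dep_nat predT) //=; apply: eq_big_nat => d /andP[d0 _].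
rewrite (@sum_multiples _ (fun n => F d (n %/ d)%N)) //.
by apply: eq_bigr => k _; rewrite mulKn.
Qed.

Definition conv a b n := \sum_(d <- divisors n) a d * b (n %/ d)%N.

Lemma mem_divisors_gt0 n d : d \in divisors n -> (0 < d)%N.
Proof.
case: n => [|n]; first by rewrite inE => /eqP ->.
by rewrite -dvdn_divisors // => /dvdn_gt0 ->.
Qed.

Lemma mem_divisors_div_gt0 n d : d \in divisors n -> (0 < n)%N -> (0 < n %/ d)%N.
Proof.
move=> dn n0; have d0 := mem_divisors_gt0 dn.
by rewrite divn_gt0 //; apply: dvdn_leq; rewrite // dvdn_divisors.
Qed.

Lemma eq_conv a a' b b' n : (0 < n)%N -> (forall m, (0 < m)%N -> a m = a' m) ->
  (forall m, (0 < m)%N -> b m = b' m) -> conv a b n = conv a' b' n.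
Proof.
move=> n0 ea eb; apply: eq_big_seq => d dn.
by rewrite ea ?eb ?(mem_divisors_gt0 dn) ?mem_divisors_div_gt0.
Qed.

Lemma sum_conv_weight a b (g : nat -> R) N :
  \sum_(1 <= n < N.+1) conv a b n * g n =
  \sum_(1 <= d < N.+1) a d * \sum_(1 <= k < (N %/ d).+1) b k * g (d * k)%N.
Proof.
under [RHS]eq_bigr do rewrite mulr_sumr.
rewrite -(@sum_divisor_pairs _ (fun d k => a d * (b k * g (d * k)%N))).
apply: eq_big_nat => n /andP[n0 _]; rewrite mulr_suml; apply: eq_big_seq => d dn.
by rewrite mulrA mulnC divnK // dvdn_divisors.
Qed.

Lemma sum_conv a b N : \sum_(1 <= n < N.+1) conv a b n =
  \sum_(1 <= d < N.+1) a d * \sum_(1 <= k < (N %/ d).+1) b k.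
Proof.
under [RHS]eq_bigr do rewrite mulr_sumr.
by rewrite -(@sum_divisor_pairs _ (fun d k => a d * b k)).
Qed.

Lemma divKdvdn n d : (0 < n)%N -> (d %| n)%N -> (n %/ (n %/ d))%N = d.
Proof. by move=> n0 dn; rewrite divnA // mulKn. Qed.

Lemma convC a b n : (0 < n)%N -> conv a b n = conv b a n.
Proof.
move=> n0; rewrite /conv; have pd : perm_eq (divisors n) [seq (n %/ d)%N | d <- divisors n].
  have inj : {in divisors n &, injective (fun d => n %/ d)%N}.
    move=> d e; rewrite -!dvdn_divisors // => dn en h.
    by rewrite -(divKdvdn n0 dn) h divKdvdn.
  apply: uniq_perm; rewrite ?map_inj_in_uniq ?divisors_uniq //.
  move=> d; rewrite -dvdn_divisors //; apply/idP/mapP => [dn|[e]].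
    by exists (n %/ d)%N; rewrite -?dvdn_divisors ?dvdn_div ?divKdvdn.
  by rewrite -dvdn_divisors // => en ->; rewrite dvdn_div.
rewrite (perm_big _ pd) big_map; apply: eq_big_seq => d dn.
by rewrite divKdvdn 1?mulrC // dvdn_divisors.
Qed.

Lemma eq_of_sums a b : (forall N, \sum_(1 <= n < N.+1) a n = \sum_(1 <= n < N.+1) b n) ->
  forall n, (0 < n)%N -> a n = b n.
Proof.
move=> e [//|n] _; have := e n.+1; rewrite !(@big_nat_recr _ _ _ n.+1) //= e.
by move/addrI.
Qed.

(** Two functions with the same summatory function agree, and for summatory functions
    associativity reduces to (N / d) / k = N / (d k). *)
Lemma convA a b c n : (0 < n)%N -> conv (conv a b) c n = conv a (conv b c) n.
Proof.
move: n; apply: eq_of_sums => N; rewrite !sum_conv.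
rewrite (sum_conv_weight a b (fun d => \sum_(1 <= k < (N %/ d).+1) c k)).
apply: eq_bigr => d _; congr (_ * _); rewrite sum_conv.
by apply: eq_bigr => k _; rewrite divnMA.
Qed.

Lemma convDl a b c n : conv (fun n => a n + b n) c n = conv a c n + conv b c n.
Proof. by rewrite /conv -big_split; apply: eq_bigr => d _; rewrite mulrDl. Qed.

(** In terms of Dirichlet series, La is minus the logarithmic derivative of a, when l is the
    logarithm. *)
Definition log_deriv (l : nat -> R) (La a : nat -> R) :=
  forall n, (0 < n)%N -> a n * l n = conv La a n.

(** The product rule: multiplication by a logarithm is a derivation of the convolution
    algebra. *)
Lemma log_deriv_conv (l La Lb a b : nat -> R) :
  (forall m n, (0 < m)%N -> (0 < n)%N -> l (m * n)%N = l m + l n) ->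
  log_deriv l La a -> log_deriv l Lb b ->
  log_deriv l (fun n => La n + Lb n) (conv a b).
Proof.
move=> lM ha hb n n0; rewrite convDl.
have -> : conv La (conv a b) n = conv (fun n => a n * l n) b n.
  by rewrite -convA //; apply: eq_conv => // m m0; rewrite ha.
have -> : conv Lb (conv a b) n = conv a (fun n => b n * l n) n.
  rewrite (eq_conv n0 (fun _ _ => erefl) (fun m m0 => convC a b m0)).
  rewrite -convA // convC //; apply: eq_conv => // m m0; rewrite hb //.
rewrite /conv -big_split mulr_suml; apply: eq_big_seq => d dn /=.
have -> : l n = l d + l (n %/ d)%N.
  by rewrite -lM ?(mem_divisors_gt0 dn) ?mem_divisors_div_gt0 // mulnC divnK // dvdn_divisors.
ring.
Qed.

Lemma conv_head (L a : nat -> R) n : (1 < n)%N -> L 1%N = 0 ->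
  conv L a n = \sum_(d <- divisors n | d != 1%N) L d * a (n %/ d)%N.
Proof.
move=> n1 L1; rewrite /conv (bigID (fun d => d == 1%N)) /= big1 ?add0r // => d /eqP ->.
by rewrite L1 mul0r.
Qed.
End DirichletConvolution.

Section LogDeriv.
Variable R : realType.
Implicit Types (a b c L : nat -> R) (n N d p k : nat).

Definition lnn n : R := ln n%:R.

Lemma lnnM m n : (0 < m)%N -> (0 < n)%N -> lnn (m * n) = lnn m + lnn n.
Proof. by move=> m0 n0; rewrite /lnn natrM lnM ?posrE ?ltr0n. Qed.

Lemma lnn_gt0 n : (1 < n)%N -> 0 < lnn n.
Proof. by move=> n1; rewrite /lnn ln_gt0 // ltr1n. Qed.

Lemma lnn_ge0 n : 0 <= lnn n.
Proof. by case: n => [|n]; [rewrite /lnn ln0|rewrite /lnn ln_ge0 // ler1n]. Qed.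

Lemma div_divisor_lt n d : (0 < n)%N -> d \in divisors n -> d != 1%N -> (n %/ d < n)%N.
Proof.
by move=> n0 dn d1; rewrite ltn_Pdiv //; have := mem_divisors_gt0 dn; lia.
Qed.

(** Since L 1 = 0, the identity a n ln n = (L * a) n computes a n from smaller arguments. *)
Lemma log_deriv_inj L a b : L 1%N = 0 -> log_deriv lnn L a -> log_deriv lnn L b ->
  a 1%N = b 1%N -> forall n, (0 < n)%N -> a n = b n.
Proof.
move=> L1 ha hb ab1 n; have [m] := ubnP n; elim: m n => // m IH n ltn n0.
have [n1|n1] := leqP n 1; first by have -> : n = 1%N by lia.
apply: (mulIf (lt0r_neq0 (lnn_gt0 n1))); rewrite ha // hb // !conv_head //.
rewrite big_seq_cond [RHS]big_seq_cond; apply: eq_bigr => d /andP[dn d1].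
by congr (_ * _); apply: IH; rewrite ?mem_divisors_div_gt0 //; have := div_divisor_lt n0 dn d1; lia.
Qed.

Lemma log_deriv_ge0 L a : L 1%N = 0 -> log_deriv lnn L a -> 0 <= a 1%N ->
  (forall n, 0 <= L n) -> forall n, (0 < n)%N -> 0 <= a n.
Proof.
move=> L1 ha a1 L0 n; have [m] := ubnP n; elim: m n => // m IH n ltn n0.
have [n1|n1] := leqP n 1; first by have -> : n = 1%N by lia.
rewrite -(pmulr_lge0 _ (lnn_gt0 n1)) ha // conv_head // big_seq_cond.
apply: sumr_ge0 => d /andP[dn d1]; apply: mulr_ge0 => //.
by apply: IH; rewrite ?mem_divisors_div_gt0 //; have := div_divisor_lt n0 dn d1; lia.
Qed.

(** Equal to g p k at the prime power p^k, and to 0 elsewhere. *)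
Definition Lam (g : nat -> nat -> R) n : R :=
  \sum_(p <- primes n) (if n == (p ^ logn p n)%N then g p (logn p n) else 0).

Lemma Lam1 g : Lam g 1 = 0.
Proof. by rewrite /Lam big_nil. Qed.

Lemma sum_Lam_divisors g (h : nat -> R) n : (0 < n)%N ->
  \sum_(d <- divisors n) Lam g d * h d =
  \sum_(p <- primes n) \sum_(1 <= k < (logn p n).+1) g p k * h (p ^ k)%N.
Proof.
move=> n0.
have step d : d \in divisors n -> Lam g d * h d =
    \sum_(p <- primes n | (p \in primes d) && (d == p ^ logn p d)%N) g p (logn p d) * h d.
  move=> dn; have d0 := mem_divisors_gt0 dn.
  rewrite /Lam mulr_suml.
  have -> : \sum_(p <- primes d) (if d == (p ^ logn p d)%N then g p (logn p d) else 0) * h d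
      = \sum_(p <- primes d | d == (p ^ logn p d)%N) g p (logn p d) * h d.
    by rewrite [RHS]big_mkcond; apply: eq_bigr => p _; case: ifP; rewrite ?mul0r.
  rewrite -[in LHS]big_filter -[in RHS]big_filter; apply: perm_big; apply: uniq_perm;
    rewrite ?filter_uniq ?primes_uniq // => p; rewrite !mem_filter andbC.
  case: eqP => _; rewrite ?andbF ?andbT //= mem_primes.
  rewrite mem_primes n0 d0 /=; case: (prime p) => //=; case: (boolP (p %| d)%N) => //= pd.
  by rewrite (dvdn_trans pd) // dvdn_divisors.
rewrite (eq_big_seq _ step) (exchange_big_dep predT) //=; apply: eq_big_seq => p.
rewrite mem_primes => /and3P[pp _ pn]; have p1 := prime_gt1 pp; have p0 := ltnW p1.
have pm : perm_eq [seq d <- divisors n | (p \in primes d) && (d == p ^ logn p d)%N]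
    [seq (p ^ k)%N | k <- index_iota 1 (logn p n).+1].
  apply: uniq_perm; rewrite ?filter_uniq ?divisors_uniq //.
    rewrite map_inj_uniq ?iota_uniq // => k l /eqP; rewrite eqn_exp2l //.
    by move/eqP.
  move=> d; rewrite mem_filter -dvdn_divisors //; apply/idP/mapP.
    case/andP=> /andP[+ /eqP ed] dn; rewrite mem_primes => /and3P[_ d0 pd].
    exists (logn p d) => //; rewrite mem_index_iota ltnS logn_gt0 mem_primes pp d0 pd.
    by rewrite dvdn_leq_log.
  case=> k; rewrite mem_index_iota ltnS => /andP[k0 kl] ->.
  by rewrite mem_primes pp expn_gt0 p0 dvdn_exp //= pfactorK // eqxx pfactor_dvdn.
rewrite -big_filter (perm_big _ pm) big_map; apply: eq_bigr => k _.
by rewrite pfactorK.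
Qed.

Lemma lnn_prod (s : seq nat) (F : nat -> nat) : (forall p, p \in s -> (0 < F p)%N) ->
  lnn (\prod_(p <- s) F p) = \sum_(p <- s) lnn (F p).
Proof.
elim: s => [|p s IH] hs; first by rewrite !big_nil /lnn ln1.
have hs' q : q \in s -> (0 < F q)%N by move=> qs; apply: hs; rewrite inE qs orbT.
rewrite !big_cons lnnM ?IH ?hs ?mem_head //.
by rewrite big_seq prodn_cond_gt0.
Qed.

Lemma lnnX m n : lnn (m ^ n) = n%:R * lnn m.
Proof.
case: m => [|m]; last by rewrite /lnn natrX lnXn ?ltr0n // mulr_natl.
by case: n => [|n]; rewrite ?expn0 ?exp0n // /lnn ?ln1 ?ln0 ?mul0r ?mulr0.
Qed.

Lemma lnn_primes n : (0 < n)%N -> lnn n = \sum_(p <- primes n) (logn p n)%:R * lnn p.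
Proof.
move=> n0; rewrite {1}[n]prod_prime_decomp // prime_decompE big_map /= lnn_prod.
  by apply: eq_bigr => p _; rewrite lnnX.
by move=> p; rewrite mem_primes expn_gt0 => /and3P[/prime_gt0 ->].
Qed.

(** The one shape shared by the indicators f and h, so that their logarithmic derivatives are
    computed together. *)
Definition adm (J I : pred nat) n : bool :=
  all (fun p => ~~ J p && (I p ==> ~~ odd (logn p n))) (primes n).

Lemma admP (J I : pred nat) n : (0 < n)%N ->
  reflect (forall p, prime p -> (0 < logn p n)%N -> ~~ J p && (I p ==> ~~ odd (logn p n)))
          (adm J I n).
Proof.
move=> n0; apply: (iffP allP) => h p.
  by move=> pp; rewrite logn_gt0; apply: h.
by rewrite -logn_gt0 => pn; apply: h => //; move: pn; rewrite logn_gt0 mem_primes => /and3P[].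
Qed.

Lemma adm_split (J I : pred nat) p j m : prime p -> (0 < m)%N -> ~~ (p %| m)%N ->
  adm J I (p ^ j * m) = ((j == 0%N) || (~~ J p && (I p ==> ~~ odd j))) && adm J I m.
Proof.
move=> pp m0 pm; have p0 := prime_gt0 pp.
have lp : logn p (p ^ j * m) = j.
  by rewrite lognM ?expn_gt0 ?p0 // pfactorK // logn_coprime ?prime_coprime // addn0.
have lq q : prime q -> q != p -> logn q (p ^ j * m) = logn q m.
  by move=> qp qNp; rewrite lognM ?expn_gt0 ?p0 // lognX (logn_prime _ pp) (negbTE qNp) muln0.
have pjm0 : (0 < p ^ j * m)%N by rewrite muln_gt0 expn_gt0 p0.
apply/admP/andP => // [h|[hp /admP-/(_ m0) h] q pq].
  split; first by case: (posnP j) => //= j0; have := h p pp; rewrite lp; apply.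
  apply/admP => // q pq; have [->|qNp] := eqVneq q p; first by rewrite logn_coprime ?prime_coprime.
  by have := h q pq; rewrite lq.
have [->|qNp] := eqVneq q p; last by rewrite lq //; apply: h.
by rewrite lp lt0n; move: hp; case: eqP.
Qed.

(** The local factor at p of the Dirichlet series of [adm] is 1, (1 - p^(-2s))^(-1) or
    (1 - p^(-s))^(-1) in the three cases. *)
Definition adm_weight (J I : pred nat) p k : R :=
  if J p then 0 else if I p then (if odd k then 0 else 2 * lnn p) else lnn p.

Lemma sum_even_weight (x : R) v :
  \sum_(1 <= k < v.+1) (if odd k then 0 else 2 * x) = (v - odd v)%:R * x.
Proof.
elim: v => [|v IH]; first by rewrite big_geq // mul0r.
rewrite big_nat_recr //= IH {IH}.
case: (boolP (odd v)) => o; rewrite ?subn0 ?subn1 /= ?addr0 //.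
by case: v o => // v _ /=; rewrite -!natr1; ring.
Qed.

(** Prime by prime: if p^v exactly divides n, then the sum over the powers p^k of the weights,
    restricted to the k for which n / p^k is still admissible, is v ln p when n is admissible, and
    0 otherwise. *)
Lemma adm_log_deriv (J I : pred nat) :
  log_deriv lnn (Lam (adm_weight J I)) (fun n => (adm J I n)%:R).
Proof.
move=> n n0; rewrite /conv (@sum_Lam_divisors _ (fun d => (adm J I (n %/ d))%:R)) //.
rewrite lnn_primes // mulr_sumr; apply: eq_big_seq => p.
rewrite mem_primes => /and3P[pp _ pn]; have p0 := prime_gt0 pp.
have [m pm def_n] := pfactor_coprime pp n0; set v := logn p n in def_n *.
have m0 : (0 < m)%N by case: m def_n pm => // e; rewrite e in n0.
rewrite prime_coprime // in pm.
have v0 : (0 < v)%N by rewrite logn_gt0 mem_primes pp n0.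
have En k : (k <= v)%N -> (n %/ p ^ k = p ^ (v - k) * m)%N.
  move=> kv; rewrite def_n mulnC -{1}(subnK kv) expnD -mulnA [(p ^ k * m)%N]mulnC mulnA mulnK //.
  by rewrite expn_gt0 p0.
have -> : adm J I n = adm J I (p ^ v * m)%N by rewrite mulnC -def_n.
rewrite adm_split //.
under eq_big_nat => k /andP[k0 kv] do rewrite En // adm_split //.
rewrite eqn0Ngt v0 /= /adm_weight; case: (boolP (J p)) => Jp /=.
  by rewrite mul0r big1 // => k _; rewrite mul0r.
case: (boolP (I p)) => Ip /=; last first.
  under eq_bigr do rewrite orbT /=.
  by rewrite sumr_const_nat subSS subn0 -mulr_natl; ring.
transitivity ((~~ odd v && adm J I m)%:R * \sum_(1 <= k < v.+1) (if odd k then 0 else 2 * lnn p)).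
  by rewrite sum_even_weight; case: (boolP (odd v)) => o /=; rewrite ?mul0r ?subn0.
rewrite mulr_sumr; apply: eq_big_nat => k /andP[k0 kv].
case: (boolP (odd k)) => ok; first by rewrite mulr0 mul0r.
rewrite mulrC; congr (_ * (_ && _)%:R); rewrite oddB // (negbTE ok) addbF.
by case: eqP => // e; have -> : v = k by lia.
Qed.

Definition Mangoldt : nat -> R := Lam (fun p _ => lnn p).

Lemma Lam_ge0 g n : (forall p k, prime p -> 0 <= g p k) -> 0 <= Lam g n.
Proof.
move=> g0; rewrite /Lam big_seq; apply: sumr_ge0 => p; rewrite mem_primes => /and3P[pp _ _].
by case: ifP => // _; apply: g0.
Qed.

Lemma Mangoldt_ge0 n : 0 <= Mangoldt n.
Proof. by apply: Lam_ge0 => p k _; apply: lnn_ge0. Qed.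

Lemma Mangoldt_log_deriv : log_deriv lnn Mangoldt (fun=> 1).
Proof.
move=> n n0; have := @adm_log_deriv pred0 pred0 n n0.
rewrite (_ : adm pred0 pred0 n) /=; last by apply/allP.
move=> ->; apply: eq_conv => // m m0; last by rewrite (_ : adm pred0 pred0 m) //; apply/allP.
Qed.
End LogDeriv.

(** * The character and the multiplicative functions of a form *)

Definition inert (q : nat) : pred nat := fun n => (n %% q == q.-1)%N.
Definition split (q : nat) : pred nat := fun n => (n %% q == 1)%N.

Section Character.
Variables (R : realType) (q : nat).
Hypothesis q34 : q = 3%N \/ q = 4%N.
Implicit Types (n p k N : nat).

Definition chi n : R := (split q n)%:R - (inert q n)%:R.

Lemma modq_cases n : (n %% q)%N \in [:: 0; 1; 2; 3]%N.
Proof. by case: q34 => ->; rewrite !inE; lia. Qed.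

Lemma chiM m n : chi (m * n) = chi m * chi n.
Proof.
rewrite /chi /split /inert -modnMm.
have := modq_cases m; have := modq_cases n; rewrite !inE.
by case: q34 => ->; (case/or4P=> /eqP ->; case/or4P=> /eqP ->); rewrite /=; ring.
Qed.

Lemma chi1 : chi 1 = 1.
Proof. by rewrite /chi /split /inert; case: q34 => ->; rewrite /= subr0. Qed.

Lemma chiX p k : chi (p ^ k) = chi p ^+ k.
Proof. by elim: k => [|k IH]; rewrite ?chi1 // expnS chiM IH exprS. Qed.

Lemma normr_chi n : `|chi n| <= 1.
Proof.
rewrite /chi; case: (split q n); case: (inert q n); rewrite /= ?subrr ?subr0 ?sub0r ?normrN ?normr1 ?normr0 //.
Qed.

(** The partial sums of the character are 1 on an interval of residues and 0 elsewhere. *)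
Definition chi_sum n : bool := (0 < n %% q < q.-1)%N.

Lemma chi_sumE n : \sum_(1 <= k < n.+1) chi k = (chi_sum n)%:R.
Proof.
elim: n => [|n IH]; first by rewrite big_geq // /chi_sum mod0n.
rewrite big_nat_recr //= IH /chi /split /inert /chi_sum.
have := modq_cases n; have := modq_cases n.+1; rewrite -addn1 -modnDml !inE.
case: q34 => ->; case/or4P=> /eqP e; case/or4P=> /eqP e'; rewrite e' in e *;
  try (by exfalso; move: e; rewrite /=; lia); try (by exfalso; move: e'; lia);
  by rewrite /= ?subr0 ?sub0r ?addr0 ?add0r ?subrr.
Qed.

Lemma split_inertF p : split q p -> inert q p = false.
Proof. by rewrite /split /inert => /eqP ->; case: q34 => ->. Qed.

Definition f_ n : R := (adm pred0 (inert q) n)%:R.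
Definition h_ n : R := (adm (split q) (inert q) n)%:R.
Definition Lam_f : nat -> R := Lam (adm_weight R pred0 (inert q)).
Definition Lam_h : nat -> R := Lam (adm_weight R (split q) (inert q)).

(** The weight of f at p^k is ln p for split p, 2 ln p on even k for inert p, and ln p for
    ramified p; the twisted Mangoldt function accounts for it except at even powers of inert primes
    and at powers of the ramified prime. *)
Lemma Lam_fE n : 2 * Lam_f n = Mangoldt R n + chi n * Mangoldt R n + Lam_h n.
Proof.
rewrite /Lam_f /Lam_h /Mangoldt /Lam !mulr_sumr -!big_split /=; apply: eq_big_seq => p.
rewrite -logn_gt0 => v0.
case: eqP => [def_n|_]; last by rewrite !mulr0 !addr0.
rewrite [in chi n]def_n chiX /adm_weight /= /chi.
case: (boolP (split q p)) => sp; first by rewrite split_inertF //= subr0 expr1n; ring.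
case: (inert q p); last by rewrite /= subr0 expr0n eqn0Ngt v0 /=; ring.
by rewrite /= sub0r -signr_odd; case: (odd _); rewrite /= ?expr1 ?expr0; ring.
Qed.

Lemma Lam_f_ge0 n : 0 <= Lam_f n.
Proof.
apply: Lam_ge0 => p k pp; rewrite /adm_weight /=; have := lnn_ge0 R p.
by case: ifP => // _; case: ifP => // _; lra.
Qed.

Lemma Lam_h_ge0 n : 0 <= Lam_h n.
Proof.
apply: Lam_ge0 => p k pp; rewrite /adm_weight /=; have := lnn_ge0 R p.
by case: ifP => // _; case: ifP => // _; case: ifP => // _; lra.
Qed.

Lemma f_log_deriv : log_deriv (@lnn R) Lam_f f_.
Proof. exact: adm_log_deriv. Qed.

Lemma h_log_deriv : log_deriv (@lnn R) Lam_h h_.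
Proof. exact: adm_log_deriv. Qed.

Lemma chi_log_deriv : log_deriv (@lnn R) (fun n => chi n * Mangoldt R n) chi.
Proof.
move=> n n0; have := Mangoldt_log_deriv R n0; rewrite mul1r => ->.
rewrite /conv mulr_sumr; apply: eq_big_seq => d dn.
have -> : chi n = chi d * chi (n %/ d)%N.
  by rewrite -chiM mulnC divnK // dvdn_divisors.
ring.
Qed.

(** The number of ideals of norm n in the quadratic ring of discriminant -q. *)
Definition r_ : nat -> R := conv (fun=> 1) chi.

Lemma r_log_deriv :
  log_deriv (@lnn R) (fun n => Mangoldt R n + chi n * Mangoldt R n) r_.
Proof.
apply: log_deriv_conv; [exact: lnnM|exact: (@Mangoldt_log_deriv R)|exact: chi_log_deriv].
Qed.

Lemma conv11 (a b : nat -> R) : conv a b 1 = a 1%N * b 1%N.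
Proof. by rewrite /conv (_ : divisors 1 = [:: 1%N]) // big_seq1. Qed.

Lemma Mangoldt1 : Mangoldt R 1 = 0. Proof. exact: Lam1. Qed.

(** Its logarithmic derivative Mangoldt (1 + chi) is nonnegative. *)
Lemma r_ge0 n : (0 < n)%N -> 0 <= r_ n.
Proof.
apply: (log_deriv_ge0 _ r_log_deriv) => [||m].
- by rewrite Mangoldt1 mulr0 addr0.
- by rewrite /r_ conv11 chi1 mulr1.
have := Mangoldt_ge0 R m; have := normr_chi m; rewrite ler_norml => /andP[]; nra.
Qed.

(** Both sides have the logarithmic derivative 2 Lam_f. *)
Lemma f_conv_f n : (0 < n)%N -> conv f_ f_ n = conv r_ h_ n.
Proof.
apply: (@log_deriv_inj _ (fun n => Lam_f n + Lam_f n)).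
- by rewrite /Lam_f Lam1 addr0.
- apply: log_deriv_conv; [exact: lnnM|exact: f_log_deriv|exact: f_log_deriv].
- have := log_deriv_conv (@lnnM R) r_log_deriv h_log_deriv.
  move=> e m m0; rewrite e //; apply: eq_conv => // k _.
  by rewrite -Lam_fE; ring.
- by rewrite !conv11 /r_ conv11 /f_ /h_ /adm /= chi1 !mulr1.
Qed.
End Character.

(** * Logarithms of integers and a first Chebyshev bound *)

Section Basic.
Variable R : realType.
Implicit Types (n m k d N : nat).
Local Notation lnn := (@lnn R).
Local Notation Mangoldt := (@Mangoldt R).

Lemma lnn1 : lnn 1 = 0. Proof. by rewrite /lnn ln1. Qed.

Lemma ler_lnn m n : (0 < m)%N -> (m <= n)%N -> lnn m <= lnn n.
Proof.
move=> m0 mn; have n0 := leq_trans m0 mn.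
by rewrite /lnn ler_ln ?posrE ?ltr0n // ler_nat.
Qed.

Lemma lnn_step_le n : (0 < n)%N -> lnn n.+1 - lnn n <= n%:R^-1.
Proof.
move=> n0; have n0' : 0 < n%:R :> R by rewrite ltr0n.
rewrite /lnn -ln_div ?posrE ?ltr0n //.
have -> : n.+1%:R / n%:R = 1 + n%:R^-1 :> R by rewrite -natr1; field; rewrite lt0r_neq0.
by apply: le_ln1Dx; apply: (@lt_trans _ _ 0); rewrite ?invr_gt0 ?ltrN10.
Qed.

Lemma lnn_step_ge n : (0 < n)%N -> n.+1%:R^-1 <= lnn n.+1 - lnn n.
Proof.
move=> n0; have n0' : 0 < n%:R :> R by rewrite ltr0n.
have n1 : 0 < n.+1%:R :> R by rewrite ltr0n.
rewrite -lerN2 opprB /lnn -ln_div ?posrE ?ltr0n //.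
have -> : n%:R / n.+1%:R = 1 + - n.+1%:R^-1 :> R.
  by rewrite -natr1; field; rewrite natr1 lt0r_neq0.
apply: le_ln1Dx; rewrite ltrN2 invf_lt1 // ltr1n ltnS //.
Qed.

Lemma lnn_step_ge0 n : 0 <= lnn n.+1 - lnn n.
Proof.
case: n => [|n]; first by rewrite lnn1 /lnn ln0 // subr0.
by apply: le_trans (lnn_step_ge _) => //; rewrite invr_ge0 ler0n.
Qed.

Lemma lnn_step_le1 n : (0 < n)%N -> lnn n.+1 - lnn n <= 1.
Proof.
move=> n0; apply: le_trans (lnn_step_le n0) _.
by rewrite invf_le1 ?ltr0n // ler1n.
Qed.

Lemma lnn_sub_le a b : (0 < a <= b)%N -> lnn b - lnn a <= \sum_(a <= k < b) k%:R^-1.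
Proof.
move=> /andP[a0 ab]; rewrite -telescope_sumr //.
by apply: ler_sum_nat => k /andP[ak _]; apply: lnn_step_le; lia.
Qed.

Lemma lnn_sub_ge a b : (0 < a <= b)%N -> \sum_(a <= k < b) k.+1%:R^-1 <= lnn b - lnn a.
Proof.
move=> /andP[a0 ab]; rewrite -telescope_sumr //.
by apply: ler_sum_nat => k /andP[ak _]; apply: lnn_step_ge; lia.
Qed.

(** The tangent at c to the graph of the logarithm. *)
Lemma lnn_tangent n c : (0 < n)%N -> (0 < c)%N -> lnn n <= n%:R / c%:R - 1 + lnn c.
Proof.
move=> n0 c0; rewrite -lerBlDr /lnn -ln_div ?posrE ?ltr0n //.
set x := n%:R / c%:R; have x0 : 0 < x :> R by rewrite divr_gt0 ?ltr0n.
have -> : x = 1 + (x - 1) by ring.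
by apply: le_trans (le_ln1Dx _) _; lra.
Qed.

Lemma lnn2_le : lnn 2 <= 3 / 4.
Proof.
have -> : lnn 2 = lnn 16 - lnn 8.
  by rewrite (_ : 16 = 2 ^ 4)%N // (_ : 8 = 2 ^ 3)%N // !lnnX; ring.
apply: le_trans (lnn_sub_le _) _ => //.
rewrite unlock /=; lra.
Qed.

(** Chebyshev's notation; [T_fact] links it to the factorial. *)
Definition T N : R := \sum_(1 <= n < N.+1) lnn n.

Lemma TS N : T N.+1 = T N + lnn N.+1.
Proof. by rewrite /T big_nat_recr. Qed.

Lemma T_ge N : N%:R * lnn N - N%:R <= T N.
Proof.
elim: N => [|N IH]; first by rewrite /T big_geq // mul0r subr0.
case: (posnP N) => [->|N0]; first by rewrite TS /T big_geq // lnn1; lra.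
rewrite TS; have := lnn_step_le N0; have Np : 0 < N%:R :> R by rewrite ltr0n.
rewrite -(ler_pM2l Np) mulfV ?lt0r_neq0 // -natr1; nra.
Qed.

Lemma T_le N : (0 < N)%N -> T N <= N%:R * lnn N - N%:R + lnn N + 1.
Proof.
elim: N => [//|N IH] _; case: (posnP N) => [->|N0].
  by rewrite TS /T big_geq // lnn1; lra.
rewrite TS; have := lnn_step_ge N0; have Np : 0 < N.+1%:R :> R by rewrite ltr0n.
rewrite -(ler_pM2l Np) mulfV ?lt0r_neq0 //; have := IH N0; rewrite -natr1.
have := lnn_step_ge0 N; nra.
Qed.

Definition psi N : R := \sum_(1 <= n < N.+1) Mangoldt n.

Lemma ler_psi m n : (m <= n)%N -> psi m <= psi n.
Proof.
move=> mn; rewrite /psi (@big_cat_nat _ _ _ m.+1 1 n.+1) //= lerDl.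
by apply: sumr_ge0 => k _; apply: Mangoldt_ge0.
Qed.

Lemma T_Mangoldt N : T N = \sum_(1 <= d < N.+1) Mangoldt d * (N %/ d)%:R.
Proof.
transitivity (\sum_(1 <= n < N.+1) conv Mangoldt (fun=> 1) n).
  by apply: eq_big_nat => n /andP[n0 _]; rewrite -Mangoldt_log_deriv // mul1r.
rewrite sum_conv; apply: eq_bigr => d _; congr (_ * _).
by rewrite sumr_const_nat subSS subn0.
Qed.

Lemma T_fact N : T N = lnn N`!.
Proof.
rewrite fact_prod lnn_prod // => p; rewrite mem_index_iota => /andP[]//.
Qed.

(** A common range of summation for all quotients N / d, so that combinations of the values of
    T can be formed termwise. *)
Lemma T_Mangoldt_wide N M : (N <= M)%N ->
  T N = \sum_(1 <= d < M.+1) Mangoldt d * (N %/ d)%:R.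
Proof.
move=> NM; rewrite T_Mangoldt (@big_cat_nat _ _ _ N.+1 1 M.+1) //= [X in _ + X]big1_seq ?addr0 //.
by move=> d; rewrite mem_index_iota => /and3P[_ Nd _]; rewrite divn_small // mulr0.
Qed.

Lemma psi_wide N M : (N <= M)%N ->
  psi N = \sum_(1 <= d < M.+1) Mangoldt d * (d <= N)%N%:R.
Proof.
move=> NM; rewrite (@big_cat_nat _ _ _ N.+1 1 M.+1) //= [X in _ + X]big1_seq ?addr0.
  by apply: eq_big_nat => d /andP[_]; rewrite ltnS => ->; rewrite mulr1.
by move=> d; rewrite mem_index_iota => /and3P[_ Nd _]; rewrite leqNgt Nd mulr0.
Qed.

Lemma leq_bin_pow2 n m : ('C(n, m) <= 2 ^ n)%N.
Proof.
case: (leqP m n) => mn; last by rewrite bin_small.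
rewrite -(addn1 1) expnDn (bigD1 (Ordinal (mn : (m < n.+1)%N))) //= !exp1n !muln1.
exact: leq_addr.
Qed.

(** The classical estimate through the central binomial coefficient: floor (2m / d) - 2 floor
    (m / d) is nonnegative, and is 1 for m < d <= 2m. *)
Lemma psi_double m : psi m.*2 - psi m <= m.*2%:R * lnn 2.
Proof.
have hT : T m.*2 - 2 * T m <= m.*2%:R * lnn 2.
  have b : ('C(m.*2, m) * (m`! * m`!) = m.*2`!)%N.
    have := @bin_fact m.*2 m; rewrite (_ : m.*2 - m = m)%N; last by lia.
    by apply; lia.
  have b0 : (0 < 'C(m.*2, m))%N by rewrite bin_gt0; lia.
  rewrite !T_fact -b !lnnM ?muln_gt0 ?fact_gt0 //.
  have : lnn 'C(m.*2, m) <= lnn (2 ^ m.*2) by apply: ler_lnn => //; apply: leq_bin_pow2.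
  by rewrite lnnX; lra.
apply: le_trans hT; rewrite T_Mangoldt (@T_Mangoldt_wide m m.*2) ?(@psi_wide m m.*2); try lia.
rewrite /psi mulr_sumr -!sumrB; apply: ler_sum_nat => d /andP[d0 d2m].
rewrite mulrCA -{1}[Mangoldt d]mulr1 -!mulrBr; apply: ler_wpM2l; first exact: Mangoldt_ge0.
have h : ((m < d) + 2 * (m %/ d) <= m.*2 %/ d)%N.
  rewrite leq_divRL // mulnDl -mulnA; have := leq_trunc_div m d.
  by case: (ltnP m d) => md; [rewrite divn_small|]; lia.
have := h; rewrite -(ler_nat R) natrD natrM ltnNge; case: (d <= m)%N => /=; lra.
Qed.

(** Doubling costs at most 2 m ln 2 <= 3 m / 2, so N = 2 m follows from m; an odd N is rounded up,
    which the induction tolerates from N = 7 on. *)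
Lemma psi_le2 N : psi N <= 2 * N%:R.
Proof.
have ln2 := lnn2_le; have p2 m := psi_double m.
have hT : psi 3 <= lnn 6.
  have -> : lnn 6 = T 3 by rewrite T_fact.
  rewrite T_Mangoldt /psi; apply: ler_sum_nat => d /andP[d0 d3].
  rewrite -{1}[Mangoldt d]mulr1; apply: ler_wpM2l; first exact: Mangoldt_ge0.
  by rewrite ler1n divn_gt0.
have l6 : lnn 6 <= 3 * lnn 2 by rewrite -lnnX; apply: ler_lnn.
have [n] := ubnP N; elim: n N => // n IH N ltN.
have [m [eN | eN]] : exists m, N = m.*2 \/ N = m.*2.+1.
  by exists N./2; have := odd_double_half N; case: (odd N) => /= e; [right|left]; lia.
  subst N; case: (posnP m) => [->|m0]; first by rewrite /psi big_geq // mulr0.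
  have := IH m; have := p2 m; rewrite -muln2 natrM.
  have m0' : 0 < m%:R :> R by rewrite ltr0n.
  have lm : (m < n)%N by lia.
  by move=> h1 /(_ lm) h2; nra.
subst N; case: m ltN => [|[|[|m]]] ltN.
- by rewrite /psi big_nat1 Mangoldt1 mulr_ge0.
- by apply: le_trans hT _; rewrite (_ : 1.*2.+1 = 3)%N //; lra.
- have := p2 3%N; have : psi 5 <= psi 6 by apply: ler_psi.
  by rewrite (_ : 2.*2.+1 = 5)%N // (_ : 3.*2 = 6)%N //; lra.
- have := p2 m.+4; have lm : (m.+4 < n)%N by lia.
  have := IH _ lm; have : psi m.+3.*2.+1 <= psi m.+4.*2 by apply: ler_psi; lia.
  rewrite -!muln2 -!natr1 !natrM -!natr1; have : 0 <= m%:R :> R by rewrite ler0n.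
  by nra.
Qed.
End Basic.

(** * Mertens sums for the Mangoldt function and its twist *)

Section Mertens.
Variables (R : realType) (q : nat).
Hypothesis q34 : q = 3%N \/ q = 4%N.
Implicit Types (n m k d N : nat).
Local Notation lnn := (@lnn R).
Local Notation Mangoldt := (@Mangoldt R).
Local Notation chi := (@chi R q).
Local Notation s k := ((chi_sum q k)%:R : R).
Local Notation psi := (@psi R).

Lemma chi_diff k : (0 < k)%N -> chi k = s k - s k.-1.
Proof.
case: k => // k _; rewrite -!(chi_sumE R q34) big_nat_recr //=; ring.
Qed.

Lemma chi_sum01 k : 0 <= s k <= 1.
Proof. by case: (chi_sum q k); rewrite ?ler01 ?lexx. Qed.

(** Abel summation; the partial sums of the character are 0 or 1. *)
Lemma chi_abel (G : nat -> R) J n : (J < n)%N ->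
  \sum_(J.+1 <= k < n.+1) chi k * G k =
  s n * G n - s J * G J.+1 + \sum_(J.+1 <= k < n) s k * (G k - G k.+1).
Proof.
elim: n => // n IH; rewrite ltnS leq_eqVlt => /orP[/eqP <-|Jn].
  by rewrite big_nat1 big_geq // chi_diff //=; ring.
by rewrite big_nat_recr ?ltnS 1?ltnW // [in RHS]big_nat_recr //= IH // chi_diff //=; ring.
Qed.

Lemma chi_abel_decr (G : nat -> R) J n :
  (forall k, (J < k)%N -> G k.+1 <= G k) -> (forall k, (J < k)%N -> 0 <= G k) ->
  - s J * G J.+1 <= \sum_(J.+1 <= k < n.+1) chi k * G k <= (1 - s J) * G J.+1.
Proof.
move=> dG G0; have GJ := G0 J.+1 (ltnSn J); have sJ := chi_sum01 J.
have [nJ|Jn] := leqP n J; first by rewrite big_geq // ; nra.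
rewrite chi_abel //.
have h : 0 <= \sum_(J.+1 <= k < n) s k * (G k - G k.+1) <= \sum_(J.+1 <= k < n) (G k - G k.+1).
  apply/andP; split.
    rewrite big_seq; apply: sumr_ge0 => k; rewrite mem_index_iota => /andP[Jk _].
    by have := dG k Jk; have := chi_sum01 k; nra.
  by apply: ler_sum_nat => k /andP[Jk _]; have := dG k Jk; have := chi_sum01 k; nra.
have e : \sum_(J.+1 <= k < n) (G k - G k.+1) = G J.+1 - G n.
  rewrite -opprB -telescope_sumr // -sumrN; apply: eq_bigr => k _; by rewrite opprB.
rewrite e in h; have := chi_sum01 n; have := G0 n Jn; nra.
Qed.

Lemma chi_abel_incr (G : nat -> R) n :
  (forall k, (0 < k)%N -> G k <= G k.+1) -> 0 <= G 1%N ->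
  (0 < n)%N -> `|\sum_(1 <= k < n.+1) chi k * G k| <= G n.
Proof.
move=> dG G0 n0; have Gm m : (0 < m)%N -> G 1%N <= G m.
  by elim: m => // -[_ _|m IH _]; [|apply: le_trans (IH _) (dG _ _)].
rewrite chi_abel //.
have h : 0 <= \sum_(1 <= k < n) s k * (G k.+1 - G k) <= \sum_(1 <= k < n) (G k.+1 - G k).
  apply/andP; split.
    rewrite big_seq; apply: sumr_ge0 => k; rewrite mem_index_iota => /andP[Jk _].
    by have := dG k Jk; have := chi_sum01 k; nra.
  by apply: ler_sum_nat => k /andP[Jk _]; have := dG k Jk; have := chi_sum01 k; nra.
have e : \sum_(1 <= k < n) s k * (G k - G k.+1) = - \sum_(1 <= k < n) s k * (G k.+1 - G k).
  by rewrite -sumrN; apply: eq_bigr => k _; ring.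
rewrite telescope_sumr // in h; rewrite e ler_norml.
have s0 : s 0 = 0 by rewrite /chi_sum mod0n.
rewrite s0; have := chi_sum01 n; move: h.
set S := \sum_(1 <= k < n) _; have := Gm n n0; nra.
Qed.

Lemma sum_chi_lnn n : (0 < n)%N -> `|\sum_(1 <= k < n.+1) chi k * lnn k| <= lnn n.
Proof.
move=> n0; apply: chi_abel_incr => //; last by rewrite lnn1.
by move=> k k0; apply: ler_lnn.
Qed.

(** Partial sums of L(1, chi). *)
Definition Lsum n : R := \sum_(1 <= k < n.+1) chi k / k%:R.

Lemma inv_nat_decr k : (0 < k)%N -> k.+1%:R^-1 <= k%:R^-1 :> R.
Proof. by move=> k0; rewrite lef_pV2 ?posrE ?ltr0n // ler_nat. Qed.

Lemma Lsum_tail m n : (m <= n)%N -> `|Lsum n - Lsum m| <= m.+1%:R^-1.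
Proof.
move=> mn; rewrite /Lsum (@big_cat_nat _ _ _ m.+1 1 n.+1) //= addrAC subrr add0r.
have := @chi_abel_decr (fun k => k%:R^-1) m n.
have i0 k : 0 <= k%:R^-1 :> R by rewrite invr_ge0 ler0n.
move=> /(_ _ (fun k _ => i0 k)) h; have {}h := h (fun k mk => inv_nat_decr (leq_ltn_trans (leq0n m) mk)).
move: h; set y := m.+1%:R^-1; set S := \sum_(_ <= _ < _) _.
have : 0 <= y by apply: i0.
by rewrite ler_norml => y0 h; have := chi_sum01 m; move: h; nra.
Qed.

Lemma Lsum_ge n : (0 < n)%N -> 1 / 2 <= Lsum n.
Proof.
move=> n0; have e : Lsum 1 = 1 by rewrite /Lsum big_nat1 chi1 // divr1.
have := Lsum_tail n0; rewrite e ler_norml => /andP[h _]; by lra.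
Qed.

(** The function ln x / x decreases for x >= e, hence the bound 2 < k. *)
Lemma lnn_div_decr k : (2 < k)%N -> lnn k.+1 / k.+1%:R <= lnn k / k%:R.
Proof.
move=> k2; have k0 : (0 < k)%N by lia.
have kp : 0 < k%:R :> R by rewrite ltr0n.
have k1 : 0 < k.+1%:R :> R by rewrite ltr0n.
rewrite ler_pdivrMr // mulrAC ler_pdivlMr // -natr1.
have : 1 <= lnn k.
  apply: le_trans (ler_lnn _ (isT : (0 < 3)%N) k2).
  have -> : lnn 3 = lnn 12 - lnn 4 by rewrite (_ : 12 = 3 * 4)%N // lnnM //; ring.
  by apply: le_trans (@lnn_sub_ge R 4 12 isT); rewrite unlock /=; lra.
have : k%:R * (lnn k.+1 - lnn k) <= 1.
  by rewrite mulrC -ler_pdivlMr // div1r; apply: lnn_step_le.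
nra.
Qed.

Lemma sum_chi_lnn_div n : `|\sum_(1 <= k < n.+1) chi k * (lnn k / k%:R)| <= 1.
Proof.
have c1 := normr_chi R q; have l1 := lnn1 R.
have l2 : 0 <= lnn 2 <= 3 / 4 by rewrite lnn_ge0 lnn2_le.
have l3 : lnn 3 <= 2 * lnn 2 by rewrite -lnnX; apply: ler_lnn.
have c2 : `|chi 2 * (lnn 2 / 2%:R)| <= 3 / 8.
  rewrite normrM (ger0_norm (_ : 0 <= lnn 2 / 2)); last by lra.
  have := c1 2%N; have := normr_ge0 (chi 2); nra.
case: n => [|[|n]]; first by rewrite big_geq // normr0.
  by rewrite big_nat1 l1 mul0r mulr0 normr0.
rewrite (@big_cat_nat _ _ _ 3 1) //= big_nat_recr // big_nat1 /= l1 mul0r mulr0 add0r.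
apply: le_trans (ler_normD _ _) _.
have G0 k : (2 < k)%N -> 0 <= lnn k / k%:R by move=> _; rewrite divr_ge0 ?lnn_ge0 ?ler0n.
have /andP[h1 h2] := chi_abel_decr n.+2 lnn_div_decr G0.
have := chi_sum01 2; have : 0 <= lnn 3 / 3%:R by apply: G0.
have : lnn 3 / 3%:R <= 1 / 2 by lra.
move=> h3 h4 h5; have : `|\sum_(3 <= k < n.+3) chi k * (lnn k / k%:R)| <= 1 / 2.
  by rewrite ler_norml; nra.
lra.
Qed.

Definition mertens N : R := \sum_(1 <= d < N.+1) Mangoldt d / d%:R.

Lemma natdiv_le N d : (0 < d)%N -> (N %/ d)%:R <= N%:R / d%:R :> R.
Proof. by move=> d0; rewrite ler_pdivlMr ?ltr0n // -natrM ler_nat leq_trunc_div. Qed.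

Lemma natdiv_gt N d : (0 < d)%N -> N%:R / d%:R < (N %/ d).+1%:R :> R.
Proof. by move=> d0; rewrite ltr_pdivrMr ?ltr0n // -natrM ltr_nat ltn_ceil. Qed.

Lemma mertens_bounds N : (0 < N)%N -> lnn N - 1 <= mertens N <= lnn N + 2.
Proof.
move=> N0; have Np : 0 < N%:R :> R by rewrite ltr0n.
have lo : T R N <= N%:R * mertens N.
  rewrite T_Mangoldt /mertens mulr_sumr; apply: ler_sum_nat => d /andP[d0 _].
  by rewrite mulrCA; apply: ler_wpM2l; [exact: Mangoldt_ge0|exact: natdiv_le].
have hi : N%:R * mertens N - psi N <= T R N.
  rewrite T_Mangoldt /mertens mulr_sumr -sumrB; apply: ler_sum_nat => d /andP[d0 _].
  rewrite mulrCA -{2}[Mangoldt d]mulr1 -mulrBr; apply: ler_wpM2l; first exact: Mangoldt_ge0.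
  by have := natdiv_gt N d0; rewrite -natr1; lra.
have := T_ge R N; have := T_le R N0; have := psi_le2 R N.
have := lnn_tangent R N0 (isT : (0 < 1)%N); rewrite lnn1 divr1 => h1 h2 h3 h4.
apply/andP; split; rewrite -(ler_pM2l Np).
  by move: lo; set y := _ * mertens N; lra.
by move: hi; set y := _ * mertens N; lra.
Qed.

Definition mertens_chi N : R := \sum_(1 <= d < N.+1) chi d * Mangoldt d / d%:R.

(** From chi ln = (chi Mangoldt) * chi one gets
    sum_(k <= N) chi k ln k / k = sum_(d <= N) (chi d Mangoldt d / d) Lsum (N / d).
    Replacing Lsum (N / d) by Lsum N costs at most d / N in each term, hence psi N / N in all, and
    Lsum N is at least 1/2. *)
Lemma mertens_chi_le N : `|mertens_chi N| <= 6.
Proof.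
case: (posnP N) => [->|N0]; first by rewrite /mertens_chi big_geq // normr0.
have Np : 0 < N%:R :> R by rewrite ltr0n.
have e : \sum_(1 <= k < N.+1) chi k * (lnn k / k%:R) =
    \sum_(1 <= d < N.+1) chi d * Mangoldt d / d%:R * Lsum (N %/ d).
  under eq_big_nat => k /andP[k0 _] do rewrite mulrA chi_log_deriv //.
  rewrite sum_conv_weight; apply: eq_bigr => d _; rewrite -mulrA; congr (_ * _).
  rewrite /Lsum mulr_sumr; apply: eq_bigr => k _.
  by rewrite natrM invfM; ring.
(* replace Lsum (N / d) with Lsum N *)
have h : `|Lsum N * mertens_chi N - \sum_(1 <= k < N.+1) chi k * (lnn k / k%:R)| <= 2.
  rewrite e /mertens_chi mulr_sumr -sumrB; apply: le_trans (ler_norm_sum _ _ _) _.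
  apply: (@le_trans _ _ (\sum_(1 <= d < N.+1) Mangoldt d / N%:R)).
    apply: ler_sum_nat => d /andP[d0 dN].
    have dp : 0 < d%:R :> R by rewrite ltr0n.
    have -> : Lsum N * (chi d * Mangoldt d / d%:R) - chi d * Mangoldt d / d%:R * Lsum (N %/ d)
      = chi d * (Mangoldt d * ((Lsum N - Lsum (N %/ d)) / d%:R)) by ring.
    rewrite 2!normrM (ger0_norm (Mangoldt_ge0 _ _)).
    have m0 := Mangoldt_ge0 R d.
    apply: le_trans (ler_piMl _ (normr_chi R q d)) _; first by rewrite mulr_ge0.
    apply: ler_wpM2l => //; rewrite normrM normfV (ger0_norm (ltW dp)).
    rewrite ler_pdivrMr // mulrC; apply: le_trans (@Lsum_tail (N %/ d) N (leq_div _ _)) _.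
    rewrite -[leRHS]invf_div lef_pV2 ?posrE ?ltr0n ?divr_gt0 //.
    by rewrite ltW // natdiv_gt.
  rewrite -mulr_suml -[X in X / _]/(psi N) ler_pdivrMr //; exact: psi_le2.
have := sum_chi_lnn_div N; have := Lsum_ge N0; move: h; rewrite !ler_norml.
set y := Lsum N; set z := mertens_chi N; set w := \sum_(1 <= k < N.+1) _; nra.
Qed.
End Mertens.

(** * The contribution of squares and of the ramified prime *)

Section InverseSquares.
Variable R : realType.
Local Notation lnn := (@lnn R).

(** Telescoping against (ln N + 2) / N, the shape of the tail of the integral. *)
Lemma sum_lnn_div_sqr N : \sum_(1 <= m < N.+1) lnn m / m%:R ^+ 2 <= 2.
Proof.
(* the added term makes the left side decrease with N *)
suff h : \sum_(1 <= m < N.+1) lnn m / m%:R ^+ 2 + (lnn N.+1 + 2) / N.+1%:R <= 2.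
  by apply: le_trans h; rewrite lerDl divr_ge0 // addr_ge0 ?lnn_ge0.
elim: N => [|N IH]; first by rewrite big_geq // lnn1; lra.
rewrite big_nat_recr //=; apply: le_trans IH; rewrite -addrA lerD2l.
have x1 : 1 <= N.+1%:R :> R by rewrite ler1n.
have d1 : lnn N.+2 - lnn N.+1 <= N.+1%:R^-1 by apply: lnn_step_le.
rewrite -[N.+2%:R]natr1; move: x1 d1 (lnn_ge0 R N.+1); set x := N.+1%:R; set l := lnn N.+1.
set l' := lnn N.+2 => x1 d1 l0.
have -> : (l + 2) / x = l / x ^+ 2 + ((l + 2) * x - l) / x ^+ 2 by field; lra.
rewrite lerD2l ler_pdivlMr; last by rewrite exprn_gt0 //; lra.
rewrite mulrAC ler_pdivrMr; last by lra.
have d2 : x * (l' - l) <= 1 by rewrite mulrC -ler_pdivlMr ?div1r //; lra.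
have d3 : x ^+ 2 * (l' - l) <= x by rewrite expr2 -mulrA; nra.
have lx : l <= x.
  by have := lnn_tangent R (isT : (0 < N.+1)%N) (isT : (0 < 1)%N); rewrite lnn1 divr1 /l /x; lra.
nra.
Qed.

Lemma sum_inv_sqr_tail a N : (0 < a)%N ->
  \sum_(a.+1 <= m < N.+1) (m%:R ^+ 2)^-1 <= a%:R^-1 :> R.
Proof.
move=> a0; have [Na|aN] := leqP N a; first by rewrite big_geq // invr_ge0.
suff h : \sum_(a.+1 <= m < N.+1) (m%:R ^+ 2)^-1 + N%:R^-1 <= a%:R^-1 :> R.
  by apply: le_trans h; rewrite lerDl invr_ge0.
elim: N aN => // N IH; rewrite ltnS leq_eqVlt => /orP[/eqP <-|aN].
  rewrite big_nat1 -natr1; have : 1 <= a%:R :> R by rewrite ler1n.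
  set x := a%:R => x1; rewrite -lerBrDr.
  have -> : x^-1 - (x + 1)^-1 = (x * (x + 1))^-1 by field; apply/andP; split; lra.
  by rewrite lef_pV2 ?posrE ?exprn_gt0 ?mulr_gt0; nra.
rewrite big_nat_recr ?ltnS 1?ltnW //=; apply: le_trans (IH aN); rewrite -addrA lerD2l -natr1.
have : 1 <= N%:R :> R by rewrite ler1n; lia.
set x := N%:R => x1; rewrite -lerBrDr.
have -> : x^-1 - (x + 1)^-1 = (x * (x + 1))^-1 by field; apply/andP; split; lra.
by rewrite lef_pV2 ?posrE ?exprn_gt0 ?mulr_gt0; nra.
Qed.

End InverseSquares.

Section HSums.
Variables (R : realType) (q : nat).
Hypothesis q34 : q = 3%N \/ q = 4%N.
Implicit Types (n m k d N : nat).
Local Notation lnn := (@lnn R).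
Local Notation h_ := (@h_ R q).
Local Notation Lam_h := (@Lam_h R q).
Local Notation Lam_f := (@Lam_f R q).

Definition ramified_prime : nat := if q == 3%N then 3%N else 2%N.

Lemma ram_gt1 : (1 < ramified_prime)%N. Proof. by rewrite /ramified_prime; case: eqP. Qed.

Lemma prime_ram p : prime p -> ~~ split q p -> ~~ inert q p -> p = ramified_prime.
Proof.
rewrite /split /inert /ramified_prime => pp; case: q34 => -> /= p1 p2.
  have /(prime_nt_dvdP pp)-> // : (3 %| p)%N by rewrite /dvdn; lia.
have /(prime_nt_dvdP pp)-> // : (2 %| p)%N by rewrite /dvdn; lia.
Qed.

(** The exponents of the split primes vanish and those of the inert ones are even, so only the
    ramified prime can have an odd exponent. *)
Lemma adm_ram_square n : (0 < n)%N -> adm (split q) (inert q) n ->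
  exists2 m, (0 < m)%N & n = (m ^ 2)%N \/ n = (ramified_prime * m ^ 2)%N.
Proof.
have [b] := ubnP n; elim: b n => // b IH n ltn n0 hn.
have [n1|n1] := leqP n 1; first by exists 1%N => //; left; lia.
have pp := pdiv_prime n1; have pn := pdiv_dvd n.
move: (pdiv n) pp pn => p pp pn; have p1 := prime_gt1 pp.
have [k pk def_n] := pfactor_coprime pp n0.
have : (0 < logn p n)%N by rewrite logn_gt0 mem_primes pp n0.
move: (logn p n) def_n => v def_n v0.
have k0 : (0 < k)%N by case: k def_n {pk} => // e; rewrite e in n0.
rewrite prime_coprime // in pk.
move: hn; rewrite def_n mulnC adm_split // eqn0Ngt v0 /= => /andP[/andP[sp ip] hk].
have pv : (1 < p ^ v)%N by rewrite -(exp1n v) ltn_exp2r.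
have [|m m0 em] := IH k _ k0 hk; first by rewrite def_n in ltn; nia.
have ew := odd_double_half v; set w := v./2 in ew.
have epw : (p ^ v = p ^ (odd v) * (p ^ w) ^ 2)%N by rewrite -expnM -expnD muln2 ew.
have pw0 : (0 < p ^ w)%N by rewrite expn_gt0 (ltnW p1).
move: ip epw; case: (odd v) => /=; last first.
  rewrite mul1n => _ ->; exists (p ^ w * m)%N; first by rewrite muln_gt0 pw0.
  by case: em => ->; [left|right]; ring.
rewrite implybF expn1 => ip ->; rewrite {1 3}(prime_ram pp sp ip).
case: em => ->.
  by exists (p ^ w * m)%N; [rewrite muln_gt0 pw0|right; ring].
exists (ramified_prime * p ^ w * m)%N; last by left; ring.
by rewrite !muln_gt0 pw0 (ltnW ram_gt1).
Qed.

(** The m with n = m^2 or n = p m^2, p ramified, has no split factor when n is in the support of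
    h; keeping this constraint is essential for the numerical size of the sum of h d / d. *)
Definition nosplit m : R := (adm (split q) pred0 m)%:R.

Lemma sum_h_le (G : nat -> R) N : (forall n, 0 <= G n) ->
  \sum_(1 <= n < N.+1) h_ n * G n <=
  \sum_(1 <= m < N.+1) nosplit m * (G (m ^ 2)%N + G (ramified_prime * m ^ 2)%N).
Proof.
move=> G0.
pose E n m : R := (n == m ^ 2)%N%:R + (n == ramified_prime * m ^ 2)%N%:R.
have E0 n m : 0 <= E n m by rewrite addr_ge0.
have v0 m : 0 <= nosplit m by rewrite ler0n.
apply: (@le_trans _ _ (\sum_(1 <= n < N.+1) \sum_(1 <= m < N.+1) nosplit m * E n m * G n)).
  apply: ler_sum_nat => n /andP[n0 nN]; rewrite -mulr_suml; apply: ler_wpM2r => //.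
  have t0 : 0 <= \sum_(1 <= m < N.+1) nosplit m * E n m.
    by apply: sumr_ge0 => m _; rewrite mulr_ge0.
  rewrite /h_; case: (boolP (adm _ _ _)) => // hn.
  have [m m0 em] := adm_ram_square n0 hn.
  have mn : (m %| n)%N by case: em => ->; [rewrite dvdn_exp|rewrite dvdn_mull ?dvdn_exp].
  have vm : nosplit m = 1.
    rewrite /nosplit (_ : adm _ _ _) //; apply/admP => // p pp.
    rewrite logn_gt0 mem_primes => /and3P[_ _ pm] /=; rewrite andbT.
    have /(admP _ _ n0)/(_ p pp) := hn.
    by rewrite logn_gt0 mem_primes pp n0 (dvdn_trans pm mn) => /(_ isT) /andP[].
  have mN : (m < N.+1)%N by apply: leq_ltn_trans nN; apply: dvdn_leq.
  rewrite (@big_cat_nat _ _ _ m 1 N.+1) //=; last by rewrite ltnW.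
  rewrite (big_ltn mN) vm mul1r.
  have : 1 <= E n m.
    by rewrite /E; case: em => ->; rewrite eqxx ?lerDl ?lerDr.
  set A := \sum_(_ <= _ < _) _; set B := \sum_(_ <= _ < _) _ => h.
  have : 0 <= A by apply: sumr_ge0 => i _; rewrite mulr_ge0.
  have : 0 <= B by apply: sumr_ge0 => i _; rewrite mulr_ge0.
  by lra.
rewrite exchange_big /=; apply: ler_sum_nat => m /andP[m0 _].
under eq_bigr do rewrite -mulrA.
rewrite -mulr_sumr; apply: ler_wpM2l => //.
have one k : \sum_(1 <= n < N.+1) (n == k)%:R * G n <= G k.
  have [kN|] := boolP (k \in index_iota 1 N.+1); last first.
    move=> kN; rewrite big1_seq // => n /andP[_ nN]; case: eqP => [e|]; rewrite ?mul0r //.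
    by rewrite -e nN in kN.
  rewrite (bigD1_seq k) ?iota_uniq //= eqxx mul1r big1 ?addr0 // => n /negbTE ->.
  by rewrite mul0r.
under eq_bigr do rewrite mulrDl.
by rewrite big_split; apply: lerD; apply: one.
Qed.

(** In h ln = Lam_h * h, all terms are nonnegative, and h 1 = 1. *)
Lemma Lam_h_sum_le (F : nat -> R) N : (forall n, 0 <= F n) ->
  \sum_(1 <= d < N.+1) Lam_h d * F d <= \sum_(1 <= n < N.+1) h_ n * (lnn n * F n).
Proof.
move=> F0.
under [leRHS]eq_big_nat => n /andP[n0 _] do rewrite mulrA h_log_deriv //.
rewrite sum_conv_weight; apply: ler_sum_nat => d /andP[d0 dN].
apply: ler_wpM2l; first exact: Lam_h_ge0.
rewrite big_ltn ?ltnS ?divn_gt0 // /h_ muln1 {1}/adm /= mul1r lerDl.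
by apply: sumr_ge0 => k _; rewrite mulr_ge0.
Qed.

Lemma nosplit_le1 m : nosplit m <= 1.
Proof. by rewrite /nosplit; case: adm; rewrite ?lexx ?ler01. Qed.

(** The sum of h n ln n / n dominates, and it converges because h lives on squares up to the
    ramified prime. *)
Lemma mertens_h_le N : 0 <= \sum_(1 <= d < N.+1) Lam_h d / d%:R <= 8.
Proof.
apply/andP; split; first by apply: sumr_ge0 => d _; rewrite divr_ge0 ?Lam_h_ge0.
apply: le_trans (@Lam_h_sum_le (fun n => n%:R^-1) N _) _ => [n|]; first by rewrite invr_ge0.
apply: le_trans (@sum_h_le (fun n => lnn n / n%:R) N _) _ => [n|].
  by rewrite divr_ge0 ?lnn_ge0.
apply: (@le_trans _ _ (\sum_(1 <= m < N.+1) (3 * (lnn m / m%:R ^+ 2) + 3 / 4 * (m%:R ^+ 2)^-1))).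
  apply: ler_sum_nat => m /andP[m0 _].
  have m1 : 0 < m%:R ^+ 2 :> R by rewrite exprn_gt0 // ltr0n.
  have e2 : 2 <= ramified_prime%:R :> R by rewrite ler_nat ram_gt1.
  have le : lnn ramified_prime <= 3 / 2.
    apply: (@le_trans _ _ (lnn (2 ^ 2))); first by apply: ler_lnn; rewrite /ramified_prime; case: eqP.
    by rewrite lnnX; have := lnn2_le R; lra.
  apply: le_trans (ler_piMl _ (nosplit_le1 m)) _.
    by rewrite addr_ge0 ?divr_ge0 ?lnn_ge0.
  rewrite lnnM ?expn_gt0 ?m0 ?(ltnW ram_gt1) // lnnX natrM natrX invfM.
  have : (lnn ramified_prime + 2%:R * lnn m) * (ramified_prime%:R^-1) <= 3 / 4 + lnn m.
    rewrite ler_pdivrMr; last by lra.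
    have := lnn_ge0 R m; nra.
  move=> h; have mi : 0 <= (m%:R ^+ 2)^-1 :> R by rewrite invr_ge0 ltW.
  have := ler_wpM2r mi h; lra.
rewrite big_split -!mulr_sumr /=; have := sum_lnn_div_sqr R N.
have : \sum_(1 <= m < N.+1) (m%:R ^+ 2)^-1 <= 2 :> R.
  case: N => [|N]; first by rewrite big_geq //; lra.
  rewrite big_ltn // expr1n invr1; have := @sum_inv_sqr_tail R 1 N.+1 isT; rewrite invr1; lra.
by lra.
Qed.

Lemma sum_h_count N s : (N < s.+1 ^ 2)%N -> \sum_(1 <= n < N.+1) h_ n <= 2 * s%:R.
Proof.
move=> Ns.
have -> : \sum_(1 <= n < N.+1) h_ n = \sum_(1 <= n < N.+1) h_ n * (n <= N)%N%:R.
  by apply: eq_big_nat => n /andP[_]; rewrite ltnS => ->; rewrite mulr1.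
apply: le_trans (@sum_h_le (fun n => (n <= N)%N%:R) N _) _ => //.
apply: (@le_trans _ _ (\sum_(1 <= m < N.+1) 2 * (m <= s)%N%:R)).
  apply: ler_sum_nat => m /andP[m0 _].
  have i1 : ((m ^ 2 <= N) <= (m <= s))%N.
    case: (leqP m s) => [_|sm]; first exact: leq_b1.
    have -> // : (m ^ 2 <= N)%N = false.
    by apply/negbTE; rewrite -ltnNge (leq_trans Ns) // leq_exp2r.
  have i2 : ((ramified_prime * m ^ 2 <= N) <= (m ^ 2 <= N))%N.
    case: (leqP (m ^ 2) N) => [_|sm]; first exact: leq_b1.
    have -> // : (ramified_prime * m ^ 2 <= N)%N = false.
    by apply/negbTE; rewrite -ltnNge (leq_trans sm) // leq_pmull // ltnW // ram_gt1.
  have h1 : (m ^ 2 <= N)%N%:R <= (m <= s)%N%:R :> R by rewrite ler_nat.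
  have h2 : (ramified_prime * m ^ 2 <= N)%N%:R <= (m ^ 2 <= N)%N%:R :> R by rewrite ler_nat.
  have a0 := ler0n R (m ^ 2 <= N)%N; have b0 := ler0n R (ramified_prime * m ^ 2 <= N)%N.
  have v0 : 0 <= nosplit m by rewrite ler0n.
  rewrite /=; have := nosplit_le1 m; nra.
rewrite -mulr_sumr ler_pM2l //.
have -> : \sum_(1 <= m < N.+1) (m <= s)%N%:R = (\sum_(1 <= m < N.+1) (m <= s))%N%:R :> R by rewrite natr_sum.
rewrite ler_nat (_ : \sum_(1 <= m < N.+1) (m <= s) = minn N s)%N ?geq_minr //.
elim: {Ns} N => [|N IH]; first by rewrite big_geq // min0n.
by rewrite big_nat_recr //= IH; case: (leqP N.+1 s); lia.
Qed.

Lemma Lam_h_count_le N s : (N < s.+1 ^ 2)%N ->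
  \sum_(1 <= d < N.+1) Lam_h d <= 2 * s%:R * lnn N.
Proof.
move=> Ns; under eq_bigr do rewrite -[Lam_h _]mulr1.
apply: le_trans (@Lam_h_sum_le (fun _ => 1) N _) _ => //.
apply: le_trans (ler_wpM2r (lnn_ge0 R N) (sum_h_count Ns)).
rewrite mulr_suml; apply: ler_sum_nat => n /andP[n0]; rewrite ltnS => nN.
by rewrite mulr1; apply: ler_wpM2l; rewrite ?ler0n //; apply: ler_lnn.
Qed.

Definition mertens_f N : R := \sum_(1 <= d < N.+1) Lam_f d / d%:R.

(** The twisted part and the part of h are bounded, so half of the Mertens sum remains. *)
Lemma mertens_f_bounds N : (0 < N)%N ->
  lnn N / 2 - 7 / 2 <= mertens_f N <= lnn N / 2 + 8.
Proof.
move=> N0; have /andP[a1 a2] := mertens_bounds R N0.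
have := mertens_chi_le R q34 N; rewrite ler_norml => /andP[b1 b2].
have /andP[c1 c2] := mertens_h_le N.
have e : 2 * mertens_f N = mertens R N + mertens_chi R q N + \sum_(1 <= d < N.+1) Lam_h d / d%:R.
  rewrite /mertens_f /mertens /mertens_chi mulr_sumr -!big_split; apply: eq_bigr => d _ /=.
  by rewrite mulrA Lam_fE // !mulrDl.
by apply/andP; split; lra.
Qed.
End HSums.

(** * Logarithmic means and their growth *)

Section Growth.
Variables (R : realType) (q : nat).
Hypothesis q34 : q = 3%N \/ q = 4%N.
Implicit Types (n m k d N : nat).
Local Notation lnn := (@lnn R).
Local Notation f_ := (@f_ R q).
Local Notation Lam_f := (@Lam_f R q).

Definition Mf N : R := \sum_(1 <= m < N.+1) f_ m / m%:R.
Definition Wf N : R := \sum_(1 <= m < N.+1) f_ m / m%:R * (lnn N - lnn m).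

Lemma f_ge0 n : 0 <= f_ n. Proof. by rewrite /f_ ler0n. Qed.
Lemma f_le1 n : f_ n <= 1. Proof. by rewrite /f_; case: adm; rewrite ?ler01. Qed.
Lemma f_1 : f_ 1 = 1. Proof. by []. Qed.

Lemma fdiv_ge0 n : 0 <= f_ n / n%:R. Proof. by rewrite divr_ge0 ?f_ge0. Qed.

Lemma ler_Mf m n : (m <= n)%N -> Mf m <= Mf n.
Proof.
move=> mn; rewrite /Mf (@big_cat_nat _ _ _ m.+1 1 n.+1) //= lerDl.
by apply: sumr_ge0 => k _; apply: fdiv_ge0.
Qed.

Lemma Mf_ge1 N : (0 < N)%N -> 1 <= Mf N.
Proof.
by move=> /ler_Mf; apply: le_trans; rewrite /Mf big_nat1 f_1 divr1.
Qed.

Lemma Mf_ge0 N : 0 <= Mf N. Proof. by apply: sumr_ge0 => k _; apply: fdiv_ge0. Qed.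

Lemma Mf_le N : (0 < N)%N -> Mf N <= lnn N + 1.
Proof.
case: N => // N _; rewrite /Mf big_ltn // f_1 divr1 addrC lerD2r.
have := @lnn_sub_ge R 1 N.+1 isT; rewrite lnn1 subr0; apply: le_trans.
rewrite big_add1 /=; apply: ler_sum_nat => k _.
by rewrite ler_piMl ?invr_ge0 ?f_le1.
Qed.

Lemma Wf_ge0 N : 0 <= Wf N.
Proof.
rewrite /Wf big_seq; apply: sumr_ge0 => k; rewrite mem_index_iota ltnS => /andP[k0 kN].
by rewrite mulr_ge0 ?fdiv_ge0 // subr_ge0 ler_lnn.
Qed.

Lemma WfS N : Wf N.+1 = Wf N + Mf N * (lnn N.+1 - lnn N).
Proof.
rewrite /Wf big_nat_recr //= subrr mulr0 addr0 /Mf mulr_suml -big_split.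
by apply: eq_bigr => m _ /=; ring.
Qed.

Lemma Wf_incr m n : (m <= n)%N -> Wf m <= Wf n.
Proof.
elim: n => [|n IH]; first by rewrite leqn0 => /eqP ->.
rewrite leq_eqVlt => /orP[/eqP -> //|]; rewrite ltnS => /IH h; apply: le_trans h _.
by rewrite WfS lerDl mulr_ge0 ?Mf_ge0 ?lnn_step_ge0.
Qed.

Lemma lnn_div_bounds N m : (0 < m <= N)%N ->
  lnn (N %/ m) <= lnn N - lnn m <= lnn (N %/ m) + 1.
Proof.
move=> /andP[m0 mN]; have N0 := leq_trans m0 mN.
have k0 : (0 < N %/ m)%N by rewrite divn_gt0.
apply/andP; split.
  rewrite lerBrDr -lnnM //; apply: ler_lnn; last exact: leq_trunc_div.
  by rewrite muln_gt0 k0.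
have h : lnn N <= lnn ((N %/ m).+1 * m) by apply: ler_lnn; rewrite // ltnW // ltn_ceil.
rewrite lnnM // in h; have := lnn_step_le1 R k0; lra.
Qed.

(** Summing f ln = f * Lam_f with weights 1 / n gives L M - W on the left, and on the right M
    averaged against Mertens sums, that is W / 2 up to 8 M. *)
Lemma Mf_Wf N : (0 < N)%N -> `|lnn N * Mf N - 3 / 2 * Wf N| <= 8 * Mf N.
Proof.
move=> N0.
have e1 : lnn N * Mf N - Wf N = \sum_(1 <= m < N.+1) f_ m / m%:R * lnn m.
  by rewrite /Mf /Wf mulr_sumr -sumrB; apply: eq_bigr => m _; ring.
have e2 : \sum_(1 <= m < N.+1) f_ m / m%:R * lnn m =
    \sum_(1 <= m < N.+1) f_ m / m%:R * mertens_f R q (N %/ m).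
  transitivity (\sum_(1 <= m < N.+1) conv f_ Lam_f m * m%:R^-1).
    apply: eq_big_nat => m /andP[m0 _]; rewrite mulrAC f_log_deriv // convC //.
  rewrite sum_conv_weight; apply: eq_bigr => d _; rewrite -mulrA; congr (_ * _).
  by rewrite /mertens_f mulr_sumr; apply: eq_bigr => k _; rewrite natrM invfM; ring.
have -> : lnn N * Mf N - 3 / 2 * Wf N =
    \sum_(1 <= m < N.+1) f_ m / m%:R * (mertens_f R q (N %/ m) - (lnn N - lnn m) / 2).
  have -> : lnn N * Mf N - 3 / 2 * Wf N = (lnn N * Mf N - Wf N) - Wf N / 2 by lra.
  by rewrite e1 e2 /Wf mulr_suml -sumrB; apply: eq_bigr => m _; ring.
apply: le_trans (ler_norm_sum _ _ _) _; rewrite /Mf mulr_sumr.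
apply: ler_sum_nat => m /andP[m0]; rewrite ltnS => mN.
have k0 : (0 < N %/ m)%N by rewrite divn_gt0.
rewrite normrM ger0_norm ?fdiv_ge0 // mulrC; apply: ler_wpM2r; first exact: fdiv_ge0.
have := mertens_f_bounds R q34 k0; have : (0 < m <= N)%N by rewrite m0.
by move=> /lnn_div_bounds /andP[a b] /andP[c d]; rewrite ler_norml; lra.
Qed.

Lemma Wf_pos N : (1 < N)%N -> 0 < Wf N.
Proof.
move=> N1; rewrite /Wf big_ltn; last by rewrite ltnS ltnW.
rewrite f_1 divr1 lnn1 mul1r subr0; apply: ltr_wpDr; last by rewrite lnn_gt0.
rewrite big_seq; apply: sumr_ge0 => k; rewrite mem_index_iota ltnS => /andP[k0 kN].
by rewrite mulr_ge0 ?fdiv_ge0 // subr_ge0 ler_lnn // ltnW.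
Qed.

(** One step of the differential inequality: with t the relative increment of L - 8, W grows at
    most by the factor 1 + 3 t / 2, and (1 + 3 t / 2)^2 <= (1 + t)^3. *)
Lemma Wf_growth_le a b : (0 < a <= b)%N -> 9 <= lnn a ->
  Wf b ^+ 2 * (lnn a - 8) ^+ 3 <= Wf a ^+ 2 * (lnn b - 8) ^+ 3.
Proof.
move=> /andP[a0 ab] La; rewrite -(subnKC ab); elim: (b - a)%N => [|k IH]; first by rewrite addn0.
rewrite addnS; set n := (a + k)%N in IH *.
have n0 : (0 < n)%N by rewrite /n; lia.
have Ln : lnn a <= lnn n by apply: ler_lnn; rewrite // /n leq_addr.
have dn := lnn_step_ge0 R n; rewrite WfS.
have := Mf_Wf n0; rewrite ler_norml => /andP[_ hM].
have W0 := Wf_ge0 n; have M0 := Mf_ge0 n.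
move: hM W0 M0 dn Ln IH; set W := Wf n; set M := Mf n; set L := lnn n; set L' := lnn n.+1.
set La8 := lnn a - 8; set Wa := Wf a ^+ 2 => hM W0 M0 dn Ln IH.
have A0 : 0 <= La8 ^+ 3 by rewrite exprn_ge0 // /La8; lra.
have L8 : 1 <= L - 8 by lra.
set t := (L' - L) / (L - 8).
have t0 : 0 <= t by rewrite divr_ge0 //; lra.
have et : L' - 8 = (L - 8) * (1 + t) by rewrite /t; field; lra.
have hM' : M * (L' - L) <= W * (3 / 2 * t).
  rewrite /t !mulrA ler_pdivlMr; last by lra.
  by rewrite mulrAC; apply: ler_wpM2r => //; lra.
have t3 : 0 <= (1 + t) ^+ 3 by rewrite exprn_ge0 //; lra.
have IH2 := ler_wpM2r t3 IH.
rewrite et exprMn (mulrA Wa); apply: le_trans _ IH2.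
rewrite [leRHS]mulrAC; apply: ler_wpM2r => //.
apply: (@le_trans _ _ ((W * (1 + 3 / 2 * t)) ^+ 2)).
  by rewrite ler_sqr ?nnegrE ?addr_ge0 ?mulr_ge0 //; lra.
rewrite exprMn; apply: ler_wpM2l; first by rewrite exprn_ge0.
by rewrite !exprS expr0; nra.
Qed.

(** Here W grows at least by the factor 1 + (3/2) (L' - L) / (L + 8). For this to beat the step
    of (L + 9)^(3/2), the constant 8 is raised to 9; the gain pays for the second order terms. *)
Lemma Wf_growth_ge a b : (0 < a <= b)%N -> 9 <= lnn a ->
  Wf a ^+ 2 * (lnn b + 9) ^+ 3 <= Wf b ^+ 2 * (lnn a + 9) ^+ 3.
Proof.
move=> /andP[a0 ab] La; rewrite -(subnKC ab); elim: (b - a)%N => [|k IH]; first by rewrite addn0.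
rewrite addnS; set n := (a + k)%N in IH *.
have n0 : (0 < n)%N by rewrite /n; lia.
have Ln : lnn a <= lnn n by apply: ler_lnn; rewrite // /n leq_addr.
have dn := lnn_step_ge0 R n; have dn1 := lnn_step_le1 R n0; rewrite WfS.
have := Mf_Wf n0; rewrite ler_norml => /andP[hM _].
have W0 := Wf_ge0 n; have M0 := Mf_ge0 n.
move: hM W0 M0 dn dn1 Ln IH; set W := Wf n; set M := Mf n; set L := lnn n; set L' := lnn n.+1.
set A := (lnn a + 9) ^+ 3; set Wa := Wf a ^+ 2 => hM W0 M0 dn dn1 Ln IH.
have A0 : 0 <= A by rewrite exprn_ge0 //; lra.
set t := (L' - L) / (L + 9).
have t0 : 0 <= t by rewrite divr_ge0 //; lra.
have et : L' + 9 = (L + 9) * (1 + t) by rewrite /t; field; lra.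
set u := (L + 8)^-1.
have u0 : 0 <= u by rewrite invr_ge0; lra.
have u1 : u <= 1 by rewrite invf_le1; lra.
have tu : t <= u.
  rewrite /t /u ler_pdivrMr; last by lra.
  by rewrite mulrC ler_pdivlMr; nra.
have e2 : (L' - L) * u = t * (1 + u) by rewrite /t /u; field; apply/andP; split; lra.
have hM' : W * (3 / 2 * (t * (1 + u))) <= M * (L' - L).
  rewrite -e2 /u mulrCA !mulrA ler_pdivrMr; last by lra.
  by rewrite [leRHS]mulrAC; apply: ler_wpM2r => //; lra.
have t3 : 0 <= (1 + t) ^+ 3 by rewrite exprn_ge0 //; lra.
have IH2 := ler_wpM2r t3 IH.
rewrite et exprMn (mulrA Wa); apply: le_trans IH2 _.
rewrite mulrAC; apply: ler_wpM2r => //.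
apply: (@le_trans _ _ ((W * (1 + 3 / 2 * (t * (1 + u)))) ^+ 2)); last first.
  have tu0 : 0 <= t * (1 + u) by rewrite mulr_ge0 //; lra.
  by rewrite ler_sqr ?nnegrE ?addr_ge0 ?mulr_ge0 //; lra.
rewrite exprMn; apply: ler_wpM2l; first by rewrite exprn_ge0.
have h1 : t * t <= t * u by apply: ler_wpM2l.
have t1 : t <= 1 by lra.
have h4 : t * t <= u by nra.
have h2 : t * t * t <= t * u by rewrite -mulrA; apply: ler_wpM2l.
have h3 : 0 <= t * u by rewrite mulr_ge0.
rewrite !exprS expr0; nra.
Qed.
End Growth.

(** * The convolution square of the indicator *)

Section LogSquare.
Variable R : realType.
Implicit Types (n m k d N : nat).
Local Notation lnn := (@lnn R).

Definition harm n : R := \sum_(1 <= i < n.+1) i%:R^-1.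

Lemma harm_ge n : (0 < n)%N -> lnn n.+1 <= harm n.
Proof. by move=> n0; have := @lnn_sub_le R 1 n.+1 isT; rewrite lnn1 subr0. Qed.

Lemma harm_le n : (0 < n)%N -> harm n <= lnn n + 1.
Proof.
case: n => // n _; rewrite /harm big_ltn // invr1 addrC lerD2r.
by have := @lnn_sub_ge R 1 n.+1 isT; rewrite lnn1 subr0 big_add1.
Qed.

Definition harmW n : R := \sum_(1 <= i < n.+1) i%:R^-1 * (lnn n - lnn i).

Lemma harmWS n : harmW n.+1 = harmW n + harm n * (lnn n.+1 - lnn n).
Proof.
rewrite /harmW big_nat_recr //= subrr mulr0 addr0 /harm mulr_suml -big_split.
by apply: eq_bigr => m _ /=; ring.
Qed.

Lemma harmW_bounds n : (0 < n)%N ->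
  lnn n ^+ 2 / 2 <= harmW n <= lnn n ^+ 2 / 2 + lnn n.
Proof.
elim: n => // n IH _; case: (posnP n) => [->|n0].
  by rewrite /harmW big_nat1 lnn1 subrr mulr0; lra.
have := IH n0; rewrite harmWS; have := harm_ge n0; have := harm_le n0.
have := lnn_step_ge0 R n; have := lnn_ge0 R n.
set l := lnn n; set l' := lnn n.+1; set h := harm n => l0 d0 h1 h2 /andP[a b].
by apply/andP; split; rewrite !expr2 in a b *; nra.
Qed.

(** The logarithmic mean over the multiples of t up to N, a model for u^2 / 2 with
    u = ln (N / t). *)
Definition harmV N t : R := \sum_(1 <= i < (N %/ t).+1) i%:R^-1 * (lnn N - lnn t - lnn i).

Lemma harmV_big N t : (N < t)%N -> harmV N t = 0.
Proof. by move=> Nt; rewrite /harmV divn_small // big_geq. Qed.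

Lemma harmV_term_ge0 N t i : (0 < t)%N -> (0 < i < (N %/ t).+1)%N ->
  0 <= lnn N - lnn t - lnn i.
Proof.
move=> t0 /andP[i0]; rewrite ltnS leq_divRL // => h.
by rewrite -addrA -opprD subr_ge0 addrC -lnnM // ler_lnn // muln_gt0 i0.
Qed.

Lemma harmV_ge0 N t : (0 < t)%N -> 0 <= harmV N t.
Proof.
move=> t0; rewrite /harmV big_seq; apply: sumr_ge0 => i; rewrite mem_index_iota => h.
by rewrite mulr_ge0 ?invr_ge0 //; apply: harmV_term_ge0.
Qed.

(** Monotone in t, which is what Abel summation against the character needs. *)
Lemma harmV_decr N s t : (0 < s <= t)%N -> harmV N t <= harmV N s.
Proof.
move=> /andP[s0 st]; have le : (N %/ t <= N %/ s)%N by apply: leq_div2l.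
rewrite /harmV [leRHS](@big_cat_nat _ _ _ (N %/ t).+1) //=; apply: ler_wpDr.
  rewrite big_seq; apply: sumr_ge0 => i; rewrite mem_index_iota => /andP[h1 h2].
  by rewrite mulr_ge0 ?invr_ge0 //; apply: harmV_term_ge0 => //; rewrite h2 (leq_ltn_trans _ h1).
apply: ler_sum_nat => i _; apply: ler_wpM2l; first by rewrite invr_ge0.
by have := @ler_lnn R s t s0 st; lra.
Qed.

Lemma harmV_bounds N t (u := lnn N - lnn t) : (0 < t <= N)%N ->
  u ^+ 2 / 2 - u <= harmV N t <= u ^+ 2 / 2 + 2 * u + 2.
Proof.
move=> tN; have /andP[l1 l2] := lnn_div_bounds R tN.
rewrite -/u in l1 l2.
case/andP: (tN) => t0 tN'; set n := (N %/ t)%N in l1 l2.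
have n0 : (0 < n)%N by rewrite divn_gt0.
have e : harmV N t = harmW n + harm n * (u - lnn n).
  rewrite /harmV -/n -/u /harmW /harm mulr_suml -big_split; apply: eq_bigr => i _ /=; ring.
have /andP[w1 w2] := harmW_bounds n0; have h1 := harm_ge n0; have h2 := harm_le n0.
have ln0 := lnn_ge0 R n; have lS := lnn_step_ge0 R n.
rewrite e; move: w1 w2 h1 h2 ln0 lS; set l := lnn n in l1 l2 *; set h := harm n.
move=> w1 w2 h1 h2 ln0 lS; rewrite !expr2 in w1 w2 *.
have h0 : 0 <= h by lra.
by apply/andP; split; nra.
Qed.
End LogSquare.

Section RSum.
Variables (R : realType) (q : nat).
Hypothesis q34 : q = 3%N \/ q = 4%N.
Implicit Types (n m k d N : nat).
Local Notation lnn := (@lnn R).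
Local Notation chi := (@chi R q).
Local Notation r_ := (@r_ R q).
Local Notation h_ := (@h_ R q).
Local Notation f_ := (@f_ R q).

(** The contribution to the convolution square of the terms n = d k with d in the support of h. *)
Definition rsum N d : R := \sum_(1 <= k < (N %/ d).+1) r_ k / k%:R * (lnn N - lnn d - lnn k).

Lemma rsum_ge0 N d : (0 < d)%N -> 0 <= rsum N d.
Proof.
move=> d0; rewrite /rsum big_seq; apply: sumr_ge0 => i; rewrite mem_index_iota => h.
have /andP[i0 _] := h.
by rewrite !mulr_ge0 ?invr_ge0 ?r_ge0 //; apply: harmV_term_ge0.
Qed.

(** Since r = chi * 1, a sum over the character of the means [harmV]; the upper limit n may be
    chosen freely because [harmV] vanishes beyond N. *)
Lemma rsumE N d n : (0 < d)%N -> (N %/ d <= n)%N ->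
  rsum N d = \sum_(1 <= j < n.+1) chi j * (harmV R N (d * j) / j%:R).
Proof.
move=> d0 dn; rewrite [RHS](@big_cat_nat _ _ _ (N %/ d).+1) //= [X in _ + X]big1_seq ?addr0; last first.
  move=> j; rewrite mem_index_iota => /and3P[_ j1 _].
  by rewrite harmV_big ?mul0r ?mulr0 // mulnC -ltn_divLR.
transitivity (\sum_(1 <= k < (N %/ d).+1) conv chi (fun=> 1) k * (k%:R^-1 * (lnn N - lnn d - lnn k))).
  by apply: eq_big_nat => k /andP[k0 _]; rewrite -mulrA /r_ convC.
rewrite sum_conv_weight; apply: eq_big_nat => j /andP[j0 _]; congr (_ * _).
rewrite /harmV mulr_suml -divnMA; apply: eq_big_nat => i /andP[i0 _].
by rewrite !lnnM // natrM invfM mul1r; ring.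
Qed.

Lemma rsum_trunc N d J (u := lnn N - lnn d) : (0 < d <= N)%N ->
  `|\sum_(1 <= j < J.+1) chi j * (harmV R N (d * j) / j%:R) - Lsum R q J * (u ^+ 2 / 2)|
   <= J%:R * ((lnn J + 2) * u + 2).
Proof.
move=> dN; have /andP[d0 dN'] := dN.
have u0 : 0 <= u by rewrite subr_ge0 ler_lnn.
rewrite /Lsum mulr_suml -sumrB; apply: le_trans (ler_norm_sum _ _ _) _.
have -> : J%:R * ((lnn J + 2) * u + 2) = \sum_(1 <= j < J.+1) ((lnn J + 2) * u + 2).
  by rewrite sumr_const_nat subSS subn0 mulr_natl.
apply: ler_sum_nat => j /andP[j0]; rewrite ltnS => jJ.
have -> : chi j * (harmV R N (d * j) / j%:R) - chi j / j%:R * (u ^+ 2 / 2) =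
   chi j * (j%:R^-1 * (harmV R N (d * j) - u ^+ 2 / 2)) by ring.
rewrite !normrM normfV; apply: le_trans (ler_piMl _ (normr_chi R q j)) _.
  by rewrite mulr_ge0 ?invr_ge0.
have j1 : `|j%:R : R|^-1 <= 1 by rewrite normr_nat invf_le1 ?ltr0n // ler1n.
apply: le_trans (ler_piMl _ j1) _ => //.
have lj : lnn j <= lnn J by apply: ler_lnn.
have lj0 := lnn_ge0 R j; have dj0 : (0 < d * j)%N by rewrite muln_gt0 d0.
have up : harmV R N (d * j) <= u ^+ 2 / 2 + 2 * u + 2.
  have /andP[_ h] := harmV_bounds R dN.
  by apply: le_trans h; apply: harmV_decr; rewrite d0 leq_pmulr.
have lo : u ^+ 2 / 2 - (lnn j + 1) * u <= harmV R N (d * j).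
  case: (leqP (d * j) N) => h.
    have := @harmV_bounds R N (d * j); rewrite h dj0 /= => /(_ isT) /andP[+ _].
    rewrite lnnM // opprD addrA -/u; apply: le_trans; rewrite !expr2; nra.
  rewrite harmV_big //; have : lnn N <= lnn (d * j).
    by apply: ler_lnn; [exact: leq_trans dN'|exact: ltnW].
  rewrite lnnM // expr2 /u => hl; rewrite -/u; have : u <= lnn j by rewrite /u; lra.
  by nra.
rewrite ler_norml; apply/andP; split; nra.
Qed.

(** Cutting the sum over the character at J leaves a remainder whose sign is known: by
    [chi_abel_decr] it is nonnegative if the character sums to 0 up to J and nonpositive if it
    sums to 1. So one cut gives an upper bound and the other one a lower bound, with no error
    depending on J. *)
Lemma rsum_tail N d J : (0 < d)%N -> (0 < J)%N ->
  let S := \sum_(1 <= j < J.+1) chi j * (harmV R N (d * j) / j%:R) in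
  (chi_sum q J = false -> S <= rsum N d) /\ (chi_sum q J -> rsum N d <= S).
Proof.
move=> d0 J0 S; have dec k : (J < k)%N -> harmV R N (d * k.+1) / k.+1%:R <= harmV R N (d * k) / k%:R.
  move=> Jk; have k0 : (0 < k)%N by apply: leq_trans Jk.
  apply: ler_pM; rewrite ?invr_ge0 ?harmV_ge0 ?muln_gt0 ?d0 //; last exact: inv_nat_decr.
  by apply: harmV_decr; rewrite muln_gt0 d0 k0 leq_mul2l leqnSn orbT.
have ge0 k : (J < k)%N -> 0 <= harmV R N (d * k) / k%:R.
  by move=> Jk; rewrite divr_ge0 ?harmV_ge0 // muln_gt0 d0 (leq_trans _ Jk).
have /andP[h1 h2] := @chi_abel_decr R q q34 _ J (N %/ d + J) dec ge0.
rewrite (@rsumE N d (N %/ d + J)) ?leq_addr //.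
rewrite (@big_cat_nat _ _ _ J.+1 1 (N %/ d + J).+1) ?ltnS ?leq_addl //= -/S.
move: h1 h2; set Y := \sum_(J.+1 <= _ < _) _ => h1 h2.
split=> sJ; rewrite sJ in h1 h2; first by rewrite lerDl; move: h1; rewrite oppr0 mul0r.
by rewrite gerDl; move: h2; rewrite subrr mul0r.
Qed.

Definition Sff N : R := \sum_(1 <= n < N.+1) conv f_ f_ n * ((lnn N - lnn n) / n%:R).

Lemma Sff_rsum N : Sff N = \sum_(1 <= d < N.+1) h_ d / d%:R * rsum N d.
Proof.
transitivity (\sum_(1 <= n < N.+1) conv h_ r_ n * ((lnn N - lnn n) / n%:R)).
  by apply: eq_big_nat => n /andP[n0 _]; rewrite f_conv_f // convC.
rewrite sum_conv_weight; apply: eq_big_nat => d /andP[d0 _]; rewrite -mulrA; congr (_ * _).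
rewrite /rsum mulr_sumr; apply: eq_big_nat => k /andP[k0 _].
by rewrite lnnM // natrM invfM; ring.
Qed.
End RSum.

(** * Comparing the convolution squares of two forms *)

Section Compare.
Variables (R : realType).
Implicit Types (n m k d N : nat).
Local Notation lnn := (@lnn R).

(** The mean [Wf] at the real point N / m, rounded down only in the range of summation. *)
Definition Uf q N m : R :=
  \sum_(1 <= k < (N %/ m).+1) f_ R q k / k%:R * (lnn N - lnn m - lnn k).

Lemma Uf_bounds q N m : (0 < m <= N)%N ->
  Wf R q (N %/ m) <= Uf q N m <= Wf R q (N %/ m).+1.
Proof.
move=> mN; have /andP[l1 l2] := lnn_div_bounds R mN; case/andP: (mN) => m0 mN'.
set n := (N %/ m)%N in l1 l2 *.
have e : Uf q N m = Wf R q n + Mf R q n * (lnn N - lnn m - lnn n).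
  by rewrite /Uf -/n /Wf /Mf mulr_suml -big_split; apply: eq_bigr => i _ /=; ring.
have M0 := Mf_ge0 R q n; rewrite e WfS lerDl lerD2l; apply/andP; split.
  by rewrite mulr_ge0 // subr_ge0.
apply: ler_wpM2l => //; rewrite lerD2r lerBlDr -lnnM //; apply: ler_lnn.
  exact: leq_trans mN'.
by rewrite ltnW // ltn_ceil.
Qed.

Definition Sab (a b : nat -> R) N : R := \sum_(1 <= n < N.+1) conv a b n * ((lnn N - lnn n) / n%:R).

Lemma Sab_Uf (a : nat -> R) q N : Sab a (f_ R q) N = \sum_(1 <= m < N.+1) a m / m%:R * Uf q N m.
Proof.
rewrite /Sab sum_conv_weight; apply: eq_big_nat => d /andP[d0 _]; rewrite -mulrA; congr (_ * _).
rewrite /Uf mulr_sumr; apply: eq_big_nat => k /andP[k0 _].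
by rewrite lnnM // natrM invfM; ring.
Qed.

Lemma SabC (a b : nat -> R) N : Sab a b N = Sab b a N.
Proof. by apply: eq_big_nat => n /andP[n0 _]; rewrite convC. Qed.

(** Replace one factor f after the other in the bilinear sum [Sab]: each time the inner sum is a
    mean W of one form and is at most kappa times that of the other form, up to a constant that
    absorbs the arguments below n0 and the rounding. *)
Lemma Sff_compare q1 q3 (kap : R) n0 N : 0 <= kap ->
  (forall n, (n0 <= n)%N -> Wf R q1 n <= kap * Wf R q3 n) -> (0 < N)%N ->
  Sff R q1 N <= kap ^+ 2 * Sff R q3 N + (1 + kap) * (kap + Wf R q1 n0) * (lnn N + 1).
Proof.
move=> k0 hW N0; set C := kap + Wf R q1 n0.
have U13 m : (0 < m <= N)%N -> Uf q1 N m <= kap * Uf q3 N m + C.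
  move=> mN; have /andP[_ h1] := Uf_bounds q1 mN; have /andP[h3 _] := Uf_bounds q3 mN.
  have np : (0 < N %/ m)%N by case/andP: mN => a b; rewrite divn_gt0.
  set n := (N %/ m)%N in h1 h3 np; apply: le_trans h1 _.
  have W10 := Wf_ge0 R q1 n0; have W30 := Wf_ge0 R q3 n.
  have kU : kap * Wf R q3 n <= kap * Uf q3 N m by apply: ler_wpM2l.
  have kW : 0 <= kap * Wf R q3 n by apply: mulr_ge0.
  case: (leqP n0 n.+1) => hn; last first.
    have h := @Wf_incr R q1 _ _ (ltnW hn); apply: le_trans h _.
    by apply: ler_wpDl; [exact: le_trans kU|rewrite /C lerDr].
  have := hW _ hn; rewrite [X in _ <= kap * X]WfS => h; apply: le_trans h _.
  have : Mf R q3 n * (lnn n.+1 - lnn n) <= 1.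
    have np' : 0 < n%:R :> R by rewrite ltr0n.
    have h1 := Mf_le R q3 np; have h2 := lnn_step_le R np.
    have h4 := lnn_tangent R np (isT : (0 < 1)%N); rewrite lnn1 divr1 in h4.
    have h5 : n%:R * (lnn n.+1 - lnn n) <= 1 by rewrite mulrC -ler_pdivlMr // div1r.
    have h6 := lnn_step_ge0 R n; have M0 := Mf_ge0 R q3 n.
    by nra.
  move=> hM; have := ler_wpM2l k0 hM; rewrite mulr1 => hk.
  by rewrite mulrDr; apply: lerD => //; apply: le_trans hk _; rewrite /C lerDl.
have C0 : 0 <= C by rewrite addr_ge0 ?Wf_ge0.
have step qa : Sab (f_ R qa) (f_ R q1) N <= kap * Sab (f_ R qa) (f_ R q3) N + C * (lnn N + 1).
  rewrite !Sab_Uf; apply: (@le_trans _ _ (kap * (\sum_(1 <= m < N.+1) f_ R qa m / m%:R * Uf q3 N m)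
      + C * Mf R qa N)).
    rewrite /Mf !mulr_sumr -big_split; apply: ler_sum_nat => m /andP[m0]; rewrite ltnS => mN /=.
    have := U13 m; rewrite m0 mN => /(_ isT) h.
    have := ler_wpM2l (fdiv_ge0 R qa m) h; lra.
  by rewrite lerD2l; apply: ler_wpM2l => //; apply: Mf_le.
have s1 := step q1; have s3 := step q3; rewrite [X in X <= _]SabC in s3.
have s3' := ler_wpM2l k0 s3.
rewrite -[Sff R q1 N]/(Sab (f_ R q1) (f_ R q1) N) -[Sff R q3 N]/(Sab (f_ R q3) (f_ R q3) N).
by rewrite expr2; lra.
Qed.

(** Compare leading coefficients along N = 2^(2(k + N0)), where L is large. *)
Lemma quadratic_compare (a b c : R) N0 :
  (forall N, (N0 <= N)%N -> a * lnn N ^+ 2 <= b * lnn N ^+ 2 + c * (lnn N + 1)) -> a <= b.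
Proof.
move=> h; rewrite leNgt; apply/negP => ba.
have l2 : 1 / 2 <= lnn 2.
  by have := @lnn_sub_ge R 1 2 isT; rewrite lnn1 subr0 big_nat1; lra.
have [k hk] : exists k, (2 * `|c| / (a - b) < k%:R /\ 2 <= k%:R :> R).
  exists (Num.truncn (2 * `|c| / (a - b))).+3; split; last by rewrite ler_nat.
  by apply: lt_le_trans (truncnS_gt _) _; rewrite ler_nat ltnS (leqW (leqnSn _)).
have hN := h (2 ^ (2 * (k + N0)))%N; set N := (2 ^ _)%N in hN.
have N0N : (N0 <= N)%N.
  have h2 : (2 * (k + N0) <= N)%N by apply: ltnW; rewrite /N ltn_expl.
  by apply: leq_trans h2; rewrite mulnDr; apply: leq_trans (leq_addl _ _); rewrite leq_pmull.
have lN : (k + N0)%:R <= lnn N.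
  rewrite /N lnnX natrM.
  by move: (ler0n R (k + N0)); set x := (k + N0)%:R; move: l2; clear; nra.
have kN : k%:R <= lnn N by apply: le_trans lN; rewrite ler_nat leq_addr.
have {}hN := hN N0N; case: hk => hk1 hk2.
rewrite ltr_pdivrMr in hk1; last by rewrite subr_gt0.
have c1 := ler_norm c; set l := lnn N in hN lN kN; rewrite expr2 in hN.
have c0 := normr_ge0 c.
have l1 : c * (l + 1) <= `|c| * (2 * l) by nra.
have l0 : 0 < l by lra.
have : (a - b) * l <= 2 * `|c|.
  rewrite -(ler_pM2r l0); have -> : (a - b) * l * l = a * (l * l) - b * (l * l) by ring.
  have -> : 2 * `|c| * l = `|c| * (2 * l) by ring.
  by move: hN l1; set x := a * _; set y := b * _; lra.
have : k%:R * (a - b) <= l * (a - b) by apply: ler_wpM2r; [lra|].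
nra.
Qed.
End Compare.

(** * Numerical values of the second moments *)

Section Rho.
Variables (R : realType).
Implicit Types (n m k d N : nat).
Local Notation lnn := (@lnn R).

(** Here 100 = 1 mod 3, so the partial sum is above L(1, chi), which is about 0.6046. *)
Lemma Lsum3_le : Lsum R 3 100 <= 30 / 49.
Proof.
rewrite /Lsum /chi unlock /= /reducebig /=.
rewrite ?subr0 ?sub0r ?subrr.
lra.
Qed.

(** Here 99 = 3 mod 4, so the partial sum is below L(1, chi), which is about 0.7854. *)
Lemma Lsum4_ge : 39 / 50 <= Lsum R 4 99.
Proof.
rewrite /Lsum /chi unlock /= /reducebig /=.
rewrite ?subr0 ?sub0r ?subrr.
lra.
Qed.

Lemma sum_nosplit_le q K N : (0 < K)%N ->
  \sum_(1 <= m < N.+1) nosplit R q m / m%:R ^+ 2 <=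
  \sum_(1 <= m < K.+1) nosplit R q m / m%:R ^+ 2 + K%:R^-1.
Proof.
move=> K0; have v0 m : 0 <= nosplit R q m / m%:R ^+ 2 by rewrite divr_ge0 ?exprn_ge0 ?ler0n.
case: (leqP K N) => NK.
  rewrite (@big_cat_nat _ _ _ K.+1) //= lerD2l; apply: le_trans (@sum_inv_sqr_tail R K N K0).
  apply: ler_sum_nat => m _.
  by rewrite ler_piMl ?nosplit_le1 // invr_ge0 exprn_ge0.
apply: ler_wpDr; first by rewrite invr_ge0.
rewrite [leRHS](@big_cat_nat _ _ _ N.+1) //=; last by rewrite ltnS ltnW.
by rewrite lerDl; apply: sumr_ge0.
Qed.

(** The limit is about 1.591; the tail beyond 60 costs 1/60. *)
Lemma sum_nosplit3_le N :
  \sum_(1 <= m < N.+1) nosplit R 3 m / m%:R ^+ 2 <= 8 / 5.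
Proof.
apply: le_trans (@sum_nosplit_le 3 60 N isT) _.
have e : \sum_(1 <= m < 61) nosplit R 3 m / m%:R ^+ 2 <= 19 / 12.
  rewrite /nosplit unlock /= /reducebig /=.
  lra.
lra.
Qed.

Lemma sum_h3_le N : \sum_(1 <= d < N.+1) h_ R 3 d / d%:R <= 32 / 15.
Proof.
have i0 n : 0 <= n%:R^-1 :> R by rewrite invr_ge0.
apply: le_trans (@sum_h_le R 3 (or_introl erefl) (fun n => n%:R^-1) N i0) _.
have -> : \sum_(1 <= m < N.+1) nosplit R 3 m * ((m ^ 2)%:R^-1 + (ramified_prime 3 * m ^ 2)%:R^-1) =
    4 / 3 * \sum_(1 <= m < N.+1) nosplit R 3 m / m%:R ^+ 2.
  rewrite mulr_sumr; apply: eq_bigr => m _.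
  rewrite (_ : ramified_prime 3 = 3)%N // (natrM _ 3) natrX; set x := m%:R ^+ 2; by rewrite (invfM 3 x); set y := x^-1; field.
have := sum_nosplit3_le N; lra.
Qed.

(** Every d contributes at most Lsum 100 * L^2 / 2 up to O(L), by the cut at 100, and the weights
    h d / d sum to at most 32/15. *)
Lemma Sff3_le : exists c : R, forall N, (0 < N)%N ->
  Sff R 3 N <= 32 / 15 * (30 / 49) / 2 * lnn N ^+ 2 + c * (lnn N + 1).
Proof.
have q3 : 3%N = 3%N \/ 3%N = 4%N by left.
pose c0 : R := 100 * (lnn 100 + 2) + 200; exists (5 / 2 * c0) => N N0.
have l0 := lnn_ge0 R N; have l100 := lnn_ge0 R 100.
have c00 : 0 <= c0 by rewrite /c0; lra.
rewrite Sff_rsum // (_ : _ / 2 * _ + _ = 32 / 15 * (30 / 49 * (lnn N ^+ 2 / 2)) + 5 / 2 * (c0 * (lnn N + 1))); last by ring.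
set X := 30 / 49 * (lnn N ^+ 2 / 2); set Y := c0 * (lnn N + 1).
have X0 : 0 <= X by rewrite /X !mulr_ge0 ?invr_ge0 ?exprn_ge0.
have Y0 : 0 <= Y by rewrite mulr_ge0 //; lra.
apply: (@le_trans _ _ (\sum_(1 <= d < N.+1) h_ R 3 d / d%:R * (X + Y))); last first.
  rewrite -mulr_suml; apply: le_trans (ler_wpM2r _ (sum_h3_le N)) _; first by lra.
  by lra.
apply: ler_sum_nat => d /andP[d0]; rewrite ltnS => dN.
apply: ler_wpM2l; first by rewrite divr_ge0 // /h_ ler0n.
have [_ /(_ isT) h] := @rsum_tail R 3 q3 N d 100 d0 isT.
apply: le_trans h _.
have dN' : (0 < d <= N)%N by rewrite d0.
have := @rsum_trunc R 3 N d 100 dN'.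
set S := \sum_(1 <= j < _) _; set u := lnn N - lnn d.
have u0 : 0 <= u by rewrite subr_ge0 ler_lnn.
have ul : u <= lnn N by rewrite /u; have := lnn_ge0 R d; lra.
have u2 : u ^+ 2 <= lnn N ^+ 2 by rewrite ler_sqr ?nnegrE.
rewrite ler_norml => /andP[_ hS].
have L3 := Lsum3_le; have L0 : 0 <= Lsum R 3 100 by apply: le_trans _ (@Lsum_ge R 3 q3 100 isT); lra.
have h1 : Lsum R 3 100 * (u ^+ 2 / 2) <= X.
  by rewrite /X; apply: ler_pM => //; rewrite ?mulr_ge0 ?exprn_ge0 ?invr_ge0 //; lra.
have h2 : 100%:R * ((lnn 100 + 2) * u + 2) <= Y by rewrite /Y /c0; nra.
lra.
Qed.

(** Elements of the support of h for q = 4: the primes 3, 7, 11, 19, 23 are inert, and 2 is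
    ramified. The reciprocals of this finite part of the support already sum to more than 23/10. *)
Definition dlist4 : seq nat :=
  [seq (2 ^ a * m ^ 2)%N | a <- iota 0 7, m <- [:: 1; 3; 7; 9; 11; 19; 21; 23]%N].

Lemma sum_dlist4 : 23 / 10 <= \sum_(d <- dlist4) (d%:R^-1 : R) <= 5 / 2.
Proof.
have -> : \sum_(d <- dlist4) d%:R^-1 = (\sum_(a <- iota 0 7) 2^-1 ^+ a) *
    \sum_(m <- [:: 1; 3; 7; 9; 11; 19; 21; 23]%N) (m%:R ^+ 2)^-1 :> R.
  rewrite /dlist4 big_allpairs_dep mulr_suml; apply: eq_bigr => a _.
  rewrite mulr_sumr; apply: eq_bigr => m _.
  by rewrite (natrM _ (2 ^ a)) !natrX (invfM _ (m%:R ^+ 2)) exprVn.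
have -> : \sum_(a <- iota 0 7) 2^-1 ^+ a = 127 / 64 :> R.
  by rewrite unlock /= /reducebig /=; field.
rewrite unlock /= /reducebig /=; lra.
Qed.

(** The statement hides the list behind an existential quantifier, so that later proofs do not
    unfold it. *)
Lemma ex_h4_list : exists (s : seq nat) (D : nat), [/\ uniq s,
  {in s, forall d, [&& 0 < d, d <= D & adm (split 4) (inert 4) d]%N} &
  23 / 10 <= \sum_(d <- s) (d%:R^-1 : R) <= 5 / 2].
Proof.
exists dlist4, (2 ^ 6 * 23 ^ 2)%N; split; [by vm_compute| |exact: sum_dlist4].
by apply/allP; vm_compute.
Qed.

(** All terms are nonnegative, so it is enough to keep finitely many d, each with the cut at
    99. *)
Lemma Sff4_ge : exists (c : R) N0, forall N, (N0 <= N)%N ->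
  23 / 10 * (39 / 50) / 2 * lnn N ^+ 2 - c * (lnn N + 1) <= Sff R 4 N.
Proof.
have q4 : 4%N = 3%N \/ 4%N = 4%N by right.
have [dlist [D [du hall hsum]]] := ex_h4_list.
pose c0 : R := lnn D + 99 * (lnn 99 + 2) + 198; exists (5 / 2 * c0), D => N DN.
have l0 := lnn_ge0 R N; have l99 := lnn_ge0 R 99; have lD := lnn_ge0 R D.
have c00 : 0 <= c0 by rewrite /c0; lra.
set X := 39 / 50 * (lnn N ^+ 2 / 2); set Y := c0 * (lnn N + 1).
have X0 : 0 <= X by rewrite /X !mulr_ge0 ?invr_ge0 ?exprn_ge0.
have Y0 : 0 <= Y by rewrite mulr_ge0 //; lra.
apply: (@le_trans _ _ (\sum_(d <- dlist) d%:R^-1 * (X - Y))).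
  rewrite -mulr_suml; move: hsum; set S := \sum_(_ <- _) _ => /andP[h2 h1].
  have h3 : 23 / 10 * X <= S * X by apply: ler_wpM2r.
  have h4 : S * Y <= 5 / 2 * Y by apply: ler_wpM2r.
  have -> : 23 / 10 * (39 / 50) / 2 * lnn N ^+ 2 - 5 / 2 * c0 * (lnn N + 1) =
    23 / 10 * X - 5 / 2 * Y by rewrite /X /Y; ring.
  by rewrite mulrBr; lra.
rewrite Sff_rsum //.
apply: (@le_trans _ _ (\sum_(d <- dlist) h_ R 4 d / d%:R * rsum R 4 N d)).
  rewrite big_seq [leRHS]big_seq; apply: ler_sum => d /hall /and3P[d0 dD hd].
  have dN : (0 < d <= N)%N by rewrite d0 (leq_trans dD).
  rewrite /h_ hd mul1r; apply: ler_wpM2l; first by rewrite invr_ge0.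
  have [/(_ erefl) h _] := @rsum_tail R 4 q4 N d 99 d0 isT.
  apply: le_trans h; have := @rsum_trunc R 4 N d 99 dN.
  set S := \sum_(1 <= j < _) _; set u := lnn N - lnn d.
  have u0 : 0 <= u by rewrite subr_ge0 ler_lnn // (leq_trans dD).
  have ld : lnn d <= lnn D by apply: ler_lnn.
  have ld0 := lnn_ge0 R d.
  have ul : u <= lnn N by rewrite /u; lra.
  rewrite ler_norml => /andP[hS _]; have L4 := Lsum4_ge.
  have u20 : 0 <= u ^+ 2 / 2 by rewrite mulr_ge0 ?exprn_ge0 ?invr_ge0.
  have h1 : 39 / 50 * (u ^+ 2 / 2) <= Lsum R 4 99 * (u ^+ 2 / 2) by apply: ler_wpM2r.
  have h2 : X - lnn D * lnn N <= 39 / 50 * (u ^+ 2 / 2).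
    by rewrite /X /u !expr2; nra.
  have h3 : 99%:R * ((lnn 99 + 2) * u + 2) + lnn D * lnn N <= Y by rewrite /Y /c0; nra.
  by lra.
have F0 d : (0 < d)%N -> 0 <= h_ R 4 d / d%:R * rsum R 4 N d.
  by move=> d0; rewrite mulr_ge0 ?rsum_ge0 // divr_ge0 // /h_ ler0n.
have pf : perm_eq [seq i <- index_iota 1 N.+1 | i \in dlist] dlist.
  apply: uniq_perm; [by rewrite filter_uniq ?iota_uniq|exact: du|move=> d].
  rewrite mem_filter mem_index_iota.
  case: (boolP (d \in dlist)) => //= /hall /and3P[d0 dD _].
  by rewrite d0 ltnS (leq_trans dD).
rewrite [leRHS](bigID (mem dlist)) /= -[X in _ <= X + _]big_filter (perm_big _ pf).
rewrite lerDl big_seq_cond; apply: sumr_ge0 => d /andP[]; rewrite mem_index_iota => /andP[d0 _] _.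
exact: F0.
Qed.
End Rho.

(** * The method of Chebyshev with general coefficients *)

Section Chebyshev.
Variables (R : realType) (q : nat).
Hypothesis q34 : q = 3%N \/ q = 4%N.
Implicit Types (n m k d N : nat) (cs es vs : seq (nat * R)).
Local Notation lnn := (@lnn R).
Local Notation Mangoldt := (@Mangoldt R).
Local Notation chi := (@chi R q).
Local Notation psi := (@psi R).

(** Stirling at the integer part of y = N / d against y ln y - y. *)
Lemma T_div_approx N d : (0 < d <= N)%N ->
  `|T R (N %/ d) - (N%:R / d%:R * (lnn N - lnn d) - N%:R / d%:R)| <= lnn N + 2.
Proof.
move=> dN; have /andP[l1 l2] := lnn_div_bounds R dN; have /andP[d0 dN'] := dN.
have n0 : (0 < N %/ d)%N by rewrite divn_gt0.
have y1 := natdiv_le R N d0; have y2 := natdiv_gt R N d0.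
have hS : lnn N - lnn d <= lnn (N %/ d).+1.
  rewrite lerBlDr -lnnM //; apply: ler_lnn; first exact: leq_trans dN'.
  by rewrite ltnW // ltn_ceil.
have hn : lnn (N %/ d) <= lnn N by have := lnn_ge0 R d; lra.
have t1 := T_ge R (N %/ d); have t2 := T_le R n0.
have s1 : (N %/ d)%:R * (lnn (N %/ d).+1 - lnn (N %/ d)) <= 1.
  by rewrite mulrC -ler_pdivlMr ?ltr0n // div1r; apply: lnn_step_le.
have s2 := lnn_step_le1 R n0; have l0 := lnn_ge0 R (N %/ d).
move: y1 y2 l1 hS hn t1 t2 s1 s2 l0; rewrite -[X in _ < X]natr1.
have : 1 <= (N %/ d)%:R :> R by rewrite ler1n.
set n : R := (N %/ d)%:R; set y := N%:R / d%:R; set l := lnn (N %/ d).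
set l' := lnn (N %/ d).+1; set ly := lnn N - lnn d; set t := T R _.
move=> n1 y1 y2 l1 hS hn t1 t2 s1 s2 l0; rewrite ler_norml; apply/andP; split.
  have : y * (ly - l) <= 2 by nra.
  have : (y - n) * l <= l by nra.
  by nra.
have : 0 <= y * (ly - l) by nra.
have : 0 <= (y - n) * l by nra.
by nra.
Qed.

(** Chebyshev's combination of floor functions; close to 1 when the coefficients are those of the
    Moebius function. *)
Definition Ecomb cs k : R := \sum_(t <- cs) t.2 * (k %/ t.1)%:R.

(** The condition on the sum of the coefficients over d cancels the term of order N ln N. *)
Lemma sum_Mangoldt_Ecomb cs N : all (fun t => 0 < t.1 <= N)%N cs ->
  \sum_(t <- cs) t.2 / t.1%:R = 0 ->
  `|\sum_(1 <= n < N.+1) Mangoldt n * Ecomb cs (N %/ n)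
    + N%:R * \sum_(t <- cs) t.2 / t.1%:R * lnn t.1| <=
  (\sum_(t <- cs) `|t.2|) * (lnn N + 2).
Proof.
move=> hcs c0.
have -> : \sum_(1 <= n < N.+1) Mangoldt n * Ecomb cs (N %/ n) =
    \sum_(t <- cs) t.2 * T R (N %/ t.1).
  under eq_bigr do rewrite /Ecomb mulr_sumr.
  rewrite exchange_big /=; apply: eq_bigr => t _.
  rewrite (@T_Mangoldt_wide R _ N (leq_div _ _)) mulr_sumr; apply: eq_bigr => n _.
  by rewrite mulrCA -!divnMA mulnC.
have -> : N%:R * \sum_(t <- cs) t.2 / t.1%:R * lnn t.1 =
    - \sum_(t <- cs) t.2 * (N%:R / t.1%:R * (lnn N - lnn t.1) - N%:R / t.1%:R).
  have -> : \sum_(t <- cs) t.2 * (N%:R / t.1%:R * (lnn N - lnn t.1) - N%:R / t.1%:R) =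
      N%:R * (lnn N - 1) * (\sum_(t <- cs) t.2 / t.1%:R) -
      N%:R * \sum_(t <- cs) t.2 / t.1%:R * lnn t.1.
    by rewrite !mulr_sumr -sumrB; apply: eq_bigr => t _; ring.
  by rewrite c0 mulr0 sub0r opprK.
rewrite -sumrB; apply: le_trans (ler_norm_sum _ _ _) _; rewrite mulr_suml big_seq [leRHS]big_seq.
apply: ler_sum => t /(allP hcs) tN; rewrite -mulrBr normrM.
by apply: ler_wpM2l => //; apply: T_div_approx.
Qed.

(** The same combination for the character: the floor function, which is the summatory function
    of 1, is replaced with the one of chi. *)
Definition Xcomb es k : R := \sum_(t <- es) t.2 * (chi_sum q (k %/ t.1))%:R.

(** There is no main term here, because the sums of chi n ln n are O(ln N). *)
Lemma sum_Mangoldt_Xcomb es N : (0 < N)%N ->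
  `|\sum_(1 <= n < N.+1) Mangoldt n * chi n * Xcomb es (N %/ n)| <=
  (\sum_(t <- es) `|t.2|) * lnn N.
Proof.
move=> N0.
have -> : \sum_(1 <= n < N.+1) Mangoldt n * chi n * Xcomb es (N %/ n) =
    \sum_(t <- es) t.2 * \sum_(1 <= n < (N %/ t.1).+1) chi n * lnn n.
  under eq_bigr do rewrite /Xcomb mulr_sumr.
  rewrite exchange_big /=; apply: eq_bigr => t _.
  have -> : \sum_(1 <= n < (N %/ t.1).+1) chi n * lnn n =
      \sum_(1 <= n < (N %/ t.1).+1) conv (fun d => chi d * Mangoldt d) chi n.
    by apply: eq_big_nat => n /andP[n0 _]; rewrite chi_log_deriv.
  rewrite sum_conv mulr_sumr.
  rewrite (@big_cat_nat _ _ _ (N %/ t.1).+1 1 N.+1) ?ltnS ?leq_div //=.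
  rewrite [X in _ + X]big1_seq ?addr0; last first.
    move=> n; rewrite mem_index_iota => /and3P[_ n1 _].
    by rewrite -divnMA mulnC divnMA divn_small // /chi_sum mod0n /= !mulr0.
  by apply: eq_bigr => n _; rewrite chi_sumE // -!divnMA mulnC; ring.
apply: le_trans (ler_norm_sum _ _ _) _; rewrite mulr_suml.
apply: ler_sum => t _; rewrite normrM; apply: ler_wpM2l => //.
case: (posnP (N %/ t.1)) => [->|n0]; first by rewrite big_geq // normr0 lnn_ge0.
apply: le_trans (sum_chi_lnn R q34 n0) _; apply: ler_lnn => //; exact: leq_div.
Qed.

Definition stepf vs k : R := \sum_(t <- vs) t.2 * (t.1 <= k)%N%:R.

Lemma sum_Mangoldt_stepf vs N : all (fun t => 0 < t.1)%N vs ->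
  \sum_(1 <= n < N.+1) Mangoldt n * stepf vs (N %/ n) = \sum_(t <- vs) t.2 * psi (N %/ t.1).
Proof.
move=> hvs; under eq_bigr do rewrite /stepf mulr_sumr.
rewrite exchange_big /= big_seq [RHS]big_seq; apply: eq_bigr => t /(allP hvs) t0.
rewrite (@psi_wide R _ N (leq_div _ _)) mulr_sumr; apply: eq_big_nat => n /andP[n0 _].
by rewrite mulrCA leq_divRL // leq_divRL // mulnC.
Qed.

Lemma sum_psi_step_le vs N a b : all (fun t => 0 < t.1)%N vs -> all (fun t => 0 <= t.2) vs ->
  0 <= b -> (forall n, (n <= N)%N -> psi n <= a * n%:R + b) -> 0 <= a ->
  \sum_(t <- vs) t.2 * psi (N %/ t.1) <=
  a * (\sum_(t <- vs) t.2 / t.1%:R) * N%:R + (\sum_(t <- vs) t.2) * b.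
Proof.
move=> h1 h2 b0 hpsi a0; rewrite mulr_sumr !mulr_suml -big_split /= big_seq [leRHS]big_seq.
apply: ler_sum => t ht; have t0 := allP h1 _ ht; have v0 := allP h2 _ ht.
apply: (@le_trans _ _ (t.2 * (a * (N%:R / t.1%:R) + b))).
  apply: ler_wpM2l => //; apply: le_trans (hpsi _ (leq_div _ _)) _; rewrite lerD2r.
  by apply: ler_wpM2l => //; apply: natdiv_le.
by rewrite le_eqVlt; apply/orP; left; apply/eqP; ring.
Qed.

Definition psi_chi N : R := \sum_(1 <= n < N.+1) Mangoldt n * (1 + chi n).

(** The defects of the two combinations are multiplied by 1 and by chi n, so their sizes add up;
    a step function that dominates their sum turns the error into values of psi at N / t. *)
Lemma psi_chi_upper cs es vs N :
  (forall k, (0 < k)%N -> 1 - Ecomb cs k + `|1 - Xcomb es k| <= stepf vs k) ->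
  all (fun t => 0 < t.1)%N vs ->
  psi N <= \sum_(1 <= n < N.+1) Mangoldt n * Ecomb cs (N %/ n) + \sum_(t <- vs) t.2 * psi (N %/ t.1) /\
  psi_chi N <= \sum_(1 <= n < N.+1) Mangoldt n * Ecomb cs (N %/ n) +
    \sum_(1 <= n < N.+1) Mangoldt n * chi n * Xcomb es (N %/ n) + \sum_(t <- vs) t.2 * psi (N %/ t.1).
Proof.
move=> hE hvs; rewrite -(sum_Mangoldt_stepf N hvs) -!big_split; split.
  apply: ler_sum_nat => n /andP[n0 nN]; have k0 : (0 < N %/ n)%N by rewrite divn_gt0.
  have := hE _ k0; have := normr_ge0 (1 - Xcomb es (N %/ n)) => h1 h2.
  rewrite /= -mulrDr -{1}[Mangoldt n]mulr1; apply: ler_wpM2l; first exact: Mangoldt_ge0.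
  by move: h1 h2; set z := `|_|; lra.
apply: ler_sum_nat => n /andP[n0 nN]; have k0 : (0 < N %/ n)%N by rewrite divn_gt0.
have h1 := hE _ k0; rewrite /= -mulrA -!mulrDr; apply: ler_wpM2l; first exact: Mangoldt_ge0.
have : chi n * (1 - Xcomb es (N %/ n)) <= `|1 - Xcomb es (N %/ n)|.
  apply: le_trans (ler_norm _) _; rewrite normrM; apply: ler_piMl => //; exact: normr_chi.
by move: h1; set z := `|_|; rewrite mulrBr mulr1; lra.
Qed.

Lemma psi_chi_lower cs es vs N :
  (forall k, (0 < k)%N -> Ecomb cs k - 1 + `|1 - Xcomb es k| <= stepf vs k) ->
  all (fun t => 0 < t.1)%N vs ->
  \sum_(1 <= n < N.+1) Mangoldt n * Ecomb cs (N %/ n) +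
    \sum_(1 <= n < N.+1) Mangoldt n * chi n * Xcomb es (N %/ n) - \sum_(t <- vs) t.2 * psi (N %/ t.1)
  <= psi_chi N.
Proof.
move=> hE hvs; rewrite lerBlDr -(sum_Mangoldt_stepf N hvs) -!big_split.
apply: ler_sum_nat => n /andP[n0 nN]; have k0 : (0 < N %/ n)%N by rewrite divn_gt0.
have h1 := hE _ k0; rewrite /= -mulrA -!mulrDr; apply: ler_wpM2l; first exact: Mangoldt_ge0.
have : chi n * (Xcomb es (N %/ n) - 1) <= `|1 - Xcomb es (N %/ n)|.
  rewrite distrC; apply: le_trans (ler_norm _) _; rewrite normrM; apply: ler_piMl => //; exact: normr_chi.
by move: h1; set z := `|_|; rewrite mulrBr mulr1; lra.
Qed.
End Chebyshev.

(** * Exact integer arithmetic and periodic counters *)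

Section Eval.
Variable R : realType.

(** Inequalities between explicit rational numbers are scaled and rounded to integers, decided
    there, and then read back in the real numbers. *)
Definition evZ (z : Z) : R := (int_of_Z z)%:~R.

Lemma evZD x y : evZ (x + y)%BZ = evZ x + evZ y.
Proof. by rewrite /evZ -[Z.add x y]/(x + y) !rmorphD. Qed.

Lemma evZM x y : evZ (x * y)%BZ = evZ x * evZ y.
Proof. by rewrite /evZ -[Z.mul x y]/(x * y) !rmorphM. Qed.

Lemma evZN x : evZ (- x)%BZ = - evZ x.
Proof. by rewrite /evZ -[Z.opp x]/(- x) !rmorphN. Qed.

Lemma evZB x y : evZ (x - y)%BZ = evZ x - evZ y.
Proof. by rewrite -Z.add_opp_r evZD evZN. Qed.

Lemma evZ_nat n : evZ (Z.of_nat n) = n%:R.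
Proof. by rewrite /evZ (_ : int_of_Z _ = n%:Z) ?pmulrn //; lia. Qed.

Lemma ler_evZ x y : (x <= y)%BZ -> evZ x <= evZ y.
Proof. by move=> xy; rewrite /evZ ler_int; lia. Qed.

Lemma evZ_div x d : (0 < d)%N ->
  evZ (x / Z.of_nat d)%BZ <= evZ x / d%:R <= evZ (x / Z.of_nat d + 1)%BZ.
Proof.
move=> d0; have dp : 0 < d%:R :> R by rewrite ltr0n.
have hd : (0 < Z.of_nat d)%BZ by lia.
have h1 := Z.div_mod x (Z.of_nat d) (not_eq_sym (Z.lt_neq _ _ hd)).
have h2 := Z.mod_pos_bound x _ hd.
rewrite ler_pdivlMr // ler_pdivrMr // -evZ_nat -!evZM.
by move: h1 h2 hd; set y := (x / _)%BZ; set z := Z.modulo _ _ => h1 h2 hd;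
  apply/andP; split; apply: ler_evZ; nia.
Qed.
End Eval.

(** The d <= 170 with mu d = 1, and in [muN] those with mu d = -1. *)
Definition muP : seq nat :=
    [:: 1; 6; 10; 14; 15; 21; 22; 26; 33; 34; 35; 38; 39; 46; 51; 55; 57; 58; 62;
    65; 69; 74; 77; 82; 85; 86; 87; 91; 93; 94; 95; 106; 111; 115; 118; 119; 122;
    123; 129; 133; 134; 141; 142; 143; 145; 146; 155; 158; 159; 161; 166]%N.
Definition muN : seq nat :=
    [:: 2; 3; 5; 7; 11; 13; 17; 19; 23; 29; 30; 31; 37; 41; 42; 43; 47; 53; 59;
    61; 66; 67; 70; 71; 73; 78; 79; 83; 89; 97; 101; 102; 103; 105; 107; 109; 110;
    113; 114; 127; 130; 131; 137; 138; 139; 149; 151; 154; 157; 163; 165; 167;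
    170]%N.

(** A counter (p, c) fires after c further steps and then every p + 1 steps. Counters replace
    divisions: following floor (k / d) as k grows needs only unary decrements. *)
Definition cstep (t : nat * nat) : nat * nat := (t.1, if t.2 is c.+1 then c else t.1).

Fixpoint hits (t : nat * nat) (k : nat) : nat :=
  if k is k'.+1 then ((t.2 == 0%N) + hits (cstep t) k')%N else 0%N.

Lemma hitsE p c k : (c <= p)%N -> hits (p, c) k = ((k + p - c) %/ p.+1)%N.
Proof.
elim: k c => [|k IH] c cp /=; first by rewrite add0n divn_small // ltnS leq_subr.
case: c cp => [_|c cp].
  rewrite -[cstep _]/(p, p) IH // addnK subn0 addSnnS addnC.
  by have := @divnMDl 1 k p.+1 isT; rewrite mul1n addnC => ->; rewrite addnC.
rewrite -[cstep _]/(p, c) IH; last exact: ltnW.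
by rewrite -[RHS]add0n addSn subSS.
Qed.

(** One step of all counters of a list; h counts those that fire. The continuation avoids
    building pairs. *)
Fixpoint tick (l acc : seq (nat * nat)) (h : Z) (cont : seq (nat * nat) -> Z -> bool) : bool :=
  match l with
  | [::] => cont acc h
  | (p, c) :: l' => match c with
                    | 0%N => tick l' ((p, p) :: acc) (Z.succ h) cont
                    | c'.+1 => tick l' ((p, c') :: acc) h cont
                    end
  end.

Definition Hits (l : seq (nat * nat)) (k : nat) : nat := \sum_(t <- l) hits t k.

Lemma tickE l acc h cont : exists l',
  tick l acc h cont = cont l' (h + Z.of_nat (\sum_(t <- l) (t.2 == 0%N)))%BZ /\
  (forall k, Hits l' k = Hits [seq cstep t | t <- l] k + Hits acc k)%N.
Proof.
elim: l acc h => [|[p [|c]] l IH] acc h /=.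
- by exists acc; rewrite big_nil Z.add_0_r /Hits; split=> // k; rewrite big_nil.
- have [l' [-> hl']] := IH ((p, p) :: acc) (Z.succ h); exists l'; split.
    by rewrite big_cons /=; congr (cont _ _); lia.
  by move=> k; rewrite hl' /Hits !big_cons /cstep /=; lia.
- have [l' [-> hl']] := IH ((p, c) :: acc) h; exists l'; split.
    by rewrite big_cons /=; congr (cont _ _); lia.
  by move=> k; rewrite hl' /Hits !big_cons /cstep /=; lia.
Qed.

Lemma HitsS l k : Hits l k.+1 = (\sum_(t <- l) (t.2 == 0) + Hits [seq cstep t | t <- l] k)%N.
Proof. by rewrite /Hits big_map -big_split. Qed.

Section Run.
Variable cond : Z -> Z -> Z -> Z -> bool.

(** The lists a1 and a2 feed a difference of numbers of hits, b1 and b2 another one, and c1 a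
    third number; cond tests the three values at every time. *)
Fixpoint run (n : nat) (a1 a2 b1 b2 c1 : seq (nat * nat)) (a b c k : Z) : bool :=
  if n is n'.+1 then
    tick a1 [::] a (fun a1' a' => tick a2 [::] 0%BZ (fun a2' ha =>
    tick b1 [::] b (fun b1' b' => tick b2 [::] 0%BZ (fun b2' hb =>
    tick c1 [::] c (fun c1' c' =>
      let a'' := (a' - ha)%BZ in let b'' := (b' - hb)%BZ in let k' := Z.succ k in
      if cond a'' b'' c' k' then run n' a1' a2' b1' b2' c1' a'' b'' c' k' else false)))))
  else true.

Lemma runP n a1 a2 b1 b2 c1 a b c k : run n a1 a2 b1 b2 c1 a b c k ->
  forall j, (0 < j <= n)%N ->
  cond (a + Z.of_nat (Hits a1 j) - Z.of_nat (Hits a2 j))%BZ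
       (b + Z.of_nat (Hits b1 j) - Z.of_nat (Hits b2 j))%BZ
       (c + Z.of_nat (Hits c1 j))%BZ (k + Z.of_nat j)%BZ.
Proof.
elim: n a1 a2 b1 b2 c1 a b c k => [|n IH] a1 a2 b1 b2 c1 a b c k /=; first by move=> _ [|j].
set f1 := (fun _ _ => _); have [a1' [-> ha1]] := tickE a1 [::] a f1; rewrite {}/f1.
set f1 := (fun _ _ => _); have [a2' [-> ha2]] := tickE a2 [::] 0%BZ f1; rewrite {}/f1.
set f1 := (fun _ _ => _); have [b1' [-> hb1]] := tickE b1 [::] b f1; rewrite {}/f1.
set f1 := (fun _ _ => _); have [b2' [-> hb2]] := tickE b2 [::] 0%BZ f1; rewrite {}/f1.
set f1 := (fun _ _ => _); have [c1' [-> hc1]] := tickE c1 [::] c f1; rewrite {}/f1.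
case: ifP => // hcond hrun [//|j] /=; rewrite ltnS => jn.
have nil0 i : Hits [::] i = 0%N by rewrite /Hits big_nil.
have H0 l : Hits l 0 = 0%N by rewrite /Hits big1.
rewrite !(HitsS _ j); case: j jn => [|j] jn.
  by rewrite !H0 !addn0; apply: etrans hcond; congr cond; lia.
have := IH _ _ _ _ _ _ _ _ _ hrun j.+1 jn.
rewrite ha1 ha2 hb1 hb2 hc1 !nil0 !addn0 /is_true => h.
by apply: etrans h; congr cond; lia.
Qed.
End Run.

(** * The coefficients and the computed part of the comparison *)

(** The d <= 170 with mu d chi d = 1, and in [eN] those with mu d chi d = -1. *)
Definition eP q : seq nat := [seq d <- muP | split q d] ++ [seq d <- muN | inert q d].
Definition eN q : seq nat := [seq d <- muP | inert q d] ++ [seq d <- muN | split q d].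

Definition floor_ctr (d : nat) : nat * nat := (d.-1, d.-1).
(** The partial sum of chi up to k / d increases at the multiples of d whose quotient is 1 mod q,
    and in [inert_ctr] it decreases at those whose quotient is -1 mod q. *)
Definition split_ctr q (d : nat) : nat * nat := ((q * d).-1, d.-1).
Definition inert_ctr q (d : nat) : nat * nat := ((q * d).-1, (q.-1 * d).-1).

Definition ctrP := [seq floor_ctr d | d <- muP].
Definition ctrN := [seq floor_ctr d | d <- muN].
Definition ctrXP q := [seq split_ctr q d | d <- eP q] ++ [seq inert_ctr q d | d <- eN q].
Definition ctrXN q := [seq inert_ctr q d | d <- eP q] ++ [seq split_ctr q d | d <- eN q].

(** Jumps of the step function, in hundredths, found by a search that keeps the sum of jump over
    position small. *)
Definition steps4 : seq (nat * nat) :=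
  [:: (173, 184); (174, 100); (193, 200); (197, 100); (255, 100); (258, 100);
      (283, 100); (286, 100); (1583, 162); (1610, 500)]%N.
Definition steps3 : seq (nat * nat) :=
  [:: (171, 19); (178, 200); (215, 200); (218, 200); (219, 100); (221, 200);
      (1273, 4); (1648, 335); (4635, 12); (11342, 77)]%N.

Definition stepZ (s : seq (nat * nat)) : seq (Z * Z) :=
  [seq (Z.of_nat t.1, Z.of_nat t.2) | t <- s].
Definition stepZ_at (s : seq (Z * Z)) (k : Z) : Z :=
  foldr (fun t a => if Z.leb t.1 k then Z.add t.2 a else a) 0%BZ s.

(** The last coefficient [c171] is within 1/4900 of -17/98, and the term 2 c pays for this
    approximation; everything is multiplied by 9800. *)
Definition condZ (lower : bool) (s : seq (Z * Z)) (a b c k : Z) : bool :=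
  let e := (98 * (a - 1) - 17 * c)%BZ in
  Z.leb (100 * ((if lower then e else - e) + 98 * Z.abs (1 - b)) + 2 * c)%BZ (98 * stepZ_at s k)%BZ.

(** A product keeps the unary numeral folded. *)
Definition Ymax : nat := (120 * 100)%N.

Definition run_check (lower : bool) q (s : seq (nat * nat)) : bool :=
  let sz := stepZ s in
  run (condZ lower sz) Ymax ctrP ctrN (ctrXP q) (ctrXN q) [:: floor_ctr 171] 0%BZ 0%BZ 0%BZ 0%BZ.

Lemma run_check4 : run_check true 4 steps4.
Proof. by vm_compute. Qed.

Lemma run_check3 : run_check false 3 steps3.
Proof. by vm_compute. Qed.

Lemma mu_gt0 d : d \in muP ++ muN -> (0 < d < 171)%N.
Proof. by move: d; apply/allP; vm_compute. Qed.

Lemma muP_gt0 d : d \in muP -> (0 < d < 171)%N.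
Proof. by move=> h; apply: mu_gt0; rewrite mem_cat h. Qed.

Lemma muN_gt0 d : d \in muN -> (0 < d < 171)%N.
Proof. by move=> h; apply: mu_gt0; rewrite mem_cat h orbT. Qed.

Lemma mem_filter_cat (a b : pred nat) (s t : seq nat) d :
  d \in [seq i <- s | a i] ++ [seq i <- t | b i] -> d \in s ++ t.
Proof. by rewrite !mem_cat !mem_filter => /orP[/andP[_ ->]|/andP[_ ->]]; rewrite ?orbT. Qed.

Lemma eP_gt0 q d : d \in eP q -> (0 < d < 171)%N.
Proof. rewrite /eP => h; have h2 := mem_filter_cat h; apply: mu_gt0; exact h2. Qed.

Lemma eN_gt0 q d : d \in eN q -> (0 < d < 171)%N.
Proof. rewrite /eN => h; have h2 := mem_filter_cat h; apply: mu_gt0; exact h2. Qed.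

Lemma hits_floor d k : (0 < d)%N -> hits (floor_ctr d) k = (k %/ d)%N.
Proof. by case: d => // d _; rewrite hitsE // addnK. Qed.

(** Both counters start so that their first hits are at d and (q - 1) d. *)
Lemma hits_split_inert q d k : q = 3%N \/ q = 4%N -> (0 < d)%N ->
  hits (split_ctr q d) k = (chi_sum q (k %/ d) + hits (inert_ctr q d) k)%N.
Proof.
move=> q34 d0; have q0 : (2 < q)%N by case: q34 => ->.
have qd : ((q * d).-1.+1 = d * q)%N by rewrite prednK 1?mulnC // muln_gt0 d0; lia.
rewrite !hitsE; [|by case: q34 => ->; lia|by case: q34 => ->; lia].
have shift a m : (m = k + a * d)%N -> (m %/ (d * q) = (k %/ d + a) %/ q)%N.
  by move=> ->; rewrite divnMA divnDMl.
rewrite qd (shift q.-1); last by case: q34 => ->; lia.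
rewrite (shift 1%N); last by case: q34 => ->; lia.
by rewrite /chi_sum; case: q34 => ->; lia.
Qed.

Section RealLists.
Variable R : realType.
Local Notation lnn := (@lnn R).
Local Notation evZ := (@evZ R).

(** The coefficient at 171 that makes the sum of c_d / d vanish. *)
Definition c171 : R := - 171 * (\sum_(d <- muP) d%:R^-1 - \sum_(d <- muN) d%:R^-1).
Definition cs : seq (nat * R) :=
  [seq (d, 1) | d <- muP] ++ [seq (d, - 1) | d <- muN] ++ [:: (171%N, c171)].
Definition es q : seq (nat * R) := [seq (d, 1) | d <- eP q] ++ [seq (d, - 1) | d <- eN q].

Lemma sum_signed (P N : seq nat) (F : nat -> R) :
  \sum_(t <- [seq (d, 1 : R) | d <- P] ++ [seq (d, - 1) | d <- N]) t.2 * F t.1 =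
  \sum_(d <- P) F d - \sum_(d <- N) F d.
Proof.
rewrite big_cat !big_map /=; congr (_ + _); first by apply: eq_bigr => d _; rewrite mul1r.
by rewrite -sumrN; apply: eq_bigr => d _; rewrite mulN1r.
Qed.

Lemma sum_cs (F : nat -> R) : \sum_(t <- cs) t.2 * F t.1 =
  \sum_(d <- muP) F d - \sum_(d <- muN) F d + c171 * F 171%N.
Proof. by rewrite /cs catA big_cat big_seq1 sum_signed. Qed.

Lemma sum_es q (F : nat -> R) : \sum_(t <- es q) t.2 * F t.1 =
  \sum_(d <- eP q) F d - \sum_(d <- eN q) F d.
Proof. exact: sum_signed. Qed.

Lemma sum_cs_inv : \sum_(t <- cs) t.2 / t.1%:R = 0.
Proof. by rewrite (sum_cs (fun d => d%:R^-1)) /c171; field. Qed.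

Lemma Ecomb_cs k : Ecomb cs k =
  (Hits ctrP k)%:R - (Hits ctrN k)%:R + c171 * (k %/ 171)%:R.
Proof.
rewrite /Ecomb (sum_cs (fun d => (k %/ d)%:R)) /Hits !big_map !natr_sum.
congr (_ - _ + _); apply: eq_big_seq => d hd.
  by have /andP[d0 _] := muP_gt0 hd; rewrite hits_floor.
by have /andP[d0 _] := muN_gt0 hd; rewrite hits_floor.
Qed.

Lemma sum_chi_hits q (P N : seq nat) k : q = 3%N \/ q = 4%N ->
  {in P ++ N, forall d, 0 < d}%N ->
  \sum_(d <- P) (chi_sum q (k %/ d))%:R - \sum_(d <- N) (chi_sum q (k %/ d))%:R =
  (Hits ([seq split_ctr q d | d <- P] ++ [seq inert_ctr q d | d <- N]) k)%:R -
  (Hits ([seq inert_ctr q d | d <- P] ++ [seq split_ctr q d | d <- N]) k)%:R :> R.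
Proof.
move=> q34 hd; rewrite /Hits !big_cat !big_map !natrD !natr_sum.
have e (s : seq nat) : {subset s <= P ++ N} -> \sum_(d <- s) (hits (split_ctr q d) k)%:R =
    \sum_(d <- s) (chi_sum q (k %/ d))%:R + \sum_(d <- s) (hits (inert_ctr q d) k)%:R :> R.
  move=> sub; rewrite -big_split; apply: eq_big_seq => d /sub /hd d0.
  by rewrite hits_split_inert // natrD.
rewrite !e; first ring; by move=> d hd'; rewrite mem_cat hd' ?orbT.
Qed.

Lemma Xcomb_es q k : q = 3%N \/ q = 4%N ->
  Xcomb q (es q) k = (Hits (ctrXP q) k)%:R - (Hits (ctrXN q) k)%:R.
Proof.
move=> q34; rewrite /Xcomb (sum_es q (fun d => (chi_sum q (k %/ d))%:R)).
apply: sum_chi_hits => // d; rewrite mem_cat => /orP[h|h].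
  by have /andP[] := eP_gt0 h.
by have /andP[] := eN_gt0 h.
Qed.
End RealLists.

(** * The trapezoidal rule for logarithms and the last coefficient *)

Section SharpLog.
Variable R : realType.
Local Notation lnn := (@lnn R).
Implicit Types n a b : nat.

(** Iterating the first inequality, F n is at least a sum of 2^j values of F at arguments of size
    2^j n, each of which is at least of order -(2^j n)^(-2); so F n >= - 2^(-j) n^(-2) for all j. *)
Lemma doubling_ge0 (F : nat -> R) :
  (forall n, (0 < n)%N -> F n.*2 + F n.*2.+1 <= F n) ->
  (forall n, (0 < n)%N -> - (n%:R ^+ 2)^-1 <= F n) ->
  forall n, (0 < n)%N -> 0 <= F n.
Proof.
move=> hF hb n n0; rewrite leNgt; apply/negP => Fn.
have h j : forall m, (0 < m)%N -> - (2^-1) ^+ j * (m%:R ^+ 2)^-1 <= F m.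
  elim: j => [|j IH] m m0; first by rewrite expr0 mulN1r; apply: hb.
  apply: le_trans (hF m m0); have := IH m.*2; have := IH m.*2.+1.
  rewrite double_gt0 m0 => /(_ isT) h1 /(_ isT) h2.
  apply: le_trans (lerD h2 h1); rewrite exprS.
  have mp : 0 < m%:R :> R by rewrite ltr0n.
  have e2 : m.*2%:R = 2 * m%:R :> R by rewrite -mul2n natrM.
  have p0 : 0 <= (2^-1) ^+ j :> R by rewrite exprn_ge0 ?invr_ge0.
  have i1 : (m.*2.+1%:R ^+ 2)^-1 <= (4 * m%:R ^+ 2)^-1 :> R.
    rewrite lef_pV2 ?posrE ?exprn_gt0 ?mulr_gt0 ?exprn_gt0 // -(natr1 m.*2) e2; nra.
  have -> : (m.*2%:R ^+ 2)^-1 = (4 * m%:R ^+ 2)^-1 :> R by rewrite e2; congr (_^-1); ring.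
  have i2 : (4 * m%:R ^+ 2)^-1 = 4^-1 * (m%:R ^+ 2)^-1 :> R by rewrite invfM.
  rewrite i2 in i1 *; move: i1 p0; set x := (m%:R ^+ 2)^-1; set y := (_ ^+ 2)^-1.
  set p := _ ^+ j => i1 p0; nra.
pose j := (Num.truncn (- (F n))^-1).+1.
have hj : (- F n)^-1 < j%:R by apply: truncnS_gt.
have j0 : 0 < j%:R :> R by rewrite ltr0n.
have hn := h j n n0.
have n1 : (n%:R ^+ 2)^-1 <= 1 :> R.
  by rewrite invf_le1 ?exprn_gt0 ?ltr0n // exprn_ege1 // ler1n.
have p1 : (2^-1) ^+ j <= j%:R^-1 :> R.
  rewrite exprVn lef_pV2 ?posrE ?exprn_gt0 // -natrX ler_nat ltnW // ltn_expl //.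
have : j%:R^-1 < - F n by rewrite -[ltRHS]invrK ltf_pV2 ?posrE ?invr_gt0 ?oppr_gt0.
have x0 : 0 <= (n%:R ^+ 2)^-1 :> R by rewrite invr_ge0 exprn_ge0.
have p0 : 0 <= (2^-1) ^+ j :> R by rewrite exprn_ge0 ?invr_ge0.
move: hn n1 p1 x0 p0; set x := (n%:R ^+ 2)^-1; set p := _ ^+ j; set z := j%:R^-1; nra.
Qed.

Definition trapezoid n : R := (n%:R^-1 + n.+1%:R^-1) / 2.

Lemma lnn_double_step n : (0 < n)%N ->
  lnn n.+1 - lnn n = (lnn n.*2.+1 - lnn n.*2) + (lnn n.*2.+2 - lnn n.*2.+1).
Proof.
move=> n0; rewrite -doubleS -!mul2n !lnnM //; ring.
Qed.

Lemma natr_double n : [/\ n.+1%:R = n%:R + 1 :> R, n.*2%:R = 2 * n%:R :> R,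
  n.*2.+1%:R = 2 * n%:R + 1 :> R & n.*2.+2%:R = 2 * n%:R + 1 + 1 :> R].
Proof.
have e : n.*2%:R = 2 * n%:R :> R by rewrite -mul2n natrM.
by split; rewrite // -natr1 // ?e // -natr1 e.
Qed.

(** The trapezoidal rule for 1 / x on [n, n + 1]. Both inequalities follow from the doubling
    argument: ln ((n + 1) / n) is the sum of its values at 2n and 2n + 1, so only rational
    functions have to be compared. *)
Lemma lnn_step_trap n : (0 < n)%N ->
  0 <= trapezoid n - (lnn n.+1 - lnn n) <= (n%:R ^- 2 - n.+1%:R ^- 2) / 8.
Proof.
move=> n0; apply/andP; split.
  move: n n0; apply: (@doubling_ge0 (fun n => trapezoid n - (lnn n.+1 - lnn n))) => n n0.
    rewrite (lnn_double_step n0); have : trapezoid n.*2 + trapezoid n.*2.+1 <= trapezoid n; last by lra.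
    have [e1 e2 e3 e4] := natr_double n; rewrite /trapezoid e4 e3 e2 e1; have : 1 <= n%:R :> R by rewrite ler1n.
    set x := n%:R => x1; rewrite -subr_ge0.
    have -> : (x^-1 + (x + 1)^-1) / 2 - (((2 * x)^-1 + (2 * x + 1)^-1) / 2 +
        ((2 * x + 1)^-1 + (2 * x + 1 + 1)^-1) / 2) = (4 * x * (x + 1) * (2 * x + 1))^-1.
      by field; repeat (apply/andP; split); lra.
    by rewrite invr_ge0 !mulr_ge0 //; lra.
  have hst := lnn_step_le R n0; have [e1 _ _ _] := natr_double n; rewrite /trapezoid e1; have : 1 <= n%:R :> R by rewrite ler1n.
  move: hst; set x := n%:R => h x1.
  have : (x^-1 + (x + 1)^-1) / 2 - x^-1 + (x ^+ 2)^-1 >= 0.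
    have -> : (x^-1 + (x + 1)^-1) / 2 - x^-1 + (x ^+ 2)^-1 = (x + 2) / (2 * x ^+ 2 * (x + 1)).
      by field; repeat (apply/andP; split); lra.
    by rewrite divr_ge0 ?mulr_ge0 ?exprn_ge0 //; lra.
  by lra.
rewrite -subr_ge0; move: n n0.
apply: (@doubling_ge0 (fun n => (n%:R ^- 2 - n.+1%:R ^- 2) / 8 - (trapezoid n - (lnn n.+1 - lnn n)))) => n n0.
  rewrite (lnn_double_step n0).
  have gen (a b c p1 p2 p3 d1 d2 : R) : a - p1 + (b - p2) <= c - p3 ->
    a - (p1 - d1) + (b - (p2 - d2)) <= c - (p3 - (d1 + d2)) by lra.
  apply: gen.
  have [e1 e2 e3 e4] := natr_double n; rewrite /trapezoid e4 e3 e2 e1; have : 1 <= n%:R :> R by rewrite ler1n.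
  set x := n%:R => x1; rewrite -subr_ge0.
  set E := (X in 0 <= X).
  have -> : E = (4 * x * (x + 1) + 3) / (32 * x ^+ 2 * (x + 1) ^+ 2 * (2 * x + 1)).
    by rewrite /E; field; repeat (apply/andP; split); lra.
  by rewrite divr_ge0 ?mulr_ge0 ?exprn_ge0 ?addr_ge0 ?mulr_ge0 //; lra.
have hst := lnn_step_ge R n0; rewrite -natr1 in hst; have [e1 _ _ _] := natr_double n; rewrite /trapezoid e1; have : 1 <= n%:R :> R by rewrite ler1n.
move: hst; set x := n%:R => h x1.
have h1 : (x + 1) ^- 2 <= x ^- 2.
  by rewrite lef_pV2 ?posrE ?exprn_gt0 //; [nra|lra|lra].
have h2 : x^-1 - (x + 1)^-1 <= x ^- 2.
  have -> : x^-1 - (x + 1)^-1 = (x * (x + 1))^-1 by field; apply/andP; split; lra.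
  by rewrite lef_pV2 ?posrE ?exprn_gt0 ?mulr_gt0 //; [nra|lra|lra|lra].
have h3 : 0 <= x ^- 2 by rewrite invr_ge0 exprn_ge0 //; lra.
by lra.
Qed.
End SharpLog.

Section Numerics.
Variable R : realType.
Local Notation lnn := (@lnn R).
Local Notation evZ := (@evZ R).
Local Notation c171 := (@c171 R).
Local Notation cs := (@cs R).
Local Notation es := (@es R).

Definition sumZ (T : Type) (s : seq T) (F : T -> Z) : Z := foldr (fun t a => Z.add (F t) a) 0%BZ s.

Lemma evZ_sumZ (T : Type) (s : seq T) (F : T -> Z) : evZ (sumZ s F) = \sum_(t <- s) evZ (F t).
Proof. by elim: s => [|t s IH]; rewrite ?big_nil // big_cons -IH -evZD. Qed.

(** A sum of fractions from integer quotients with numerators scaled by P. *)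
Lemma sumZ_ratio (s : seq (nat * nat)) (P : Z) : {in s, forall t, 0 < t.1}%N ->
  evZ (sumZ s (fun t => P * Z.of_nat t.2 / Z.of_nat t.1)%BZ) <=
  evZ P * \sum_(t <- s) t.2%:R / t.1%:R <=
  evZ (sumZ s (fun t => P * Z.of_nat t.2 / Z.of_nat t.1 + 1)%BZ).
Proof.
move=> hs; rewrite !evZ_sumZ mulr_sumr; apply/andP; split; rewrite big_seq [leRHS]big_seq;
  apply: ler_sum => t /hs t0; rewrite mulrA -(evZ_nat R t.2) -evZM;
  by have /andP[] := evZ_div R (P * Z.of_nat t.2)%BZ t0.
Qed.

Definition prec9 : Z := 1000000000%BZ.
Definition prec7 : Z := 10000000%BZ.

Definition ones (s : seq nat) : seq (nat * nat) := [seq (d, 1%N) | d <- s].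

Definition c171_lo : Z := (sumZ (ones muP) (fun t => prec9 * Z.of_nat t.2 / Z.of_nat t.1)
   - sumZ (ones muN) (fun t => prec9 * Z.of_nat t.2 / Z.of_nat t.1 + 1))%BZ.
Definition c171_hi : Z := (sumZ (ones muP) (fun t => prec9 * Z.of_nat t.2 / Z.of_nat t.1 + 1)
   - sumZ (ones muN) (fun t => prec9 * Z.of_nat t.2 / Z.of_nat t.1))%BZ.

(** The numbers are kept abstract here, so that the decision procedures never meet the closed
    integer terms. *)
Lemma c171_num (p L H : Z) (D : R) : (0 < p)%BZ ->
  evZ L <= evZ p * D -> evZ p * D <= evZ H ->
  (50 * (98 * 171 * H - 17 * p) <= p)%BZ -> (50 * (17 * p - 98 * 171 * L) <= p)%BZ ->
  `|17 - 98 * 171 * D| <= 1 / 50.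
Proof.
move=> p0 hL hH /(ler_evZ R) k1 /(ler_evZ R) k2.
have P0 : 0 < evZ p by rewrite /evZ ltr0z; lia.
have v n : evZ (Z.of_nat n) = n%:R by apply: evZ_nat.
have v50 := v 50%N; have v98 := v 98%N; have v171 := v 171%N; have v17 := v 17%N.
rewrite /= in v50 v98 v171 v17.
rewrite !(evZM, evZB) v50 v98 v171 v17 in k1 k2.
move: hL hH k1 k2 P0; set x := evZ p; set l := evZ L; set h := evZ H => hL hH k1 k2 P0.
rewrite ler_norml; apply/andP; split; rewrite -(ler_pM2r P0).
  have : x * D <= h by []. by lra.
by lra.
Qed.

Lemma evZ_sub_le (p a b : Z) (x y : R) : evZ a <= evZ p * x -> evZ p * y <= evZ b ->
  evZ (a - b)%BZ <= evZ p * (x - y).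
Proof. by move=> h1 h2; rewrite evZB mulrBr; apply: lerB. Qed.

Lemma evZ_sub_ge (p a b : Z) (x y : R) : evZ p * x <= evZ a -> evZ b <= evZ p * y ->
  evZ p * (x - y) <= evZ (a - b)%BZ.
Proof. by move=> h1 h2; rewrite evZB mulrBr; apply: lerB. Qed.

Lemma c171_bounds : `|98 * c171 + 17| <= 1 / 50.
Proof.
pose D : R := \sum_(d <- muP) d%:R^-1 - \sum_(d <- muN) d%:R^-1.
have hP : {in ones muP, forall t, 0 < t.1}%N.
  by apply/allP; vm_compute.
have hN : {in ones muN, forall t, 0 < t.1}%N.
  by apply/allP; vm_compute.
have e (s : seq nat) : \sum_(t <- ones s) t.2%:R / t.1%:R = \sum_(d <- s) d%:R^-1 :> R.
  by rewrite big_map; apply: eq_bigr => d _; rewrite mul1r.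
have /andP[p1 p2] := sumZ_ratio prec9 hP; have /andP[n1 n2] := sumZ_ratio prec9 hN.
rewrite !e in p1 p2 n1 n2.
have -> : 98 * c171 + 17 = 17 - 98 * 171 * D by rewrite /c171 -/D; ring.
apply: (@c171_num prec9 c171_lo c171_hi).
- by vm_compute.
- exact: (evZ_sub_le p1 n2).
- exact: (evZ_sub_ge p2 n1).
- by vm_compute.
- by vm_compute.
Qed.
End Numerics.

(** * The main term *)

Section LogNumerics.
Variable R : realType.
Local Notation lnn := (@lnn R).
Local Notation evZ := (@evZ R).
Local Notation cs := (@cs R).

(** The trapezoidal sum from a to b, with an error that depends only on a. *)
Lemma lnn_sub_trap a b : (0 < a <= b)%N ->
  - (8 * a%:R ^+ 2)^-1 <=
  lnn b - lnn a - (\sum_(a <= k < b) k%:R^-1 - (2 * a%:R)^-1 + (2 * b%:R)^-1) <= 0.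
Proof.
move=> /andP[a0 ab].
have e1 : lnn b - lnn a = \sum_(a <= k < b) (lnn k.+1 - lnn k) by rewrite telescope_sumr.
have tr : \sum_(a <= k < b) trapezoid R k = \sum_(a <= k < b) k%:R^-1 - (2 * a%:R)^-1 + (2 * b%:R)^-1.
  have -> : \sum_(a <= k < b) trapezoid R k =
      \sum_(a <= k < b) k%:R^-1 + \sum_(a <= k < b) (k.+1%:R^-1 / 2 - k%:R^-1 / 2).
    by rewrite -big_split; apply: eq_bigr => k _; rewrite /trapezoid /=; move: (k%:R^-1) (k.+1%:R^-1) => u v; field.
  by rewrite telescope_sumr // !(invfM 2); ring.
have up : lnn b - lnn a <= \sum_(a <= k < b) trapezoid R k.
  rewrite e1; apply: ler_sum_nat => k /andP[ak _].
  by have /andP[h _] := lnn_step_trap R (leq_trans a0 ak); lra.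
have low : \sum_(a <= k < b) trapezoid R k - (lnn b - lnn a) <= (8 * a%:R ^+ 2)^-1.
  rewrite e1 -sumrB; apply: (@le_trans _ _ (\sum_(a <= k < b) (k%:R ^- 2 - k.+1%:R ^- 2) / 8)).
    by apply: ler_sum_nat => k /andP[ak _]; have /andP[] := lnn_step_trap R (leq_trans a0 ak).
  rewrite -mulr_suml; under eq_bigr do rewrite -opprB.
  rewrite sumrN telescope_sumr // opprB (invfM 8) mulrC ler_pM2l ?invr_gt0 //.
  by have : 0 <= b%:R ^- 2 :> R; [rewrite invr_ge0 exprn_ge0|lra].
by rewrite -tr; move: up low; set x := (8 * _)^-1; lra.
Qed.

Fixpoint harmZ (P : Z) (n : nat) (k acc : Z) : Z :=
  if n is n'.+1 then harmZ P n' (Z.succ k) (acc + P / k)%BZ else acc.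

Lemma harmZ_sum P n a acc : (0 < a)%N ->
  evZ (harmZ P n (Z.of_nat a) acc) <= evZ acc + evZ P * \sum_(a <= k < a + n) k%:R^-1
  <= evZ (harmZ P n (Z.of_nat a) acc) + n%:R.
Proof.
move=> a0; elim: n a a0 acc => [|n IH] a a0 acc /=.
  by rewrite addn0 big_geq // mulr0 !addr0 lexx.
rewrite (_ : Z.succ _ = Z.of_nat a.+1); last by lia.
have /andP[d1 d2] := evZ_div R P a0; rewrite evZD in d2.
have /andP[h1 h2] := IH a.+1 isT (acc + P / Z.of_nat a)%BZ; rewrite evZD in h1 h2.
rewrite big_ltn ?addnS ?ltnS ?leq_addr // -addSn mulrDr.
have e1 : evZ 1 = 1 by []. rewrite e1 in d2.
move: d1 d2 h1 h2; rewrite -(natr1 n); set x := evZ P / _; set y := evZ P * _.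
by set u := evZ (P / _)%BZ; set v := evZ (harmZ _ _ _ _); lra.
Qed.

(** Bounds for P (ln 171 - ln d). The interval is stretched by the factor m, so that it starts
    beyond 20 and the error of the trapezoidal rule is small. *)
Definition lnZ (P : Z) (d : nat) : Z * Z :=
  let m := (20 %/ d).+1 in
  let a := Z.of_nat (d * m) in
  let b := Z.of_nat (171 * m) in
  let h := (harmZ P ((171 - d) * m) a 0 - P / (2 * a) + P / (2 * b))%BZ in
  ((h - P / (8 * (a * a)) - 2)%BZ, (h + Z.of_nat ((171 - d) * m) + 1)%BZ).

Lemma evZ_lnZ P d : (0 < P)%BZ -> (0 < d < 171)%N ->
  evZ (lnZ P d).1 <= evZ P * (lnn 171 - lnn d) <= evZ (lnZ P d).2.
Proof.
move=> P0 /andP[d0 d171]; rewrite /lnZ; cbv zeta; move: (20 %/ d).+1 (ltn0Sn (20 %/ d)) => m m0.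
have ab : (0 < d * m <= 171 * m)%N by rewrite muln_gt0 d0 m0 leq_mul2r (ltnW d171) orbT.
have e : ((d * m) + (171 - d) * m = 171 * m)%N by rewrite -mulnDl subnKC // ltnW.
have el : lnn 171 - lnn d = lnn (171 * m) - lnn (d * m).
  by rewrite !lnnM //; ring.
rewrite el; have := lnn_sub_trap ab.
have := @harmZ_sum P ((171 - d) * m) (d * m) 0%BZ; rewrite e; move: ab.
set a := (d * m)%N; set b := (171 * m)%N; set c := ((171 - d) * m)%N.
move=> /andP[a0 ab] /(_ a0) /andP[h1 h2] /andP[t1 t2].
set S := \sum_(_ <= k < _) _ in h1 h2 t1 t2.
set H := harmZ _ _ _ _ in h1 h2 *.
rewrite [evZ 0]/= add0r in h1 h2.
have z2a : (2 * Z.of_nat a)%BZ = Z.of_nat (2 * a) by lia.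
have z2b : (2 * Z.of_nat b)%BZ = Z.of_nat (2 * b) by lia.
have z8 : (8 * (Z.of_nat a * Z.of_nat a))%BZ = Z.of_nat (8 * a ^ 2) by lia.
rewrite z2a z2b z8.
have /andP[u1 u2] := @evZ_div R P (2 * a) (leq_trans a0 (leq_pmull a (ltn0Sn 1))).
have b0 : (0 < b)%N := leq_trans a0 ab.
have /andP[v1 v2] := @evZ_div R P (2 * b) (leq_trans b0 (leq_pmull b (ltn0Sn 1))).
have a8 : (0 < 8 * a ^ 2)%N by rewrite muln_gt0 expn_gt0 a0.
have /andP[w1 w2] := @evZ_div R P (8 * a ^ 2) a8.
have E1 : evZ 1 = 1 by [].
have E2 : evZ 2 = 2 by [].
rewrite evZD E1 in u2; rewrite evZD E1 in v2; rewrite evZD E1 in w2.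
rewrite (natrM _ 2) in u1 u2; rewrite (natrM _ 2) in v1 v2.
rewrite (natrM _ 8) (natrX _ a 2) in w1 w2.
cbn [fst snd]; rewrite !(evZB, evZD) E1 E2 evZ_nat.
have Pp : 0 <= evZ P by have := ler_evZ R (Z.lt_le_incl _ _ P0).
have hS : evZ P * (lnn b - lnn a) <= evZ P * (S - (2 * a%:R)^-1 + (2 * b%:R)^-1).
  by apply: ler_wpM2l => //; lra.
have hS2 : evZ P * (S - (2 * a%:R)^-1 + (2 * b%:R)^-1 - (8 * a%:R ^+ 2)^-1) <= evZ P * (lnn b - lnn a).
  by apply: ler_wpM2l => //; lra.
move: h1 h2 u1 u2 v1 v2 w1 w2 hS hS2; rewrite !(mulrDr, mulrN).
move: (evZ P * S) (evZ P * (2 * a%:R)^-1) (evZ P * (2 * b%:R)^-1) (evZ P * (8 * _)^-1) => X1 X2 X3 X4.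
move: (evZ H) (evZ (P / Z.of_nat (2 * a))) (evZ (P / Z.of_nat (2 * b))) (evZ (P / Z.of_nat (8 * a ^ 2))).
move: (evZ P * lnn b) (evZ P * lnn a) => Y1 Y2 *; apply/andP; split; lra.
Qed.

Definition accZ P (s : seq nat) : Z * Z :=
  foldr (fun d acc => let l := lnZ P d in
     ((acc.1 + l.1 / Z.of_nat d)%BZ, (acc.2 + (l.2 / Z.of_nat d + 1))%BZ)) (0%BZ, 0%BZ) s.

Lemma evZ_accZ P s : (0 < P)%BZ -> {in s, forall d, 0 < d < 171}%N ->
  evZ (accZ P s).1 <= evZ P * \sum_(d <- s) (lnn 171 - lnn d) / d%:R <= evZ (accZ P s).2.
Proof.
move=> P0; elim: s => [|d s IH] hs; first by rewrite big_nil mulr0 lexx.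
have hd := hs d (mem_head _ _); have d0 : (0 < d)%N by case/andP: hd.
have /andP[l1 l2] := evZ_lnZ P0 hd.
have /andP[i1 i2] := IH (fun x hx => hs x (mem_behead (s := d :: s) hx)).
rewrite big_cons mulrDr [accZ _ _]/= evZD evZD mulrA.
have /andP[q1 _] := evZ_div R (lnZ P d).1 d0; have /andP[_ q2] := evZ_div R (lnZ P d).2 d0.
move: q1 q2 l1 l2; set x := evZ (_ / _)%BZ; set y := evZ (_ + 1)%BZ; set l := evZ P * (_ - _) => q1 q2 l1 l2.
have dp : 0 < d%:R^-1 :> R by rewrite invr_gt0 ltr0n.
have u1 : x <= l / d%:R by apply: le_trans q1 _; rewrite ler_pM2r.
have u2 : l / d%:R <= y by apply: le_trans q2; rewrite ler_pM2r.
by rewrite addrC lerD //= addrC lerD.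
Qed.

Definition main_term_check (P : Z) : bool :=
  let p := accZ P muP in let n := accZ P muN in
  Z.leb P (p.1 - n.2) && Z.leb (1000 * (p.2 - n.1)) (1002 * P).

Lemma main_term_checkP (P : Z) : main_term_check P ->
  (P <= (accZ P muP).1 - (accZ P muN).2)%BZ /\
  (1000 * ((accZ P muP).2 - (accZ P muN).1) <= 1002 * P)%BZ.
Proof.
rewrite /main_term_check; move: (accZ P muP) (accZ P muN) => p n; cbv zeta => /andP[h1 h2].
by split; apply/Z.leb_le.
Qed.

Lemma main_term_check7 : main_term_check prec7.
Proof. by vm_compute. Qed.

Lemma main_term_num (P p1 p2 n1 n2 : Z) (x y : R) : (0 < P)%BZ ->
  evZ p1 <= evZ P * x <= evZ p2 -> evZ n1 <= evZ P * y <= evZ n2 ->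
  (P <= p1 - n2)%BZ -> (1000 * (p2 - n1) <= 1002 * P)%BZ -> 1 <= x - y <= 1002 / 1000.
Proof.
move=> P0 /andP[a1 a2] /andP[b1 b2] /(ler_evZ R) k1 /(ler_evZ R) k2.
have Pp : 0 < evZ P by rewrite /evZ ltr0z; lia.
have v n : evZ (Z.of_nat n) = n%:R by apply: evZ_nat.
have v1 := v 1000%N; have v2 := v 1002%N.
rewrite [Z.of_nat _]/= in v1 v2.
rewrite !(evZM, evZB) v1 v2 in k1 k2.
rewrite -(ler_pM2l Pp) -(ler_pM2l Pp (x - y)) mulrBr.
move: a1 a2 b1 b2 k1 k2; set X := evZ P * x; set Y := evZ P * y; set e := evZ P.
by move=> *; apply/andP; split; lra.
Qed.

(** Since the coefficients c_d / d sum to 0, each ln d may be replaced with ln d - ln 171. *)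
Lemma main_term_bounds : 1 <= - \sum_(t <- cs) t.2 / t.1%:R * lnn t.1 <= 1002 / 1000.
Proof.
have -> : - \sum_(t <- cs) t.2 / t.1%:R * lnn t.1 =
  \sum_(d <- muP) (lnn 171 - lnn d) / d%:R - \sum_(d <- muN) (lnn 171 - lnn d) / d%:R.
  have h := sum_cs (fun d => (lnn 171 - lnn d) / d%:R).
  rewrite subrr mul0r mulr0 addr0 in h; rewrite -h.
  have -> : \sum_(t <- cs) t.2 * ((lnn 171 - lnn t.1) / t.1%:R) =
      lnn 171 * (\sum_(t <- cs) t.2 / t.1%:R) - \sum_(t <- cs) t.2 / t.1%:R * lnn t.1.
    by rewrite mulr_sumr -sumrB; apply: eq_bigr => t _; ring.
  by rewrite sum_cs_inv mulr0 sub0r.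
have [k1 k2] := main_term_checkP main_term_check7.
apply: (@main_term_num prec7 (accZ prec7 muP).1 (accZ prec7 muP).2 (accZ prec7 muN).1 (accZ prec7 muN).2).
- by vm_compute.
- apply: evZ_accZ => [|d]; first (by vm_compute); exact: muP_gt0.
- apply: evZ_accZ => [|d]; first (by vm_compute); exact: muN_gt0.
- exact: k1.
- exact: k2.
Qed.
End LogNumerics.

(** * The step functions *)

Section Steps.
Variable R : realType.
Local Notation lnn := (@lnn R).
Local Notation evZ := (@evZ R).
Local Notation c171 := (@c171 R).
Local Notation cs := (@cs R).
Local Notation es := (@es R).
Local Notation Ecomb := (@Ecomb R).
Local Notation Xcomb := (@Xcomb R).
Local Notation stepf := (@stepf R).

Definition vs (s : seq (nat * nat)) : seq (nat * R) := [seq (t.1, t.2%:R / 100) | t <- s].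
(** Beyond the computed range, the sizes of the two combinations are bounded by their numbers of
    coefficients; the jump brings the step function to that level. *)
Definition tail4 : nat * nat := (Ymax.+1, (70 * 100 + 74)%N).
Definition tail3 : nat * nat := (Ymax.+1, (78 * 100 + 73)%N).
Definition vs4 := vs (tail4 :: steps4).
Definition vs3 := vs (tail3 :: steps3).

Lemma stepZ_at_vs s k : evZ (stepZ_at (stepZ s) (Z.of_nat k)) = 100 * stepf (vs s) k.
Proof.
elim: s => [|t s IH]; first by rewrite /stepf big_nil mulr0.
rewrite /stepf big_cons mulrDr -/(stepf (vs s) k) -IH /=.
case: Z.leb_spec => h.
  by rewrite evZD evZ_nat (_ : (t.1 <= k)%N = true) ?mulr1; [field|lia].
by rewrite (_ : (t.1 <= k)%N = false) ?mulr0 ?add0r //; lia.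
Qed.

Lemma evZ_abs z : evZ (Z.abs z) = `|evZ z|.
Proof.
case: (Z.abs_spec z) => [[h ->]|[h ->]]; first by rewrite ger0_norm // (ler_evZ R h).
by rewrite evZN ler0_norm //; apply: (ler_evZ R (Z.lt_le_incl _ _ h)).
Qed.

Lemma condZ_real lower s a b c k : (0 <= c)%BZ -> condZ lower s a b c k ->
  (if lower then evZ a + c171 * evZ c - 1 else 1 - (evZ a + c171 * evZ c)) +
  `|1 - evZ b| <= evZ (stepZ_at s k) / 100.
Proof.
rewrite /condZ; cbv zeta; move=> /(ler_evZ R) c0 /Z.leb_le /(ler_evZ R).
have v n : evZ (Z.of_nat n) = n%:R by apply: evZ_nat.
have v1 := v 1%N; have v2 := v 2%N; have v98 := v 98%N; have v17 := v 17%N; have v100 := v 100%N.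
rewrite [Z.of_nat _]/= in v1 v2 v98 v17 v100.
have := c171_bounds R; rewrite ler_norml => /andP[k1 k2].
have m1 : (98 * c171 + 17) * evZ c <= 1 / 50 * evZ c by apply: ler_wpM2r.
have m2 : - (1 / 50) * evZ c <= (98 * c171 + 17) * evZ c by apply: ler_wpM2r.
move: (stepZ_at s k) => S {k}.
have e1 x z : evZ (100 * (x + 98 * Z.abs (1 - b)) + 2 * z)%BZ =
  100 * (evZ x + 98 * `|1 - evZ b|) + 2 * evZ z by rewrite !(evZM, evZD) evZ_abs evZB v1 v2 v98 v100.
have e2 : evZ (98 * (a - 1) - 17 * c)%BZ = 98 * (evZ a - 1) - 17 * evZ c.
  by rewrite evZB !evZM evZB v1 v98 v17.
have e3 : evZ (98 * S)%BZ = 98 * evZ S by rewrite evZM v98.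
have m0 : (98 * c171 + 17) * evZ c = 98 * (c171 * evZ c) + 17 * evZ c by ring.
move: m1 m2; rewrite m0 {m0}.
case: lower; rewrite e1 e3 ?evZN e2;
  move: {e1 e2 e3 v1 v2 v17 v98 v100 v} (c171 * evZ c) `|1 - evZ b| c0 => X Y _ *; lra.
Qed.

Definition defect (lower : bool) q k : R :=
  (if lower then Ecomb cs k - 1 else 1 - Ecomb cs k) + `|1 - Xcomb q (es q) k|.

Lemma defect_near lower q s k : q = 3%N \/ q = 4%N -> run_check lower q s ->
  (0 < k <= Ymax)%N -> defect lower q k <= stepf (vs s) k.
Proof.
move=> q34; rewrite /run_check; cbv zeta; move: Ymax => Y hrun hk; have := runP hrun hk.
have c0 : (0 <= 0 + Z.of_nat (Hits [:: floor_ctr 171] k))%BZ by lia.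
move/(condZ_real c0); rewrite (_ : (0 + Z.of_nat k)%BZ = Z.of_nat k) // stepZ_at_vs.
rewrite !(evZB, evZD) !evZ_nat (_ : evZ 0 = 0) // !add0r /defect Ecomb_cs Xcomb_es //.
rewrite {3 6}/Hits !big_seq1 !hits_floor // => h.
by apply: le_trans h _; rewrite mulrC mulKf // pnatr_eq0.
Qed.

(** Subtract k times the vanishing sum of c_d / d: each floor function is then replaced with
    minus a fractional part. *)
Lemma Ecomb_far k : - 51 <= Ecomb cs k <= 53 - c171.
Proof.
have hc : c171 <= 0 by have := c171_bounds R; rewrite ler_norml => /andP[k1 k2]; lra.
have fl d : (0 < d)%N -> -1 <= ((k %/ d)%:R - k%:R / d%:R : R) <= 0.
  by move=> d0; have := natdiv_le R k d0; have := natdiv_gt R k d0; lra.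
have e : Ecomb cs k = \sum_(t <- cs) t.2 * ((k %/ t.1)%:R - k%:R / t.1%:R).
  have h := sum_cs_inv R.
  have -> : \sum_(t <- cs) t.2 * ((k %/ t.1)%:R - k%:R / t.1%:R) =
    Ecomb cs k - k%:R * \sum_(t <- cs) t.2 / t.1%:R.
    by rewrite mulr_sumr -sumrB; apply: eq_bigr => t _; ring.
  by rewrite h mulr0 subr0.
rewrite e (sum_cs (fun d => (k %/ d)%:R - k%:R / d%:R)).
have bd (s : seq nat) : {in s, forall d, 0 < d < 171}%N ->
    - (size s)%:R <= (\sum_(d <- s) ((k %/ d)%:R - k%:R / d%:R) : R) <= 0.
  elim: s => [|d s IH] hs; first by rewrite big_nil oppr0 lexx.
  have := IH (fun x hx => hs x (mem_behead (s := d :: s) hx)).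
  have /andP[d0 _] := hs d (mem_head _ _); have := fl d d0.
  rewrite big_cons [size _]/= -[(size s).+1%:R]natr1.
  by move: (k%:R / d%:R) ((k %/ d)%:R) (\sum_(_ <- s) _) => u v w; lra.
have /andP[p1 p2] := bd _ muP_gt0; have /andP[n1 n2] := bd _ muN_gt0.
have /andP[f1 f2] := fl 171%N isT.
have sP : size muP = 51%N by []. have sN : size muN = 53%N by [].
rewrite sP in p1; rewrite sN in n1.
move: p1 p2 n1 n2 f1 f2 hc.
move: (\sum_(d <- muP) _) (\sum_(d <- muN) _) (_ - _ / 171%:R) => x y z.
by move: c171 => c; move=> *; apply/andP; split; nra.
Qed.

Lemma chi_sum_le1 q n : (chi_sum q n)%:R <= 1 :> R.
Proof. by rewrite /chi_sum (ler_nat R _ 1) leq_b1. Qed.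

Lemma Xcomb_far q k p n : size (eP q) = p /\ size (eN q) = n ->
  - n%:R <= Xcomb q (es q) k <= p%:R.
Proof.
move=> [<- <-].
have bd (s : seq nat) : 0 <= (\sum_(d <- s) (chi_sum q (k %/ d))%:R : R) <= (size s)%:R.
  elim: s => [|d s IH]; first by rewrite big_nil lexx.
  have := chi_sum_le1 q (k %/ d); have : 0 <= (chi_sum q (k %/ d))%:R :> R by [].
  by rewrite big_cons [size _]/= -[(size s).+1%:R]natr1; lra.
rewrite /Xcomb (sum_es q (fun d => (chi_sum q (k %/ d))%:R)).
have := bd (eP q); have := bd (eN q).
by move: (eP q) (eN q) => P N; lra.
Qed.

Lemma size_e4 : size (eP 4) = 35%N /\ size (eN 4) = 34%N.
Proof. by vm_compute. Qed.

Lemma size_e3 : size (eP 3) = 40%N /\ size (eN 3) = 39%N.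
Proof. by vm_compute. Qed.

Lemma stepf_far s k : all (fun t => t.1 <= k)%N s ->
  stepf (vs s) k = (sumn [seq t.2 | t <- s])%:R / 100.
Proof.
elim: s => [|t s IH] /=; first by rewrite /stepf big_nil mul0r.
move=> /andP[h1 h2]; rewrite /stepf big_cons h1 mulr1 -/(stepf (vs s) k) IH //.
by rewrite natrD mulrDl.
Qed.

Lemma stepf_cons t s k : stepf (vs s) k <= stepf (vs (t :: s)) k.
Proof.
by rewrite {2}/stepf big_cons -/(stepf (vs s) k) lerDr mulr_ge0 ?divr_ge0.
Qed.

Lemma all_le_Ymax s k : all (fun t : nat * nat => t.1 <= Ymax.+1)%N s -> (Ymax < k)%N ->
  all (fun t => t.1 <= k)%N s.
Proof. by move=> h hk; apply: sub_all h => t ht; apply: leq_trans ht hk. Qed.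

Lemma total4 : (sumn [seq t.2 | t <- tail4 :: steps4])%:R / 100 = 87 + 1 / 5 :> R.
Proof.
rewrite (_ : sumn _ = (87 * 100 + 20)%N); last by vm_compute.
by rewrite natrD natrM; field.
Qed.

Lemma defect4 k : (0 < k)%N -> Ecomb cs k - 1 + `|1 - Xcomb 4 (es 4) k| <= stepf vs4 k.
Proof.
move=> k0; case: (leqP k Ymax) => kY.
  apply: le_trans (stepf_cons _ _ _); apply: (@defect_near true 4); [by right|exact: run_check4|].
  by rewrite k0.
have h : all (fun t : nat * nat => t.1 <= Ymax.+1)%N (tail4 :: steps4) by vm_compute.
rewrite (stepf_far (all_le_Ymax h kY)).
rewrite total4.
have := Ecomb_far k; have := Xcomb_far k size_e4.
have := c171_bounds R; rewrite ler_norml => /andP[c1 c2] /andP[x1 x2] /andP[e1 e2] {h}.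
move: (Xcomb _ _ k) (Ecomb cs k) x1 x2 e1 e2 => X E x1 x2 e1 e2.
have : `|1 - X| <= 35 by rewrite ler_norml; apply/andP; split; lra.
by move: `|1 - X| => Y hY; lra.
Qed.

Lemma total3 : (sumn [seq t.2 | t <- tail3 :: steps3])%:R / 100 = 92 + 1 / 5 :> R.
Proof.
rewrite (_ : sumn _ = (92 * 100 + 20)%N); last by vm_compute.
by rewrite natrD natrM; field.
Qed.

Lemma defect3 k : (0 < k)%N -> 1 - Ecomb cs k + `|1 - Xcomb 3 (es 3) k| <= stepf vs3 k.
Proof.
move=> k0; case: (leqP k Ymax) => kY.
  apply: le_trans (stepf_cons _ _ _); apply: (@defect_near false 3); [by left|exact: run_check3|].
  by rewrite k0.
have h : all (fun t : nat * nat => t.1 <= Ymax.+1)%N (tail3 :: steps3) by vm_compute.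
rewrite (stepf_far (all_le_Ymax h kY)).
rewrite total3.
have := Ecomb_far k; have := Xcomb_far k size_e3.
move=> /andP[x1 x2] /andP[e1 e2] {h}.
move: (Xcomb _ _ k) (Ecomb cs k) x1 x2 e1 e2 => X E x1 x2 e1 e2.
have : `|1 - X| <= 40 by rewrite ler_norml; apply/andP; split; lra.
by move: `|1 - X| => Y hY; lra.
Qed.

Lemma vs_ratio_num (P h : Z) (n : nat) (x : R) : (0 < P)%BZ -> evZ P * x <= evZ h ->
  (10 * h <= Z.of_nat n * P)%BZ -> x / 100 <= n%:R / 1000.
Proof.
move=> P0 h1 /(ler_evZ R); have Pp : 0 < evZ P by rewrite /evZ ltr0z; lia.
rewrite !evZM evZ_nat (_ : evZ 10 = 10); last exact: (evZ_nat R 10).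
move=> h2; rewrite -(ler_pM2l Pp) !mulrA; move: h1 h2.
by move: (evZ P * x) (evZ h) => u v; rewrite [n%:R * _]mulrC; move: (_ * n%:R) => w; lra.
Qed.

Lemma sum_vs_ratio s : \sum_(t <- vs s) t.2 / t.1%:R = (\sum_(t <- s) t.2%:R / t.1%:R) / 100 :> R.
Proof. by rewrite big_map mulr_suml; apply: eq_bigr => t _ /=; rewrite mulrAC. Qed.

Lemma vs_gt0 s : all (fun t : nat * nat => 0 < t.1)%N s -> {in s, forall t, 0 < t.1}%N.
Proof. by move/allP. Qed.

Lemma V4_le : \sum_(t <- vs4) t.2 / t.1%:R <= 57%:R / 1000.
Proof.
rewrite sum_vs_ratio; have h : all (fun t : nat * nat => 0 < t.1)%N (tail4 :: steps4) by vm_compute.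
have /andP[_ h2] := sumZ_ratio R prec7 (vs_gt0 h).
by apply: (vs_ratio_num _ h2); [vm_compute|vm_compute].
Qed.

Lemma V3_le : \sum_(t <- vs3) t.2 / t.1%:R <= 54%:R / 1000.
Proof.
rewrite sum_vs_ratio; have h : all (fun t : nat * nat => 0 < t.1)%N (tail3 :: steps3) by vm_compute.
have /andP[_ h2] := sumZ_ratio R prec7 (vs_gt0 h).
by apply: (vs_ratio_num _ h2); [vm_compute|vm_compute].
Qed.

Lemma sum_vs s : \sum_(t <- vs s) t.2 = (sumn [seq t.2 | t <- s])%:R / 100.
Proof.
elim: s => [|t s IH] /=; first by rewrite big_nil mul0r.
by rewrite big_cons IH natrD mulrDl.
Qed.

Lemma vs4_total : \sum_(t <- vs4) t.2 <= 93.
Proof.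
rewrite /vs4 sum_vs; move: total4; move: (sumn _)%:R => x h.
have -> : x / 100 = 87 + 1 / 5 by exact: h.
by clear; lra.
Qed.

Lemma vs3_total : \sum_(t <- vs3) t.2 <= 93.
Proof.
rewrite /vs3 sum_vs; move: total3; move: (sumn _)%:R => x h.
have -> : x / 100 = 92 + 1 / 5 by exact: h.
by clear; lra.
Qed.

Lemma cs_total : \sum_(t <- cs) `|t.2| <= 105.
Proof.
rewrite /cs !big_cat !big_map big_seq1 /=.
have n1 : `|1| = 1 :> R := normr1 R.
have := c171_bounds R; rewrite ler_norml => /andP[c1 c2].
have c3 : `|c171| <= 1 by rewrite ler_norml; apply/andP; split; lra.
have one (s : seq nat) (u : R) : `|u| = 1 -> \sum_(d <- s) `|u| = (size s)%:R.
  by move=> ->; rewrite big_const_seq count_predT iter_addr_0.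
rewrite !one ?normrN1 ?normr1 // (_ : size muP = 51%N) // (_ : size muN = 53%N) //.
by move: `|c171| c3 => c; lra.
Qed.

Lemma es_total q p n : size (eP q) = p /\ size (eN q) = n ->
  \sum_(t <- es q) `|t.2| = p%:R + n%:R.
Proof.
move=> [<- <-]; rewrite /es; move: (eP q) (eN q) => P N; rewrite big_cat !big_map /=.
by rewrite normrN1 normr1 !big_const_seq !count_predT !iter_addr_0.
Qed.

Lemma vs_pos s : all (fun t : nat * nat => 0 < t.1)%N s -> all (fun t => 0 < t.1)%N (vs s).
Proof. by rewrite all_map. Qed.

Lemma vs_ge0 s : all (fun t => 0 <= t.2) (vs s).
Proof. by rewrite all_map; apply/allP => t _ /=; rewrite divr_ge0. Qed.

End Steps.

(** * Chebyshev bounds for the two forms *)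

Section ChebyshevBounds.
Variable R : realType.
Implicit Types (n m k d N : nat).
Local Notation lnn := (@lnn R).
Local Notation Mangoldt := (@Mangoldt R).
Local Notation chi := (@chi R).
Local Notation psi := (@psi R).
Local Notation Lam_f := (@Lam_f R).
Local Notation Lam_h := (@Lam_h R).
Local Notation cs := (@cs R).

Lemma q3 : 3%N = 3%N \/ 3%N = 4%N. Proof. by left. Qed.
Lemma q4 : 4%N = 3%N \/ 4%N = 4%N. Proof. by right. Qed.

Lemma cs_le N : (170 < N)%N -> all (fun t => 0 < t.1 <= N)%N cs.
Proof.
move=> hN; have h (s : seq nat) (u : R) : {in s, forall d, 0 < d < 171}%N ->
    all (fun t => 0 < t.1 <= N)%N [seq (d, u) | d <- s].
  move=> hs; rewrite all_map; apply/allP => d /hs /andP[d0 d1] /=; rewrite d0 /=.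
  by rewrite ltnW // (leq_trans d1).
rewrite /cs !all_cat (h _ _ muP_gt0) (h _ _ muN_gt0) /= andbT.
exact: hN.
Qed.

(** The main term is between 1 and 1.002, and the coefficients have total size at most 105. *)
Lemma sum_Ecomb_bounds N : (170 < N)%N ->
  N%:R - 105 * (lnn N + 2) <= \sum_(1 <= n < N.+1) Mangoldt n * Ecomb cs (N %/ n)
  <= 1002 / 1000 * N%:R + 105 * (lnn N + 2).
Proof.
move=> hN; have := sum_Mangoldt_Ecomb (cs_le hN) (sum_cs_inv R).
have := main_term_bounds R; set A := \sum_(t <- cs) _ * lnn _; set S := \sum_(1 <= n < _) _.
move=> /andP[a1 a2]; have n0 : 0 <= N%:R :> R by [].
have l0 : 0 <= lnn N + 2 by have := lnn_ge0 R N; lra.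
have c : (\sum_(t <- cs) `|t.2|) * (lnn N + 2) <= 105 * (lnn N + 2).
  by apply: ler_wpM2r => //; apply: cs_total.
move=> /le_trans /(_ c); rewrite ler_norml => /andP[h1 h2].
have m1 : 1 * N%:R <= - A * N%:R by apply: ler_wpM2r.
have m2 : - A * N%:R <= 1002 / 1000 * N%:R by apply: ler_wpM2r.
move: m1 m2 h1 h2; rewrite [- A * _]mulNr [A * _]mulrC.
by move: (N%:R * A) (lnn N) => X l; lra.
Qed.

Lemma sum_Xcomb_bound q p n N : q = 3%N \/ q = 4%N -> size (eP q) = p /\ size (eN q) = n ->
  (0 < N)%N -> (p + n <= 79)%N ->
  `|\sum_(1 <= n < N.+1) Mangoldt n * chi q n * Xcomb q (es R q) (N %/ n)| <= 79 * lnn N.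
Proof.
move=> q34 hs N0 hpn; apply: le_trans (sum_Mangoldt_Xcomb q34 (es R q) N0) _.
apply: ler_wpM2r; first exact: lnn_ge0.
by rewrite (es_total R hs) -natrD ler_nat.
Qed.

Lemma step_pos3 : all (fun t => 0 < t.1)%N (vs3 R).
Proof. by apply: vs_pos; vm_compute. Qed.

Lemma step_pos4 : all (fun t => 0 < t.1)%N (vs4 R).
Proof. by apply: vs_pos; vm_compute. Qed.

(** One round of the upper bound, in which the remaining values of psi are estimated by the
    constant 2. *)
Lemma psi_le N : psi N <= 111 / 100 * N%:R + 105 * (lnn N + 2).
Proof.
have l0 := lnn_ge0 R N; have p2 := psi_le2 R N.
have n0 : 0 <= N%:R :> R by [].
case: (leqP N 170) => hN.
  have h : N%:R <= 170%:R :> R by rewrite ler_nat.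
  by move: (lnn N) (psi N) l0 p2 h n0 => l p; lra.
have /andP[_ e2] := sum_Ecomb_bounds hN.
have [u _] := psi_chi_upper N (@defect3 R) step_pos3.
have s := @sum_psi_step_le R _ N 2 0 step_pos3 (vs_ge0 R _) (lexx 0)
  (fun n _ => eq_ind_r (fun x => psi n <= x) (psi_le2 R n) (addr0 _)) (ler0n _ 2).
rewrite mulr0 addr0 in s.
have v : 2 * (\sum_(t <- vs3 R) t.2 / t.1%:R) * N%:R <= 2 * (54 / 1000) * N%:R.
  by apply: ler_wpM2r => //; apply: ler_wpM2l => //; apply: V3_le.
move: u e2 s v; move: (\sum_(1 <= n < _) _) (\sum_(t <- vs3 R) t.2 * _) (2 * (\sum_(t <- vs3 R) _) * N%:R) => x y z.
by move: (lnn N) (psi N) l0 => l p; lra.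
Qed.

Lemma psi_le_upto N n : (n <= N)%N -> psi n <= 111 / 100 * n%:R + 105 * (lnn N + 2).
Proof.
move=> nN; apply: le_trans (psi_le n) _; rewrite lerD2l ler_wpM2l // lerD2r.
by case: n nN => [|n] nN; [rewrite /lnn ln0 ?lnn_ge0|apply: ler_lnn].
Qed.

Lemma step_sum_le vs V N : all (fun t => 0 < t.1)%N vs -> all (fun t => 0 <= t.2) vs ->
  \sum_(t <- vs) t.2 / t.1%:R <= V -> \sum_(t <- vs) t.2 <= 93 ->
  \sum_(t <- vs) t.2 * psi (N %/ t.1) <= 111 / 100 * V * N%:R + 93 * (105 * (lnn N + 2)).
Proof.
move=> h1 h2 hV h93; have l0 := lnn_ge0 R N.
have b0 : 0 <= 105 * (lnn N + 2) by rewrite mulr_ge0 // addr_ge0.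
have a0 : 0 <= 111 / 100 :> R by rewrite divr_ge0.
apply: le_trans (sum_psi_step_le h1 h2 b0 (@psi_le_upto N) a0) _.
by apply: lerD; [apply: ler_wpM2r => //; apply: ler_wpM2l|apply: ler_wpM2r].
Qed.

(** The second round, with 1.11 for the remaining values of psi. *)
Lemma psi_chi3_le N : (170 < N)%N ->
  psi_chi R 3 N <= 1062 / 1000 * N%:R + 100 * 100 * (lnn N + 2).
Proof.
move=> hN; have l0 := lnn_ge0 R N; have n0 : 0 <= N%:R :> R by [].
have /andP[_ e2] := sum_Ecomb_bounds hN.
have [_ u] := psi_chi_upper N (@defect3 R) step_pos3.
have := sum_Xcomb_bound q3 size_e3 (leq_ltn_trans (leq0n _) hN) isT.
rewrite ler_norml => /andP[_ x2].
have s := step_sum_le N step_pos3 (vs_ge0 R _) (V3_le R) (vs3_total R).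
move: u e2 x2 s; move: (\sum_(1 <= n < _) _ * Ecomb _ _) (\sum_(1 <= n < _) _ * Xcomb _ _ _) => x y.
move: (\sum_(t <- vs3 R) _) (psi_chi R 3 N) (lnn N) l0 => z w l l0; lra.
Qed.

Lemma psi_chi4_ge N : (170 < N)%N ->
  936 / 1000 * N%:R - 100 * 100 * (lnn N + 2) <= psi_chi R 4 N.
Proof.
move=> hN; have l0 := lnn_ge0 R N; have n0 : 0 <= N%:R :> R by [].
have /andP[e1 _] := sum_Ecomb_bounds hN.
have u := psi_chi_lower N (@defect4 R) step_pos4.
have := sum_Xcomb_bound q4 size_e4 (leq_ltn_trans (leq0n _) hN) isT.
rewrite ler_norml => /andP[x1 _].
have s := step_sum_le N step_pos4 (vs_ge0 R _) (V4_le R) (vs4_total R).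
move: u e1 x1 s; move: (\sum_(1 <= n < _) _ * Ecomb _ _) (\sum_(1 <= n < _) _ * Xcomb _ _ _) => x y.
move: (\sum_(t <- vs4 R) _) (psi_chi R 4 N) (lnn N) l0 => z w l l0; lra.
Qed.

Lemma lnn10_le : lnn 10 <= 5 / 2.
Proof.
have := lnn_tangent R (isT : 0 < 10)%N (isT : 0 < 2 ^ 3)%N.
have := lnn2_le R; rewrite lnnX natrX; move: (lnn 10) (lnn 2) => x y h1 h2.
have h3 : 10 / 2 ^+ 3 = 5 / 4 :> R by field.
by move: h2; rewrite h3; lra.
Qed.

Lemma lnn_pow10_tangent N k : (0 < N)%N -> lnn N <= N%:R / 10 ^+ k - 1 + k%:R * (5 / 2).
Proof.
move=> N0; have := @lnn_tangent R N (10 ^ k) N0; rewrite expn_gt0 => /(_ isT).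
rewrite lnnX natrX => h; apply: le_trans h _; rewrite lerD2l ler_wpM2l //.
exact: lnn10_le.
Qed.

Lemma big_gt170 N : 10 ^+ 12 <= N%:R :> R -> (170 < N)%N.
Proof.
move=> h; rewrite -(ltr_nat R); apply: lt_le_trans h.
apply: (@lt_le_trans _ _ (1000)); first lra.
have -> : 1000 = 10 ^+ 3 :> R by ring.
by apply: ler_weXn2l => //; lra.
Qed.

(** The tangent at 10^8. *)
Lemma big_error N : 10 ^+ 12 <= N%:R :> R -> 100 * 100 * (lnn N + 2) <= N%:R / 1000.
Proof.
move=> h; have N0 := leq_ltn_trans (leq0n _) (big_gt170 h).
have := lnn_pow10_tangent 8 N0; move: (lnn N) => l hl.
move: (N%:R : R) h hl => x h hl.
have e : x / 10 ^+ 8 = x / (100 * 100) / (100 * 100) by field.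
have e2 : 10 ^+ 12 = 100 * 100 * (100 * 100) * (100 * 100) :> R by ring.
by move: hl h; rewrite e e2; lra.
Qed.

Lemma nat_sqrt N : exists s, (s ^ 2 <= N < s.+1 ^ 2)%N.
Proof.
elim: N => [|N [s /andP[h1 h2]]]; first by exists 0%N.
case: (ltnP N.+1 (s.+1 ^ 2)) => h; first by exists s; rewrite h (leq_trans h1).
by exists s.+1; rewrite h /=; nia.
Qed.

(** The support of h has at most 2 sqrt N elements up to N, and the tangent at 10^5 bounds the
    logarithm of sqrt N. *)
Lemma Lam_h_sum_small q N : q = 3%N \/ q = 4%N -> 10 ^+ 12 <= N%:R :> R ->
  \sum_(1 <= d < N.+1) Lam_h q d <= N%:R / 1000.
Proof.
move=> q34 h; have N0 := leq_ltn_trans (leq0n _) (big_gt170 h).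
have [s /andP[s1 s2]] := nat_sqrt N; apply: le_trans (Lam_h_count_le R q34 s2) _.
have l1 : lnn N <= 2 * lnn s.+1 by rewrite -lnnX; apply: ler_lnn => //; exact: ltnW.
have l2 := lnn_pow10_tangent 5 (ltn0Sn s).
have r1 : s%:R ^+ 2 <= N%:R :> R by rewrite -natrX ler_nat.
have r2 : N%:R < (s%:R + 1) ^+ 2 :> R by rewrite (natr1 s) -natrX ltr_nat.
rewrite -(natr1 s) in l2.
move: l1 l2 r1 r2 h; move: (s%:R : R) (ler0n R s) (N%:R : R) (lnn N) (lnn s.+1) => x x0 n l L l1 l2 r1 r2 h.
pose K : R := 10 ^+ 5.
have k5 : K = 1000 * 100 by rewrite /K; ring.
have hK : 100 * K ^+ 2 <= n by apply: le_trans h; rewrite le_eqVlt; apply/orP; left; apply/eqP; rewrite /K; ring.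
have K1 : 100 <= K by rewrite k5; lra.
have xK : 2 * K <= x.
  rewrite leNgt; apply/negP => hx.
  have : (x + 1) ^+ 2 <= (3 * K) ^+ 2 by rewrite ler_sqr ?nnegrE; lra.
  have : 0 <= K ^+ 2 by apply: sqr_ge0.
  have -> : (3 * K) ^+ 2 = 9 * K ^+ 2 by ring.
  by move: hK r2; move: (K ^+ 2) ((x + 1) ^+ 2) => u v; lra.
rewrite -/K in l2.
have a : x * ((x + 1) / K) <= x * (2 * x / K).
  by apply: ler_wpM2l => //; apply: ler_wpM2r; [rewrite invr_ge0; lra|lra].
have b : x * (2 * x / K) <= 2 / 100 * (n / 1000).
  have -> : x * (2 * x / K) = 2 / 100 * (x ^+ 2 / 1000) by rewrite k5; field.
  by rewrite expr2 in r1 *; lra.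
have c : x * L <= x * ((x + 1) / K) + 23 / 2 * x.
  apply: (@le_trans _ _ (x * ((x + 1) / K - 1 + 5%:R * (5 / 2)))); first exact: ler_wpM2l.
  by move: ((x + 1) / K) => u; rewrite le_eqVlt; apply/orP; left; apply/eqP; field.
have d : x * l <= 2 * (x * L) by rewrite mulrCA; apply: ler_wpM2l.
have e : 2 * K * x <= n by apply: le_trans r1; rewrite expr2; apply: ler_wpM2r.
have -> : 2 * x * l = 2 * (x * l) by ring.
rewrite k5 in e; move: a b c d e.
by move: (x * ((x + 1) / K)) (x * (2 * x / K)) (x * L) (x * l) => *; lra.
Qed.

(** The analogue of Chebyshev's psi for the form. *)
Definition psi_f q N : R := \sum_(1 <= d < N.+1) Lam_f q d.

Lemma psi_f_split q N : q = 3%N \/ q = 4%N ->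
  2 * psi_f q N = psi_chi R q N + \sum_(1 <= d < N.+1) Lam_h q d.
Proof.
move=> q34; rewrite mulr_sumr -big_split; apply: eq_bigr => d _ /=.
by rewrite Lam_fE // mulrDr mulr1 [chi q d * _]mulrC.
Qed.

Lemma psi_f4_ge N : 10 ^+ 12 <= N%:R :> R -> 467 / 1000 * N.+1%:R <= psi_f 4 N.
Proof.
move=> h; have hN := big_gt170 h; have e := big_error h; have p := psi_chi4_ge hN.
have s := psi_f_split N q4; have : 0 <= \sum_(1 <= d < N.+1) Lam_h 4 d.
  by apply: sumr_ge0 => d _; apply: Lam_h_ge0.
have : 1000 * 1000 <= N%:R :> R.
  apply: le_trans h; have -> : 1000 * 1000 = 10 ^+ 6 :> R by ring.
  by apply: ler_weXn2l => //; lra.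
rewrite -(natr1 N); move: p e s; clear h; move: (psi_f 4 N) (psi_chi R 4 N) (\sum_(1 <= d < _) _) => x y z.
by move: (100 * 100 * _) => w; lra.
Qed.

Lemma psi_f3_le N : 10 ^+ 12 <= N%:R :> R -> psi_f 3 N <= 532 / 1000 * N%:R.
Proof.
move=> h; have hN := big_gt170 h; have e := big_error h; have p := psi_chi3_le hN.
have s := psi_f_split N q3; have := Lam_h_sum_small q3 h.
move: p e s; clear h; move: (psi_f 3 N) (psi_chi R 3 N) (\sum_(1 <= d < _) _) => x y z.
by move: (100 * 100 * _) => w; lra.
Qed.

(** A crude bound for all N, used for the quotients N / m below 10^12. *)
Lemma psi_f_le4 q N : q = 3%N \/ q = 4%N -> psi_f q N <= 4 * N%:R.
Proof.
move=> q34; case: (posnP N) => [->|N0]; first by rewrite /psi_f big_geq // mulr0.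
have s := psi_f_split N q34.
have p : psi_chi R q N <= 2 * psi N.
  rewrite /psi_chi mulr_sumr; apply: ler_sum_nat => n _; rewrite mulrC.
  apply: ler_wpM2r; first exact: Mangoldt_ge0.
  by have := normr_chi R q n; rewrite ler_norml; lra.
have p2 := psi_le2 R N.
have [t /andP[s1 s2]] := nat_sqrt N; have u := Lam_h_count_le R q34 s2.
have l1 : lnn N <= 2 * lnn t.+1 by rewrite -lnnX; apply: ler_lnn => //; exact: ltnW.
have l2 := @lnn_tangent R t.+1 1 isT isT; rewrite divr1 lnn1 -(natr1 t) in l2.
have r1 : t%:R ^+ 2 <= N%:R :> R by rewrite -natrX ler_nat.
have m : t%:R * lnn N <= t%:R * (2 * t%:R) by apply: ler_wpM2l => //; lra.
have e : t%:R * (2 * t%:R) = 2 * t%:R ^+ 2 :> R by ring.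
rewrite e in m; rewrite -mulrA in u; move: u m r1 s p p2.
by move: (t%:R * _) (t%:R ^+ 2) (\sum_(1 <= d < _) _) (psi_f q N) (psi_chi R q N) => *; lra.
Qed.
End ChebyshevBounds.

(** * The ratio of the logarithmic means *)

Section Ratio.
Variable R : realType.
Implicit Types (n m k d N : nat).
Local Notation lnn := (@lnn R).
Local Notation Mf := (@Mf R).
Local Notation Wf := (@Wf R).
Local Notation Sff := (@Sff R).

Definition moment4 : R := 23 / 10 * (39 / 50) / 2.
Definition moment3 : R := 32 / 15 * (30 / 49) / 2.

(** W_4 increases at most like (L - 8)^(3/2) and W_3 at least like (L + 9)^(3/2), so the ratio
    of W_4 to W_3 hardly increases after N. *)
Lemma Wf_compare N n : (0 < N <= n)%N -> 9 <= lnn N ->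
  (Wf 4 n * Wf 3 N) ^+ 2 * (lnn N - 8) ^+ 3 <= (Wf 4 N * Wf 3 n) ^+ 2 * (lnn N + 9) ^+ 3.
Proof.
move=> Nn l9; have /andP[N0 Nn'] := Nn.
have g4 := @Wf_growth_le R 4 q4 N n Nn l9; have g3 := @Wf_growth_ge R 3 q3 N n Nn l9.
have ll : lnn N <= lnn n by apply: ler_lnn.
have c : (lnn n - 8) ^+ 3 <= (lnn n + 9) ^+ 3 by apply: lerXn2r; rewrite ?nnegrE; lra.
rewrite !exprMn.
apply: (@le_trans _ _ (Wf 4 N ^+ 2 * (lnn n + 9) ^+ 3 * Wf 3 N ^+ 2)).
  rewrite mulrAC; apply: ler_wpM2r; first exact: sqr_ge0.
  by apply: le_trans g4 _; apply: ler_wpM2l => //; apply: sqr_ge0.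
have s4 := sqr_ge0 (Wf 4 N); have := ler_wpM2l s4 g3.
rewrite -subr_ge0 -[_ <= Wf 4 N ^+ 2 * Wf 3 n ^+ 2 * _]subr_ge0 => h; apply: le_trans h _.
by rewrite le_eqVlt; apply/orP; left; apply/eqP; ring.
Qed.

(** The constant kappa with kappa^2 = K dominates the ratio of W_4 to W_3 from N on; so K is at
    least the quotient of the two second moments. *)
Lemma Wf_ratio N : 9 <= lnn N -> (1 < N)%N ->
  moment4 * Wf 3 N ^+ 2 * (lnn N - 8) ^+ 3 <= moment3 * Wf 4 N ^+ 2 * (lnn N + 9) ^+ 3.
Proof.
move=> l9 N1; have N0 := ltnW N1.
have w3 := Wf_pos R 3 N1; have w4 := Wf_pos R 4 N1.
have p8 : 0 < (lnn N - 8) ^+ 3 by apply: exprn_gt0; lra.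
have p9 : 0 < (lnn N + 9) ^+ 3 by apply: exprn_gt0; lra.
pose K := Wf 4 N ^+ 2 * (lnn N + 9) ^+ 3 / (Wf 3 N ^+ 2 * (lnn N - 8) ^+ 3).
have d0 : 0 < Wf 3 N ^+ 2 * (lnn N - 8) ^+ 3 by apply: mulr_gt0 p8; apply: exprn_gt0.
have K0 : 0 <= K.
  by apply: divr_ge0; [rewrite mulr_ge0 ?sqr_ge0 // ltW|exact: ltW].
suff : moment4 <= K * moment3.
  rewrite /K mulrAC ler_pdivlMr // => h.
  rewrite -[moment4 * _ * _]mulrA; apply: le_trans h _.
  by rewrite le_eqVlt; apply/orP; left; apply/eqP; ring.
have sK : Num.sqrt K ^+ 2 = K by rewrite sqr_sqrtr.
have hW n : (N <= n)%N -> Wf 4 n <= Num.sqrt K * Wf 3 n.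
  move=> Nn; have n1 := leq_trans N1 Nn.
  have x3 := Wf_pos R 3 n1; have x4 := Wf_pos R 4 n1.
  have x4' := ltW x4; have x3' := mulr_ge0 (sqrtr_ge0 K) (ltW x3).
  rewrite -ler_sqr ?nnegrE // exprMn sK.
  rewrite -(ler_pM2r d0) -[K * _ * _]mulrAC divfK; last exact: lt0r_neq0.
  have := @Wf_compare N n; rewrite N0 Nn => /(_ isT l9); rewrite !exprMn.
  by move=> h; apply: le_trans (le_trans h _); rewrite le_eqVlt; apply/orP; left; apply/eqP; ring.
have [c3 h3] := Sff3_le R; have [c4 [N4 h4]] := Sff4_ge R.
pose C := (1 + Num.sqrt K) * (Num.sqrt K + Wf 4 N).
apply: (@quadratic_compare R moment4 (K * moment3) (c4 + K * c3 + C) (maxn N4 1)) => M.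
rewrite geq_max => /andP[hM M0].
have := @Sff_compare R 4 3 (Num.sqrt K) N M (sqrtr_ge0 _) hW M0; rewrite sK -/C => h.
have u3 := ler_wpM2l K0 (h3 _ M0); have u4 := h4 _ hM.
move: h u3 u4; rewrite -/moment3 -/moment4 mulrDr.
by move: (Sff 4 M) (Sff 3 M) (lnn M) => x y l; lra.
Qed.

(** Passing from W to M costs another factor ((L + 9) / (L - 8))^2. For L >= 17000 the fifth power
    of this quotient is below 1.0056, while (moment4 / moment3) / 1.0056 is still above (7/6)^2. *)
Lemma Mf_ratio N : 17 * 1000 <= lnn N -> 7 / 6 * Mf 3 N <= Mf 4 N.
Proof.
move=> hL; have hr : lnn N + 9 <= (1 + 11 / (100 * 100)) * (lnn N - 8) by lra.
have l9 : 9 <= lnn N by lra.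
clear hL; have N1 : (1 < N)%N.
  rewrite ltnNge; apply/negP => N1; have : lnn N <= 0.
    by apply: ln_le0; rewrite (ler_nat R N 1).
  by lra.
have N0 := ltnW N1; have := Wf_ratio l9 N1.
have := @Mf_Wf R 3 q3 N N0; have := @Mf_Wf R 4 q4 N N0.
have m3 := Mf_ge0 R 3 N; have m4 := Mf_ge0 R 4 N.
have w3 := ltW (Wf_pos R 3 N1); have w4 := ltW (Wf_pos R 4 N1).
rewrite !ler_norml => /andP[a1 a2] /andP[b1 b2].
have u0 : 0 < lnn N - 8 by lra. have v0 : 0 <= lnn N + 9 by lra.
have d1 : Mf 3 N * (lnn N - 8) <= 3 / 2 * Wf 3 N by lra.
have d2 : 3 / 2 * Wf 4 N <= Mf 4 N * (lnn N + 9) by lra.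
clear a1 a2 b1 b2 l9 N0 N1; move: m3 m4 w3 w4 u0 v0 d1 d2 hr.
move: (Mf 3 N) (Mf 4 N) (Wf 3 N) (Wf 4 N) (lnn N - 8) (lnn N + 9).
move=> x y w z u v x0 y0 w0 z0 u0 v0 d1 d2 hr h.
have h32 : 0 <= 3 / 2 :> R by clear; lra.
have xu := mulr_ge0 x0 (ltW u0). have w32 := mulr_ge0 h32 w0.
have z32 := mulr_ge0 h32 z0. have yv := mulr_ge0 y0 v0.
have e1 : (x * u) ^+ 2 <= (3 / 2 * w) ^+ 2.
  by apply: lerXn2r; rewrite ?nnegrE.
have e2 : (3 / 2 * z) ^+ 2 <= (y * v) ^+ 2 by apply: lerXn2r; rewrite ?nnegrE.
have p8 : 0 <= u ^+ 3 by apply: exprn_ge0; exact: ltW.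
have p9 : 0 <= v ^+ 3 by apply: exprn_ge0.
have a40 : 0 <= moment4 by rewrite /moment4; clear; lra.
have a30 : 0 <= moment3 by rewrite /moment3; clear; lra.
have k : moment4 * x ^+ 2 * u ^+ 5 <= moment3 * y ^+ 2 * v ^+ 5.
  have f1 := ler_wpM2l a40 (ler_wpM2r p8 e1).
  have f2 := ler_wpM2l a30 (ler_wpM2r p9 e2).
  have g : moment4 * ((3 / 2 * w) ^+ 2 * u ^+ 3) <= moment3 * ((3 / 2 * z) ^+ 2 * v ^+ 3).
    have -> : moment4 * ((3 / 2 * w) ^+ 2 * u ^+ 3) = 9 / 4 * (moment4 * w ^+ 2 * u ^+ 3) by field.
    have -> : moment3 * ((3 / 2 * z) ^+ 2 * v ^+ 3) = 9 / 4 * (moment3 * z ^+ 2 * v ^+ 3) by field.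
    by apply: ler_wpM2l => //; clear; lra.
  have := le_trans f1 (le_trans g f2).
  have -> : moment4 * ((x * u) ^+ 2 * u ^+ 3) = moment4 * x ^+ 2 * u ^+ 5 by ring.
  by have -> : moment3 * ((y * v) ^+ 2 * v ^+ 3) = moment3 * y ^+ 2 * v ^+ 5 by ring.
pose r : R := 1 + 11 / (100 * 100).
have r1 : v ^+ 5 <= r ^+ 5 * u ^+ 5.
  by rewrite -exprMn; apply: lerXn2r; rewrite ?nnegrE //; exact: le_trans hr.
have r5 : r ^+ 5 <= 1 + 56 / (100 * 100) by rewrite /r; clear; lra.
have q : moment4 * x ^+ 2 <= moment3 * y ^+ 2 * (1 + 56 / (100 * 100)).
  have p5 : 0 < u ^+ 5 by apply: exprn_gt0.
  rewrite -(ler_pM2r p5); apply: le_trans k _; rewrite -[leRHS]mulrA.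
  apply: ler_wpM2l; first by rewrite mulr_ge0 // sqr_ge0.
  by apply: le_trans r1 _; rewrite ler_pM2r.
have x76 : 0 <= 7 / 6 * x by apply: mulr_ge0 => //; clear; lra.
rewrite -ler_sqr ?nnegrE //.
move: q; rewrite exprMn /moment4 /moment3; have := sqr_ge0 x; have := sqr_ge0 y.
by move: (x ^+ 2) (y ^+ 2) => X Y; clear; lra.
Qed.
End Ratio.

(** * Counting *)

Section Count.
Variable R : realType.
Implicit Types (n m k d N Y q : nat).
Local Notation lnn := (@lnn R).
Local Notation Mf := (@Mf R).
Local Notation Wf := (@Wf R).
Local Notation f_ := (@f_ R).
Local Notation psi_f := (@psi_f R).

Lemma Wf_increment q K N : (0 < K <= N)%N ->
  Wf q N - Wf q K <= Mf q N * (lnn N - lnn K).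
Proof.
move=> /andP[K0]; elim: N => [|N IH]; first by rewrite leqn0 => /eqP ->; rewrite !subrr mulr0.
rewrite leq_eqVlt => /orP[/eqP ->|]; first by rewrite !subrr mulr0.
rewrite ltnS => KN; have N0 := leq_trans K0 KN; have h := IH KN; rewrite WfS.
have l1 := lnn_step_ge0 R N; have l2 := ler_lnn R K0 KN; have m := ler_Mf R q (leqnSn N).
by move: h l1 l2 m; move: (Wf q N) (Wf q K) (Mf q N) (Mf q N.+1) => a b c d; nra.
Qed.

(** Combine [Mf_Wf] at N and at K = N / Y with W N - W K <= M N (L - ln K). The result is
    (ln K + 8) (M N - M K) <= (16 + (L - ln K) / 2) M N. *)
Lemma Mf_tail q N Y : q = 3%N \/ q = 4%N -> (0 < Y <= N)%N -> lnn Y <= 30 -> 17 * 1000 <= lnn N ->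
  Mf q N - Mf q (N %/ Y) <= 19 / (100 * 100) * Mf q N.
Proof.
move=> q34 hY l30 hL; have /andP[Y0 YN] := hY; have N0 := leq_trans Y0 YN.
have K0 : (0 < N %/ Y)%N by rewrite divn_gt0.
have KN : (0 < N %/ Y <= N)%N by rewrite K0 leq_div.
have /andP[_ l1] := lnn_div_bounds R hY.
have w := Wf_increment q KN; have m := ler_Mf R q (leq_div N Y).
have := Mf_Wf R q34 N0; have := Mf_Wf R q34 K0; have m0 := Mf_ge0 R q N.
rewrite !ler_norml => /andP[a _] /andP[_ b].
have ll : lnn (N %/ Y) <= lnn N by apply: ler_lnn => //; apply: leq_div.
have big : 169 * 100 <= lnn (N %/ Y) + 8 by lra.
have d : lnn N - lnn (N %/ Y) <= 31 by lra.
clear hL l1 l30 K0 KN hY Y0 YN N0 q34.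
move: (lnn N) (lnn (N %/ Y)) (Mf q N) (Mf q (N %/ Y)) (Wf q N) (Wf q (N %/ Y)) w m m0 a b ll big d.
move=> L l x y u v w m m0 a b ll big d.
have e1 : (l + 8) * (x - y) <= (16 + (L - l) / 2) * x by lra.
have e2 : (16 + (L - l) / 2) * x <= 63 / 2 * x by apply: ler_wpM2r => //; lra.
have e3 : 169 * 100 * (x - y) <= (l + 8) * (x - y) by apply: ler_wpM2r => //; lra.
by lra.
Qed.

Definition Cf q N : R := \sum_(1 <= n < N.+1) f_ q n.

Lemma sum_f_lnn q N : \sum_(1 <= n < N.+1) f_ q n * lnn n =
  \sum_(1 <= m < N.+1) f_ q m * psi_f q (N %/ m).
Proof.
rewrite /psi_f -sum_conv; apply: eq_big_nat => n /andP[n0 _].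
by rewrite (f_log_deriv R q n0); apply: convC.
Qed.

Lemma ler_Cf_lnn q N : \sum_(1 <= n < N.+1) f_ q n * lnn n <= Cf q N * lnn N.
Proof.
rewrite mulr_suml; apply: ler_sum_nat => n /andP[n0 nN].
by apply: ler_wpM2l; [exact: f_ge0|exact: ler_lnn].
Qed.

Lemma sum_f_psi4_ge N Y : (0 < Y)%N -> 10 ^+ 12 <= Y%:R :> R ->
  467 / 1000 * N%:R * Mf 4 (N %/ Y) <= \sum_(1 <= m < N.+1) f_ 4 m * psi_f 4 (N %/ m).
Proof.
move=> Y0 hY; have h0 m : 0 <= f_ 4 m * psi_f 4 (N %/ m).
  by rewrite mulr_ge0 ?f_ge0 // sumr_ge0 // => d _; exact: Lam_f_ge0.
rewrite (@big_cat_nat _ _ _ (N %/ Y).+1) ?ltnS ?leq_div //=.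
rewrite -[leLHS]addr0; apply: lerD; last by rewrite sumr_ge0.
rewrite mulr_sumr; apply: ler_sum_nat => m /andP[m0 mK].
have mY : (Y <= N %/ m)%N by rewrite leq_divRL // mulnC -leq_divRL.
have hm : 10 ^+ 12 <= (N %/ m)%:R :> R by apply: le_trans hY _; rewrite ler_nat.
have -> : 467 / 1000 * N%:R * (f_ 4 m / m%:R) = f_ 4 m * (467 / 1000 * (N%:R / m%:R)) by ring.
apply: ler_wpM2l; first exact: f_ge0.
apply: le_trans (psi_f4_ge hm); apply: ler_wpM2l; first by clear; lra.
exact: ltW (natdiv_gt R N m0).
Qed.

Lemma sum_f_psi3_le N Y : (0 < Y)%N -> 10 ^+ 12 <= Y%:R :> R ->
  \sum_(1 <= m < N.+1) f_ 3 m * psi_f 3 (N %/ m) <=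
  532 / 1000 * N%:R * Mf 3 N + 4 * N%:R * (Mf 3 N - Mf 3 (N %/ Y)).
Proof.
move=> Y0 hY; have KN : ((N %/ Y).+1 <= N.+1)%N by rewrite ltnS leq_div.
have cut (F : nat -> R) : \sum_(1 <= m < N.+1) F m =
    \sum_(1 <= m < (N %/ Y).+1) F m + \sum_((N %/ Y).+1 <= m < N.+1) F m.
  by rewrite -big_cat_nat.
have -> : Mf 3 N - Mf 3 (N %/ Y) = \sum_((N %/ Y).+1 <= m < N.+1) f_ 3 m / m%:R.
  by rewrite /Mf cut addrC addKr.
rewrite cut; apply: lerD.
  apply: (@le_trans _ _ (532 / 1000 * N%:R * Mf 3 (N %/ Y))); last first.
    by apply: ler_wpM2l; [rewrite mulr_ge0 //; clear; lra|apply: ler_Mf; exact: leq_div].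
  rewrite mulr_sumr; apply: ler_sum_nat => m /andP[m0 mK].
  have mY : (Y <= N %/ m)%N by rewrite leq_divRL // mulnC -leq_divRL.
  have hm : 10 ^+ 12 <= (N %/ m)%:R :> R by apply: le_trans hY _; rewrite ler_nat.
  have -> : 532 / 1000 * N%:R * (f_ 3 m / m%:R) = f_ 3 m * (532 / 1000 * (N%:R / m%:R)) by ring.
  apply: ler_wpM2l; first exact: f_ge0.
  apply: le_trans (psi_f3_le hm) _; apply: ler_wpM2l; first by clear; lra.
  exact: natdiv_le.
rewrite mulr_sumr; apply: ler_sum_nat => m /andP[m0 _].
have -> : 4 * N%:R * (f_ 3 m / m%:R) = f_ 3 m * (4 * (N%:R / m%:R)) by ring.
apply: ler_wpM2l; first exact: f_ge0.
apply: le_trans (psi_f_le4 R _ q3) _; apply: ler_wpM2l => //.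
by apply: natdiv_le; apply: leq_trans m0.
Qed.

(** For n above N / Y the inequality ln (N / n) <= N / n is sharp enough, since M varies little
    there; below it there are few integers. *)
Lemma Cf_defect_le q N Y : (0 < Y <= N)%N ->
  Cf q N * lnn N - \sum_(1 <= n < N.+1) f_ q n * lnn n <=
  N%:R / Y%:R * (lnn Y + 2) + N%:R * (Mf q N - Mf q (N %/ Y)).
Proof.
move=> hY; have /andP[Y0 YN] := hY; have N0 := leq_trans Y0 YN.
have KN : ((N %/ Y).+1 <= N.+1)%N by rewrite ltnS leq_div.
have K0 : (0 < N %/ Y)%N by rewrite divn_gt0.
have cut (F : nat -> R) : \sum_(1 <= m < N.+1) F m =
    \sum_(1 <= m < (N %/ Y).+1) F m + \sum_((N %/ Y).+1 <= m < N.+1) F m.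
  by rewrite -big_cat_nat.
have -> : Mf q N - Mf q (N %/ Y) = \sum_((N %/ Y).+1 <= m < N.+1) f_ q m / m%:R.
  by rewrite /Mf cut addrC addKr.
rewrite mulr_suml -sumrB cut; apply: lerD; last first.
  rewrite mulr_sumr; apply: ler_sum_nat => n /andP[Kn _].
  have n0 : (0 < n)%N by apply: leq_trans Kn.
  have -> : N%:R * (f_ q n / n%:R) = f_ q n * (N%:R / n%:R) by ring.
  rewrite -mulrBr; apply: ler_wpM2l; first exact: f_ge0.
  by have := lnn_tangent R N0 n0; lra.
apply: (@le_trans _ _ (\sum_(1 <= n < (N %/ Y).+1) (lnn N - lnn n))).
  apply: ler_sum_nat => n /andP[n0 nK]; rewrite -mulrBr.
  apply: ler_piMl; last exact: f_le1.
  rewrite subr_ge0; apply: ler_lnn => //; apply: leq_trans (leq_div N Y); exact: nK.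
rewrite sumrB sumr_const_nat subn1 /= -/(T R (N %/ Y)) -[lnn N *+ _]mulr_natl.
have t := T_ge R (N %/ Y); have /andP[_ l] := lnn_div_bounds R hY.
have d := natdiv_le R N Y0; have ly := lnn_ge0 R Y.
have e : (N %/ Y)%:R * (lnn N - lnn (N %/ Y) + 1) <= (N %/ Y)%:R * (lnn Y + 2).
  by apply: ler_wpM2l => //; lra.
have e2 : (N %/ Y)%:R * (lnn Y + 2) <= N%:R / Y%:R * (lnn Y + 2).
  by apply: ler_wpM2r => //; lra.
apply: le_trans e2; apply: le_trans e; move: t.
by rewrite mulrDr mulrBr mulr1; move: (_ * lnn N) (_ * lnn (N %/ Y)) => *; lra.
Qed.

Lemma Cf_compare N Y : (0 < Y <= N)%N -> 10 ^+ 12 <= Y%:R :> R -> lnn Y <= 30 ->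
  17 * 1000 <= lnn N -> Cf 3 N <= Cf 4 N.
Proof.
move=> hY hY12 l30 hL; have /andP[Y0 YN] := hY.
have r := Mf_ratio hL.
have t3 := Mf_tail q3 hY l30 hL; have t4 := Mf_tail q4 hY l30 hL.
have s4 := sum_f_psi4_ge N Y0 hY12; have s3 := sum_f_psi3_le N Y0 hY12.
have d3 := Cf_defect_le 3 hY; have u4 := ler_Cf_lnn 4 N.
have m3 := Mf_ge1 R 3 (leq_trans Y0 YN).
rewrite !sum_f_lnn in d3 u4.
have e : N%:R / Y%:R * (lnn Y + 2) <= 1 / 1000 * (N%:R : R).
  have Yp : 0 < Y%:R :> R by rewrite ltr0n.
  rewrite mulrAC ler_pdivrMr //; apply: (@le_trans _ _ (N%:R * 32)).
    by apply: ler_wpM2l => //; lra.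
  rewrite mulrAC [leRHS]mulrC; apply: ler_wpM2l => //.
  have : 100 ^+ 6 <= Y%:R :> R.
    by apply: le_trans hY12; rewrite le_eqVlt; apply/orP; left; apply/eqP; ring.
  have : 100 ^+ 3 <= 100 ^+ 6 :> R by apply: ler_weXn2l => //; clear; lra.
  have -> : 100 ^+ 3 = 100 * 100 * 100 :> R by ring.
  by move: (100 ^+ 6) (Y%:R) => a y h1 h2; lra.
have L0 : 0 < lnn N by lra.
rewrite -(ler_pM2r L0).
have n0 : 0 <= N%:R :> R by [].
clear hL l30 hY12.
move: (lnn N) L0 s4 s3 d3 u4 => L L0 s4 s3 d3 u4.
apply: le_trans u4; apply: le_trans s4.
have k1 : Cf 3 N * L <= 1 / 1000 * N%:R + 532 / 1000 * N%:R * Mf 3 N + 5 * (N%:R * (Mf 3 N - Mf 3 (N %/ Y))).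
  move: d3 s3 e; move: (\sum_(1 <= m < _) _) (_ / _ * (_ + 2)) => S E.
  by move: (Mf 3 N) (Mf 3 N - Mf 3 (N %/ Y)) => m D; clear -S E D m; lra.
apply: le_trans k1 _.
have k2 := ler_wpM2l n0 t3.
have k3 : N%:R * ((1 - 19 / (100 * 100)) * (7 / 6 * Mf 3 N)) <= N%:R * Mf 4 (N %/ Y).
  apply: ler_wpM2l => //; lra.
have k4 : N%:R * 1 <= N%:R * Mf 3 N by apply: ler_wpM2l.
move: n0 k2 k3 k4.
have -> : N%:R * (19 / (100 * 100) * Mf 3 N) = 19 / (100 * 100) * (N%:R * Mf 3 N) by ring.
have -> : N%:R * ((1 - 19 / (100 * 100)) * (7 / 6 * Mf 3 N)) =
  (1 - 19 / (100 * 100)) * (7 / 6) * (N%:R * Mf 3 N) by ring.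
rewrite -[532 / 1000 * _ * _]mulrA -[467 / 1000 * _ * _]mulrA mulr1.
(* 0.001 + 0.532 + 5 * 0.0019 = 0.5425 is less than 0.467 * 0.9981 * 7/6 = 0.5437 *)
move: (N%:R : R) (Mf 3 N) (Mf 4 _) (Mf 3 N - Mf 3 _) => n y z x; clear; lra.
Qed.

(** The existential quantifier hides the power of 10 from computation. *)
Lemma Y_exists : exists Y, [/\ (0 < Y)%N, 10 ^+ 12 <= Y%:R :> R & lnn Y <= 30].
Proof.
exists (10 ^ 12)%N; split; first by rewrite expn_gt0.
  by rewrite natrX.
by rewrite lnnX; have := lnn10_le R; move: (lnn 10) => x h; lra.
Qed.

Lemma lnn10_ge : 19 / 10 <= lnn 10.
Proof.
have h n : (0 < n)%N -> n.+1%:R^-1 <= lnn n.+1 - lnn n by apply: lnn_step_ge.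
have h1 := h 1%N isT; have h2 := h 2%N isT; have h3 := h 3%N isT; have h4 := h 4%N isT.
have h5 := h 5%N isT; have h6 := h 6%N isT; have h7 := h 7%N isT; have h8 := h 8%N isT.
have h9 := h 9%N isT; rewrite lnn1 in h1; clear h.
move: (lnn 2) (lnn 3) (lnn 4) (lnn 5) (lnn 6) (lnn 7) (lnn 8) (lnn 9) (lnn 10) h1 h2 h3 h4 h5 h6 h7 h8 h9.
by move=> *; lra.
Qed.

(** The exponent is a bound number, so that powers of 10 are not computed. *)
Lemma lnn_truncn_ge e (x : R) : (9 * 1000 <= e)%N -> 10 ^+ e <= x ->
  17 * 1000 <= lnn (Num.truncn x).
Proof.
move=> he hx; have x0 : 0 <= x by apply: le_trans hx; apply: exprn_ge0.
have hN : (10 ^ e <= Num.truncn x)%N by rewrite truncn_ge_nat // natrX.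
apply: (@le_trans _ _ (lnn (10 ^ e))); last first.
  by apply: ler_lnn hN; rewrite expn_gt0.
rewrite lnnX; apply: (@le_trans _ _ ((9 * 1000)%N%:R * lnn 10)).
  by rewrite natrM; have := lnn10_ge; move: (lnn 10) => l; clear; lra.
by apply: ler_wpM2r; [exact: lnn_ge0|rewrite ler_nat].
Qed.

Lemma b3_le n : (0 < n)%N -> (b 3 n)%:R <= f_ 3 n.
Proof.
move=> n0; rewrite /b; case: asboolP => [[X [Y e]]|_]; last exact: f_ge0.
have := loeschian_even_on n0 e; rewrite /f_ /adm /even_on /inert => h.
by rewrite (_ : all _ _ = true) //; apply: sub_all h => p hp.
Qed.

Lemma b1_ge n : (0 < n)%N -> f_ 4 n <= (b 1 n)%:R.
Proof.
move=> n0; rewrite /f_; case: (boolP (adm _ _ _)) => [h|_]; last by [].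
have h2 : even_on (fun p => p %% 4 == 3)%N n by apply: sub_all h => p hp.
have [X [Y e]] := even_on_sum_two_squares n0 h2.
rewrite /b asboolT //; exists X, Y; rewrite e; ring.
Qed.

End Count.

Theorem corollary1 (R : realType) (x : R) (hx : 10 ^+ 9111 <= x) :
  (B 3 x <= B 1 x)%N.
Proof.
have he : (9 * 1000 <= 9111)%N by vm_compute.
have := lnn_truncn_ge he hx; rewrite /B; move: (Num.truncn x) => N hL; clear he hx.
have [Y [Y0 hY l30]] := Y_exists R.
have YN : (0 < Y <= N)%N.
  rewrite Y0 leqNgt; apply/negP => NY; case: (posnP N) => [N0|N0].
    by move: hL; rewrite N0 /lnn ln0 //; clear; lra.
  by have := ler_lnn R N0 (ltnW NY); clear hY; lra.
have h := Cf_compare YN hY l30 hL.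
rewrite -(ler_nat R) !natr_sum; apply: le_trans (le_trans h _).
  by apply: ler_sum_nat => n /andP[n0 _]; apply: b3_le.
by apply: ler_sum_nat => n /andP[n0 _]; apply: b1_ge.
Qed.
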